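(* Let $d\ge3$ and $p\in(d,+\infty]$ (with $1/p=0$ if $p=\infty$). There exists a constant $C_0\ge1$, depending only on $p$ and $d$, such that the following holds. Suppose $u$ is a strong Navier--Stokes solution with initial data $u_0\in L^p_\sigma(\mathbb{R}^d)$ whose maximal time of existence $T^*=T^*(u_0)$ is finite. For $t\in(0,T^* )$ define $\gamma_p(t)$ by $$\|u(\cdot,t)\|_{L^p}(T^*-t)^{\frac12(1-\frac dp)}\gamma_p(t)=c_p$$ and $T_1(t)>0$ by $$\|u(\cdot,t)\|_{L^p}\,T_1(t)^{\frac12(1-\frac dp)}=\frac{\gamma_p(t)}{2C_1}.$$ Then, for all $t\in(0,T^* )$, $u(\cdot,t)$ fails to be $(\varepsilon,\beta,\ell)$-sparse in $L^p$ with $\ell=\sqrt{T_1(t)}\,\bar\ell$, for any dimensionless parameters $\varepsilon,\beta\in(0,1)$, $\bar\ell>0$ satisfying $$\bar\ell^2\ge C_0\log(C_0/\gamma_p(t)),\qquad\beta=C_0^{-1}\gamma_p(t),\qquad\varepsilon^{1-\frac1p}\le C_0^{-1}\gamma_p(t)/\bar\ell^{\,d}.$$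
   Context: Navier--Stokes equations on $\mathbb{R}^d$: $\partial_t u+u\cdot\nabla u-\Delta u+\nabla p=0$, $\operatorname{div}u=0$, $u(\cdot,0)=u_0$. $L^p_\sigma(\mathbb{R}^d)$ is the space of (weakly) divergence-free vector fields in $L^p(\mathbb{R}^d)$. A mild solution satisfies $u(\cdot,t)=e^{t\Delta}u_0-\int_0^t e^{(t-s)\Delta}\mathbb{P}\nabla\cdot(u\otimes u)\,ds$, with $\mathbb{P}$ the Leray projector; the strong ($L^p$) solution on $(0,T)$ is the unique mild solution that is in $C((0,T);L^p)$ and is bounded in $L^p$ on $(0,T')$ for each $T'<T$. $T^*(u_0)$ is its maximal time of existence. Constants. $c_p\in(0,1]$ is a fixed small constant (depending on $d,p$) such that for each $u_0\in L^p_\sigma$, with $\bar T$ defined by $\|u_0\|_{L^p}\bar T^{\frac12(1-\frac dp)}=c_p$, there is a unique mild solution $u\in C((0,\bar T];L^p)$, and it satisfies $\sup_{t\in(0,\bar T)}\|u(\cdot,t)\|_{L^p}\le 2\|u_0\|_{L^p}$. $C_1\ge(2c_p)^{-1}$ is a fixed constant (depending on $d,p$) such that for all such $u_0$ and all $t\in(0,\bar T)$, $\big\|\int_0^t e^{(t-s)\Delta}\mathbb{P}\nabla\cdot(u\otimes u)\,ds\big\|_{L^p}\le C_1t^{\frac12(1-\frac dp)}\|u_0\|_{L^p}^2$. Sparseness. For $1\le p\le\infty$, $\varepsilon,\beta\in(0,1)$, $\ell>0$, a vector field $v\in L^p(\mathbb{R}^d)$ is $(\varepsilon,\beta,\ell)$-sparse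 in $L^p$ if there is a measurable set $S\subset\mathbb{R}^d$ with $\|v\|_{L^p(S^c)}<\beta\|v\|_{L^p}$ and $\sup_{x_0\in\mathbb{R}^d}|S\cap B_\ell(x_0)|/|B_\ell(x_0)|\le\varepsilon$. *)

(* Defs.v *)
From HB Require Import structures.
From mathcomp Require Import all_boot all_order all_algebra.
From mathcomp Require Import all_classical all_reals all_analysis.
Set Implicit Arguments.
Unset Strict Implicit.
Unset Printing Implicit Defensive.
Import Order.TTheory GRing.Theory Num.Theory.
Import numFieldNormedType.Exports.
Local Open Scope classical_set_scope.
Local Open Scope ring_scope.

(* R^n is ['rV[R]_n]; the sigma-algebra generated by the coordinates is the
   Borel one. *)

Definition measure_rV_display : measure_display -> measure_display.
Proof. exact. Qed.

Section measurable_rV.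
Context {d : measure_display} {T : sigmaRingType d}.
Variable n : nat.

Let coords : 'I_n -> 'rV[T]_n -> T := fun i x => x ord0 i.

Let rV_set0 : g_sigma_preimage coords set0.
Proof. exact: sigma_algebra0. Qed.

Let rV_setC A : g_sigma_preimage coords A -> g_sigma_preimage coords (~` A).
Proof. exact: sigma_algebraC. Qed.

Let rV_bigcup (F : _^nat) : (forall i, g_sigma_preimage coords (F i)) ->
  g_sigma_preimage coords (\bigcup_i (F i)).
Proof. exact: sigma_algebra_bigcup. Qed.

HB.instance Definition _ := @isMeasurable.Build (measure_rV_display d)
  'rV[T]_n (g_sigma_preimage coords) rV_set0 rV_setC rV_bigcup.

End measurable_rV.

Lemma measurable_coord d (T : sigmaRingType d) n (i : 'I_n) :
  measurable_fun [set: 'rV[T]_n] (fun x : 'rV[T]_n => x ord0 i).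
Proof.
move=> _ Y mY; rewrite setTI; apply: sub_sigma_algebra => /=.
rewrite -bigcup_seq/=; exists i => /=; first by rewrite mem_index_enum.
by exists Y => //; rewrite setTI.
Qed.

Lemma measurable_fun_rVP d1 d2 (T1 : measurableType d1)
    (T2 : sigmaRingType d2) n (f : T1 -> 'rV[T2]_n) :
  measurable_fun [set: T1] f <->
  forall i, measurable_fun [set: T1] (fun x => f x ord0 i).
Proof.
split=> [mf i|mf _ A mA].
  move=> _ Y mY; have := @measurable_coord _ T2 n i measurableT Y mY.
  by rewrite setTI => /(mf measurableT); rewrite !setTI.
rewrite setTI; move: A mA; apply: smallest_sub.
  split=> [|A mA|F mF]; rewrite /=.
  - by rewrite preimage_set0.
  - by rewrite setTD preimage_setC; exact: measurableC.
  - by rewrite preimage_bigcup; exact: bigcup_measurable.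
move=> A; rewrite -bigcup_seq/= => -[i _ [B mB <-]].
by rewrite setTI; have := mf i measurableT B mB; rewrite setTI.
Qed.

Section lebesgue_rV.
Context {R : realType}.

Definition cons_rV n (x : R * 'rV[R]_n) : 'rV[R]_n.+1 :=
  \row_i (if unlift ord0 i is Some j then x.2 ord0 j else x.1).

Definition uncons_rV n (v : 'rV[R]_n.+1) : R * 'rV[R]_n :=
  (v ord0 ord0, \row_i v ord0 (lift ord0 i)).

Lemma cons_rV0 n (x : R * 'rV[R]_n) : cons_rV x ord0 ord0 = x.1.
Proof. by rewrite mxE unlift_none. Qed.

Lemma cons_rVS n (x : R * 'rV[R]_n) i :
  cons_rV x ord0 (lift ord0 i) = x.2 ord0 i.
Proof. by rewrite mxE liftK. Qed.

Lemma cons_rVK n : cancel (@cons_rV n) (@uncons_rV n).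
Proof.
case=> a v; rewrite /uncons_rV cons_rV0; congr pair.
by apply/rowP => i; rewrite mxE cons_rVS.
Qed.

Lemma measurable_cons_rV n :
  measurable_fun [set: measurableTypeR R * 'rV[R]_n] (@cons_rV n).
Proof.
apply/measurable_fun_rVP => i; have [j ->|->] := unliftP ord0 i; last first.
- by under eq_fun do rewrite cons_rV0; exact: measurable_fst.
- under eq_fun do rewrite cons_rVS.
  exact: (measurableT_comp (@measurable_coord _ R n j)).
Qed.

Lemma measurable_uncons_rV n : measurable_fun [set: 'rV[R]_n.+1]
  (@uncons_rV n : _ -> measurableTypeR R * 'rV[R]_n).
Proof.
apply: measurable_fun_pair; first exact: (@measurable_coord _ R).
apply/measurable_fun_rVP => i; under eq_fun do rewrite mxE.
exact: (@measurable_coord _ R).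
Qed.

Section step.
Variables (n : nat) (mu : {sigma_finite_measure set 'rV[R]_n -> \bar R}).

Definition cons_measure : set 'rV[R]_n.+1 -> \bar R :=
  pushforward (lebesgue_measure \x mu)%E (@cons_rV n).

HB.instance Definition _ := Measure.copy cons_measure
  (@measure_function_pushforward__canonical__measure_function_Measure
     _ _ _ _ _ (lebesgue_measure \x mu)%E _ (@measurable_cons_rV n)).

Let sigma_finite_cons : sigma_finite setT cons_measure.
Proof.
have /sigma_finiteP[F [TF ndF Foo]] := sigma_finiteT (@lebesgue_measure R).
have /sigma_finiteP[G [TG ndG Goo]] := sigma_finiteT mu.
have FGT : setT = \bigcup_k (F k `*` G k).
  rewrite -setXTT TF TG predeqE => -[x y]; split.
    move=> [/= [k _ Fkx] [l _ Gly]]; exists (maxn k l) => //; split.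
    - by move: x Fkx; exact/subsetPset/ndF/leq_maxl.
    - by move: y Gly; exact/subsetPset/ndG/leq_maxr.
  by move=> [k _ []/= ? ?]; split; exists k.
exists (fun k => @uncons_rV n @^-1` (F k `*` G k)).
  by rewrite -preimage_bigcup -FGT.
move=> k; have [mF oF] := Foo k; have [mG oG] := Goo k; split.
  rewrite -[X in measurable X]setTI.
  by apply: measurable_uncons_rV => //; exact: measurableX.
rewrite /cons_measure /pushforward -comp_preimage.
rewrite (_ : _ \o _ = id); last by apply/funext => x /=; rewrite cons_rVK.
by rewrite preimage_id product_measure1E// lte_mul_pinfty// ge0_fin_numE.
Qed.

HB.instance Definition _ :=
  Measure_isSigmaFinite.Build _ _ _ cons_measure sigma_finite_cons.

End step.

(* Iterated product of [lebesgue_measure]; on R^0 it is the unit mass. *)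
Fixpoint lebesgue_rV n : {sigma_finite_measure set 'rV[R]_n -> \bar R} :=
  if n is m.+1 then cons_measure (lebesgue_rV m) else \d_(0 : 'rV[R]_0).

End lebesgue_rV.

Section lebesgue_rV_box.
Context {R : realType}.

Lemma lebesgue_rV_box n (A : 'I_n -> set R) : (forall i, measurable (A i)) ->
  (lebesgue_rV n [set v : 'rV[R]_n | forall i, A i (v ord0 i)] =
   \prod_(i < n) lebesgue_measure (A i))%E.
Proof.
elim: n A => [|n IH] A mA.
  rewrite big_ord0 /= (_ : [set v | _] = setT) ?diracT//.
  by apply/seteqP; split=> // v _ [].
rewrite big_ord_recl -IH; last by move=> i; exact: mA.
have mAS : measurable [set v : 'rV[R]_n | forall i, A (lift ord0 i) (v ord0 i)].
  rewrite (_ : [set v | _] = \bigcap_(i in [set: 'I_n])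
      ((fun v : 'rV[R]_n => v ord0 i) @^-1` A (lift ord0 i))); last first.
    by apply/seteqP; split=> v /= Av i => [_|]; exact: Av.
  apply: fin_bigcap_measurable => // i _; rewrite -[X in measurable X]setTI.
  exact: (@measurable_coord _ R).
rewrite -product_measure1E//; last exact: mA.
rewrite /= /cons_measure /pushforward; congr (product_measure1 _ _ _).
apply/seteqP; split=> -[x v] /=.
  move=> Av; split=> [|i]; first by have := Av ord0; rewrite cons_rV0.
  by have := Av (lift ord0 i); rewrite cons_rVS.
move=> [Ax Av] i; have [j ->|->] := unliftP ord0 i; last by rewrite cons_rV0.
by rewrite cons_rVS.
Qed.

End lebesgue_rV_box.

Section navier_stokes.
Context {R : realType} {d : nat}.
Local Notation field := ('rV[R]_d -> 'rV[R]_d).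
Implicit Types (x y : 'rV[R]_d) (v : field) (u w : R -> field)
  (p : \bar R) (I : set R).

Local Notation mu := (@lebesgue_rV R d).
Local Notation leb := (@lebesgue_measure R).

(* Euclidean; the library norm [`|x|] on ['rV[R]_d] is the maximum norm. *)
Definition enorm x : R := Num.sqrt (\sum_(i < d) x ord0 i ^+ 2).

Definition eball x (r : R) : set 'rV[R]_d := [set y | enorm (y - x) < r].

Definition Lp_norm p v : \bar R := 'N[mu]_p[(fun x => (enorm (v x))%:E)].

Definition Lp_norm_on (D : set 'rV[R]_d) p v : \bar R :=
  'N[mu]_p[(fun x => (enorm (v x))%:E) \_ D].

Definition in_Lp p v : Prop :=
  measurable_fun [set: 'rV[R]_d] v /\ (Lp_norm p v < +oo)%E.

Definition partial (i : 'I_d) (f : 'rV[R]_d -> R) : 'rV[R]_d -> R :=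
  fun x => 'D_(delta_mx ord0 i) f x.

Definition partials (s : seq 'I_d) (f : 'rV[R]_d -> R) : 'rV[R]_d -> R :=
  foldr partial f s.

Definition smooth (f : 'rV[R]_d -> R) : Prop :=
  forall s : seq 'I_d, continuous (partials s f) /\
    forall i x, derivable (partials s f) x (delta_mx ord0 i).

Definition test_function (phi : 'rV[R]_d -> R) : Prop :=
  smooth phi /\ exists r : R, forall x, r < enorm x -> phi x = 0.

Definition weakly_divergence_free v : Prop :=
  forall phi, test_function phi ->
    \int[mu]_x (\sum_(i < d) v x ord0 i * partial i phi x) = 0.

Definition in_Lp_sigma p v : Prop := in_Lp p v /\ weakly_divergence_free v.

Definition heat_kernel (t : R) x : R :=
  (4 * pi * t) `^ (- (d%:R / 2)) * expR (- (enorm x ^+ 2 / (4 * t))).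

Definition heat (t : R) v x : 'rV[R]_d :=
  \row_i \int[mu]_y (heat_kernel t (x - y) * v y ord0 i).

(* Kernel of [e^{t Delta} P_ij partial_k].  The Leray projector is
   [P_ij = delta_ij + partial_i partial_j (- Delta)^-1] and
   [(- Delta)^-1 e^{t Delta} = \int_t^oo e^{s Delta} ds].  The individual
   factors need not act on [L^oo], but this kernel is in [L^1]. *)
Definition oseen_kernel (t : R) (i j k : 'I_d) x : R :=
  (i == j)%:R * partial k (heat_kernel t) x +
  \int[leb]_(s in `]t, +oo[) partial i (partial j (partial k (heat_kernel s))) x.

(* [e^{t Delta} P div (v (x) v)], with [div F = (\sum_k partial_k F_jk)_j]. *)
Definition heat_leray_div (t : R) v x : 'rV[R]_d :=
  \row_i \int[mu]_y (\sum_(j < d) \sum_(k < d)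
    oseen_kernel t i j k (x - y) * (v y ord0 j * v y ord0 k)).

Definition duhamel u (t : R) x : 'rV[R]_d :=
  \row_i \int[leb]_(s in `]0, t[) heat_leray_div (t - s) (u s) x ord0 i.

(* In the definitions below, [I] stands for [`]0, T[] or [`]0, T]]. *)
Definition mild_on I (u0 : field) u : Prop :=
  forall t, I t -> {ae mu, forall x, u t x = heat t u0 x - duhamel u t x}.

Definition Lp_continuous_on p I u : Prop :=
  forall t, I t ->
    Lp_norm p (fun x => u s x - u t x) @[s --> within I (nbhs t)] --> 0%E.

Definition Lp_bounded_on p I u : Prop :=
  forall T', I T' -> exists M : R,
    forall t, 0 < t <= T' -> (Lp_norm p (u t) <= M%:E)%E.

(* [in_Lp_sigma] includes the equation [div u = 0]. *)
Definition strong_solution_on p I (u0 : field) u : Prop :=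
  [/\ forall t, I t -> in_Lp_sigma p (u t),
      Lp_continuous_on p I u, Lp_bounded_on p I u & mild_on I u0 u].

Definition max_existence_time p (u0 : field) : \bar R :=
  ereal_sup [set T%:E | T in [set T : R |
    0 < T /\ exists u, strong_solution_on p `]0, T[ u0 u]].

(* [(1 - d/p)/2]; the inverse of [+oo] in [\bar R] is [0]. *)
Definition scaling_exponent p : R := (1 - d%:R * fine p^-1%E) / 2.

(* Uniqueness is among the mild solutions that are bounded near [t = 0].  For
   [u0 = 0] no time [T] satisfies the defining equation, and nothing is
   required. *)
Definition is_cp p (cp : R) : Prop :=
  0 < cp <= 1 /\
  forall u0 : field, in_Lp_sigma p u0 -> forall T : R, 0 < T ->
  (Lp_norm p u0 * (T `^ scaling_exponent p)%:E = cp%:E)%E ->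
  exists u, [/\ strong_solution_on p `]0, T] u0 u,
    (forall w, strong_solution_on p `]0, T] u0 w ->
      forall t, 0 < t <= T -> {ae mu, forall x, w t x = u t x}) &
    (ereal_sup [set Lp_norm p (u t) | t in `]0%R, T[] <= 2%:E * Lp_norm p u0)%E].

Definition is_C1 p (cp C1 : R) : Prop :=
  (2 * cp)^-1 <= C1 /\
  forall u0 : field, in_Lp_sigma p u0 -> forall T : R, 0 < T ->
  (Lp_norm p u0 * (T `^ scaling_exponent p)%:E = cp%:E)%E ->
  forall u, strong_solution_on p `]0, T] u0 u ->
  forall t, 0 < t < T ->
  (Lp_norm p (duhamel u t) <=
     (C1 * t `^ scaling_exponent p)%:E * Lp_norm p u0 ^+ 2)%E.

Definition sparse p (eps beta l : R) v : Prop :=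
  exists S : set 'rV[R]_d, [/\ measurable S,
    (Lp_norm_on (~` S) p v < beta%:E * Lp_norm p v)%E &
    (ereal_sup [set mu (S `&` eball x0 l) / mu (eball x0 l) |
                x0 in [set: 'rV[R]_d]] <= eps%:E)%E].

End navier_stokes.

Arguments scaling_exponent {R} d p.
Arguments is_cp {R} d p cp.
Arguments is_C1 {R} d p cp C1.

(* Main.v *)
(* A solution that is small relative to [Tstar - t] at some later time
   [t + T1 / 2] could be continued past [Tstar], because local solutions of the
   integral equation can be glued.  Over the step [T1 / 2] the Duhamel term is at
   most half of the admissible size, by the choice of [T1], so a contradiction
   follows once the heat flow of [u t] is also that small.  For sparse data it is:
   the part of [u t] off [S] is small by definition, heat from points of [S] at
   distance [>= l] is damped by the Gaussian tail, and near points contribute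
   little since [S] has density at most [eps] in every ball of radius [l], by
   Schur's test.  Gluing rests on the semigroup identities
   [K_r * K_s = K_{r+s}] and [K_r * O_s = O_{r+s}] ([O] the kernel of
   [e^{t Delta} P div]) and on the bounds [|O_t|_1 <= C t^(-1/2)] and
   [|O_t|_oo <= C t^(-(d+1)/2)]. *)
Require Import Defs.
From mathcomp Require Import all_boot all_order all_algebra.
From mathcomp Require Import all_classical all_reals all_analysis.
From mathcomp Require Import measurable_realfun ess_sup_inf ring lra.
Set Implicit Arguments.
Unset Strict Implicit.
Unset Printing Implicit Defensive.
Import Order.TTheory GRing.Theory Num.Theory.
Import numFieldNormedType.Exports.
Local Open Scope classical_set_scope.
Local Open Scope ring_scope.

(** * Integration on R^d *)

(** A solution is only a continuous curve in [L^p]: nothing makes [u s x] jointly measurable in time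
    and space, and the mild identity holds almost everywhere in [x]. Fubini and Minkowski for the
    Duhamel term therefore rest on a joint measurability obtained by sampling [u] at discrete times,
    and the Duhamel term is split in time only up to a null set. A second obstacle is [p = +oo],
    where [e^(t Delta)] is not strongly continuous: continuity of a restarted solution at its
    initial time comes from comparison with the solution that it continues. The quadratic term
    leaves [L^p] for [L^(p/2)]; interpolating the two kernel bounds with weights [1 - 1/p] and [1/p]
    returns to [L^p] at the price [tau^(alpha - 1)], with [alpha = (1 - d/p)/2], integrable at [0]
    since [p > d]. At time [t + T1/2] the solution has norm at most [gamma] times that of [u t],
    which by the definition of [gamma] buys a further life span [Tstar - t], hence a solution up to
    [Tstar + T1/2]. *)

Section measure_prelim.
Context {R : realType}.
Local Notation leb := (@lebesgue_measure R).

Lemma ge0_integral_cons_rV n (f : 'rV[R]_n.+1 -> \bar R) :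
  measurable_fun [set: 'rV[R]_n.+1] f -> (forall x, 0 <= f x)%E ->
  (\int[lebesgue_rV n.+1]_x f x =
   \int[leb]_a \int[lebesgue_rV n]_v f (cons_rV (a, v)))%E.
Proof.
move=> mf f0.
have mc := @measurable_cons_rV R n.
transitivity (\int[(leb \x lebesgue_rV n)%E]_z (f \o @cons_rV R n) z)%E.
  rewrite -[in RHS](preimage_setT (@cons_rV R n)).
  by rewrite -(@ge0_integral_pushforward _ _ _ _ R _ mc).
rewrite fubini_tonelli1//; last by move=> ?; exact: f0.
exact: measurableT_comp.
Qed.

Lemma ge0_integral_prod_rV n (f : 'I_n -> R -> R) :
  (forall i, measurable_fun [set: R] (f i)) -> (forall i x, 0 <= f i x) ->
  (\int[lebesgue_rV n]_y (\prod_i f i (y ord0 i))%:E =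
   \prod_i \int[leb]_a (f i a)%:E)%E.
Proof.
elim: n f => [|n IH] f mf f0.
  rewrite big_ord0 /=.
  under eq_integral do rewrite big_ord0.
  by rewrite integral_cst//= diracT mul1e.
have mp m (g : 'I_m -> R -> R) (s : 'I_m -> 'I_m) : (forall i, measurable_fun [set: R] (g i)) ->
    measurable_fun [set: 'rV[R]_m] (fun y : 'rV[R]_m => \prod_i g i (y ord0 i)).
  move=> mg; apply: measurable_prod => i _.
  exact: (measurableT_comp (mg i) (@measurable_coord _ R m i)).
rewrite ge0_integral_cons_rV; first last.
- by move=> x; rewrite lee_fin prodr_ge0.
- by apply/measurable_EFinP; exact: mp.
rewrite big_ord_recl.
under eq_integral => a _.
  under eq_integral => v _.
    rewrite big_ord_recl cons_rV0/= EFinM.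
    under eq_bigr do rewrite cons_rVS/=.
    over.
  rewrite ge0_integralZl//=; last 3 first.
  - by apply/measurable_EFinP; apply: (mp _ (fun i => f (lift ord0 i))).
  - by move=> v _; rewrite lee_fin prodr_ge0.
  - by rewrite lee_fin f0.
  rewrite (IH (fun i => f (lift ord0 i)))//.
  over.
rewrite ge0_integralZr//=.
- by apply/measurable_EFinP; exact: mf.
- by move=> x _; rewrite lee_fin f0.
- by apply: prode_ge0 => i _; apply: integral_ge0 => x _; rewrite lee_fin.
Qed.

(** The pushforward is a measure that agrees with Lebesgue measure on the intervals []b, c]], and
    these determine it. *)
Lemma lebesgue_measure_shift (a : R) (A : set R) : measurable A ->
  pushforward leb (fun x : R => (a + x : measurableTypeR R)) A = leb A.
Proof.
move=> mA.
have ms : measurable_fun [set: R] (fun x : R => (a + x : measurableTypeR R)).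
  exact: measurable_funD.
pose m := @measure_function_pushforward__canonical__measure_function_Measure
     _ _ _ _ _ leb _ ms.
apply/esym; apply: (@lebesgue_measure_unique R m) => //= _ [[b c]] _ <-.
rewrite /pushforward (_ : _ @^-1` _ = `]b - a, c - a]%classic); last first.
  apply/seteqP; split => x /=; rewrite !in_itv/=.
    by rewrite ltrBlDl lerBrDl.
  by rewrite ltrBlDl lerBrDl.
rewrite !lebesgue_measure_itv/= !lte_fin ltrD2r; case: ifPn => // _.
by rewrite -!EFinB; congr EFin; ring.
Qed.

(** Positive and negative parts are shifted separately, so the identity also covers functions that
    are not integrable. *)
Lemma integral_shift (a : R) (f : R -> \bar R) : measurable_fun [set: R] f ->
  (\int[leb]_x f (a + x)%R = \int[leb]_x f x)%E.
Proof.
move=> mf.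
pose phi : measurableTypeR R -> measurableTypeR R := fun x => a + x.
have ms : measurable_fun [set: measurableTypeR R] phi by exact: measurable_funD.
have ge0 (g : R -> \bar R) : measurable_fun [set: R] g -> (forall x, 0 <= g x)%E ->
    (\int[leb]_x g (a + x)%R = \int[leb]_x g x)%E.
  move=> mg g0; apply/esym.
  transitivity (\int[pushforward leb phi]_x g x)%E.
    by apply: eq_measure_integral => A mA _; exact/esym/lebesgue_measure_shift.
  rewrite -[in RHS](preimage_setT phi).
  by rewrite (ge0_integral_pushforward ms leb) => // y _; exact: g0.
rewrite integralE [RHS]integralE; congr (_ - _)%E.
  under eq_integral do rewrite (funepos_comp f)/=.
  by apply: ge0 => //; exact: measurable_funepos.
under eq_integral do rewrite (funeneg_comp f)/=.
by apply: ge0 => //; exact: measurable_funeneg.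
Qed.

Lemma Rintegral_shift (a : R) (D : set R) (f : R -> R) : measurable D ->
  measurable_fun D f ->
  \int[leb]_(x in [set x | D (a + x)]) f (a + x) = \int[leb]_(x in D) f x.
Proof.
move=> mD mf; rewrite Rintegral_mkcond [RHS]Rintegral_mkcond /Rintegral; congr fine.
rewrite -(@integral_shift a (fun x => ((f \_ D) x)%:E)); last first.
  by apply/measurable_EFinP; rewrite -measurable_restrictT.
by apply: eq_integral => x _; congr EFin; rewrite !patchE.
Qed.

Lemma Rintegral_shift_itv0 (a r : R) (f : R -> R) :
  measurable_fun `]a, a + r[ f ->
  \int[leb]_(x in `]0, r[) f (a + x) = \int[leb]_(x in `]a, a + r[) f x.
Proof.
move=> mf; rewrite -(@Rintegral_shift a `]a, a + r[)//.
rewrite (_ : `]0, r[%classic = [set x | `]a, a + r[%classic (a + x)])//.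
by apply/seteqP; split => x /=; rewrite !in_itv/= ltrDl ltrD2l.
Qed.

Lemma Rintegral_shift_itvy (a t : R) (f : R -> R) :
  measurable_fun `]a + t, +oo[ f ->
  \int[leb]_(x in `]t, +oo[) f (a + x) = \int[leb]_(x in `]a + t, +oo[) f x.
Proof.
move=> mf; rewrite -(@Rintegral_shift a `]a + t, +oo[)//.
rewrite (_ : `]t, +oo[%classic = [set x | `]a + t, +oo[%classic (a + x)])//.
by apply/seteqP; split => x /=; rewrite !in_itv/= !andbT ltrD2l.
Qed.

End measure_prelim.

(** Measurability of integrals in a parameter holds without integrability: the integral is the
    difference of those of the positive and negative parts, each of which is measurable by
    Tonelli. *)
Section measurable_parametric.
Context {R : realType} d1 d2 (T1 : measurableType d1) (T2 : measurableType d2).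
Variable m2 : {sigma_finite_measure set T2 -> \bar R}.

Lemma measurable_integral_param (f : T1 * T2 -> \bar R) :
  measurable_fun [set: T1 * T2] f ->
  measurable_fun [set: T1] (fun x => \int[m2]_y f (x, y))%E.
Proof.
move=> mf; under eq_fun do rewrite integralE.
apply: emeasurable_funB.
  under eq_fun do under eq_integral do rewrite (funepos_comp f)/=.
  apply: (measurable_fun_fubini_tonelli_F (f^\+%E)) => //.
  exact: measurable_funepos.
under eq_fun do under eq_integral do rewrite (funeneg_comp f)/=.
apply: (measurable_fun_fubini_tonelli_F (f^\-%E)) => //.
exact: measurable_funeneg.
Qed.

Lemma measurable_Rintegral_param (f : T1 * T2 -> R) :
  measurable_fun [set: T1 * T2] f ->
  measurable_fun [set: T1] (fun x => \int[m2]_y f (x, y)).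
Proof.
move=> mf; apply: measurableT_comp => //.
by apply: (measurable_integral_param (f := EFin \o f)); exact/measurable_EFinP.
Qed.

(** Made for step functions in time: [N z] will be the index of the time slab that contains [z]. *)
Lemma measurable_fun_glue_nat (N : T1 -> nat) (g : nat -> T1 -> T2) :
  (forall k, measurable (N @^-1` [set k])) ->
  (forall k, measurable_fun [set: T1] (g k)) ->
  measurable_fun [set: T1] (fun z => g (N z) z).
Proof.
move=> mN mg _ Y mY; rewrite setTI.
rewrite (_ : _ @^-1` _ = \bigcup_k (N @^-1` [set k] `&` g k @^-1` Y)); last first.
  apply/seteqP; split=> z /=; first by move=> Yz; exists (N z).
  by case=> k _ /= [<-].
apply: bigcup_measurable => k _; apply: measurableI => //.
by rewrite -[X in measurable X]setTI; exact: mg.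
Qed.

End measurable_parametric.

(** * Heat and Oseen kernels *)

Section enorm.
Context {R : realType} {d : nat}.
Implicit Types x y : 'rV[R]_d.

Lemma enorm_ge0 x : 0 <= enorm x. Proof. exact: sqrtr_ge0. Qed.

Lemma enorm_sqr x : enorm x ^+ 2 = \sum_(i < d) x ord0 i ^+ 2.
Proof. by rewrite sqr_sqrtr// sumr_ge0// => i _; exact: sqr_ge0. Qed.

Lemma enormN x : enorm (- x) = enorm x.
Proof. by congr Num.sqrt; apply: eq_bigr => i _; rewrite mxE sqrrN. Qed.

Lemma enormB x y : enorm (x - y) = enorm (y - x).
Proof. by rewrite -enormN opprB. Qed.

Lemma enorm0 : enorm (0 : 'rV[R]_d) = 0.
Proof. by rewrite /enorm big1 ?sqrtr0// => i _; rewrite mxE expr0n. Qed.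

Lemma ler_coord_enorm x i : `|x ord0 i| <= enorm x.
Proof.
rewrite -sqrtr_sqr ler_wsqrtr// (bigD1 i)//= lerDl sumr_ge0// => j _.
exact: sqr_ge0.
Qed.

Lemma enorm_le_sum x : enorm x <= \sum_(i < d) `|x ord0 i|.
Proof.
have s0 : 0 <= \sum_(i < d) `|x ord0 i| by exact: sumr_ge0.
rewrite -[leRHS](ger0_norm s0) -sqrtr_sqr ler_wsqrtr//.
suff : 0 <= \sum_(i < d) `|x ord0 i| /\
    \sum_(i < d) x ord0 i ^+ 2 <= (\sum_(i < d) `|x ord0 i|) ^+ 2 by case.
elim/big_ind2 : _ => [|a b c e [b0 ab] [e0 ce]|i _].
- by rewrite expr0n; split.
- by split; [rewrite addr_ge0|nra].
- by rewrite real_normK ?num_real; split.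
Qed.

Lemma enorm_eq0 x : enorm x = 0 -> forall i, x ord0 i = 0.
Proof.
by move=> x0 i; apply/eqP; rewrite -normr_le0 -x0 ler_coord_enorm.
Qed.

Lemma enormD x y : enorm (x + y) <= enorm x + enorm y.
Proof.
have x0 := enorm_ge0 x; have y0 := enorm_ge0 y.
(* Cauchy-Schwarz, by expanding the sum of the squares of [|y| x_i - |x| y_i]. *)
have CS : \sum_(i < d) x ord0 i * y ord0 i <= enorm x * enorm y.
  have [x00|xn0] := eqVneq (enorm x) 0.
    by rewrite x00 mul0r big1// => i _; rewrite enorm_eq0// mul0r.
  have [y00|yn0] := eqVneq (enorm y) 0.
    by rewrite y00 mulr0 big1// => i _; rewrite (enorm_eq0 y00) mulr0.
  have : 0 <= \sum_(i < d) (enorm y * x ord0 i - enorm x * y ord0 i) ^+ 2.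
    by apply: sumr_ge0 => i _; exact: sqr_ge0.
  have -> : \sum_(i < d) (enorm y * x ord0 i - enorm x * y ord0 i) ^+ 2 =
      2 * (enorm x * enorm y) * (enorm x * enorm y - \sum_(i < d) x ord0 i * y ord0 i).
    transitivity (\sum_(i < d) (enorm y ^+ 2 * x ord0 i ^+ 2 +
      enorm x ^+ 2 * y ord0 i ^+ 2 - 2 * (enorm x * enorm y) * (x ord0 i * y ord0 i))).
      by apply: eq_bigr => i _; ring.
    rewrite sumrB big_split/= -!mulr_sumr -!enorm_sqr; ring.
  have xp : 0 < enorm x by rewrite lt0r xn0.
  have yp : 0 < enorm y by rewrite lt0r yn0.
  by rewrite pmulr_rge0 ?subr_ge0 ?(mulr_gt0 _ (mulr_gt0 xp yp)).
rewrite -ler_sqr ?nnegrE ?enorm_ge0 ?addr_ge0// enorm_sqr.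
under eq_bigr do rewrite mxE sqrrD.
rewrite big_split/= big_split/= -!enorm_sqr sumrMnl sqrrD.
by rewrite lerD2r lerD2l lerMn2r.
Qed.

Lemma measurable_enorm : measurable_fun [set: 'rV[R]_d] (@enorm R d).
Proof.
have -> : @enorm R d = (fun x => (\sum_(i < d) x ord0 i ^+ 2) `^ 2^-1).
  apply/funext => x; rewrite powR12_sqrt// sumr_ge0// => i _; exact: sqr_ge0.
apply: (measurableT_comp (measurable_powR _)).
apply: measurable_sum => i; apply: measurable_funX.
exact: (@measurable_coord _ R).
Qed.

End enorm.

Section measurable_inv.
Context {R : realType}.

(** Inversion is written as [x] times the power [-1] of [x^2], which reduces it to the measurability
    of real powers; at [0] both sides vanish. *)
Lemma measurable_inv : measurable_fun [set: R] (@GRing.inv R).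
Proof.
have -> : @GRing.inv R = (fun x => x * (x ^+ 2) `^ (-1)).
  apply/funext => x; rewrite powR_inv1 ?sqr_ge0//.
  have [->|x0] := eqVneq x 0; first by rewrite invr0 mul0r.
  by rewrite expr2 invfM mulrA divff// mul1r.
apply: measurable_funM => //.
by apply: (measurableT_comp (measurable_powR _)); exact: measurable_funX.
Qed.

End measurable_inv.

Section heat1.
Context {R : realType}.
Local Notation leb := (@lebesgue_measure R).

(** The heat kernel of the line; [heat_kernel] is a product of [d] copies of it. *)
Definition heat1 (t a : R) : R :=
  (4 * pi * t) `^ (- 2^-1) * expR (- (a ^+ 2 / (4 * t))).

Lemma heat1_ge0 t a : 0 <= heat1 t a.
Proof. by rewrite mulr_ge0 ?powR_ge0 ?expR_ge0. Qed.

Lemma measurable_heat1 t : measurable_fun [set: R] (heat1 t).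
Proof.
apply: measurable_funM => //; apply: measurableT_comp => //.
by apply: measurableT_comp => //; apply: measurable_funM.
Qed.

Lemma heat1_normal (t a b : R) : 0 < t ->
  heat1 t (a - b) = normal_pdf a (Num.sqrt (2 * t)) b.
Proof.
move=> t0.
have s0 : Num.sqrt (2 * t) != 0 by rewrite gt_eqF// sqrtr_gt0 mulr_gt0.
rewrite /heat1 normal_pdfE// /normal_peak /normal_fun powRN powR12_sqrt; last first.
  by rewrite !mulr_ge0 ?pi_ge0// ltW.
rewrite sqr_sqrtr ?mulr_ge0 ?(ltW t0)//; congr (_ * _).
  by congr (_^-1); congr Num.sqrt; ring.
congr expR; rewrite -mulNr; congr (_ / _); last by ring.
by ring.
Qed.

Lemma integral_heat1 (t a : R) : 0 < t ->
  (\int[leb]_b (heat1 t (a - b))%:E = 1)%E.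
Proof.
move=> t0; under eq_integral do rewrite heat1_normal//.
exact: integral_normal_pdf.
Qed.

(** Completing the square in [y]: the second factor on the right is again a heat kernel in [y], of
    mass one, so that integration in [y] leaves the semigroup law. *)
Lemma heat1M (r s a b y : R) : 0 < r -> 0 < s ->
  heat1 r (a - y) * heat1 s (y - b) = heat1 (r + s) (a - b) *
    heat1 (r * s / (r + s)) ((s * a + r * b) / (r + s) - y).
Proof.
move=> r0 s0; have rs0 : 0 < r + s by rewrite addr_gt0.
have p0 : (0 : R) < pi by exact: pi_gt0.
have q0 : 0 < r * s / (r + s) by rewrite divr_gt0 ?mulr_gt0.
have P (t : R) : 0 < t -> 0 <= 4 * pi * t by move=> t0; rewrite !mulr_ge0// ltW.
rewrite /heat1 mulrACA -powRM ?P//.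
rewrite [RHS]mulrACA -powRM ?P//.
rewrite -!expRD; congr (_ `^ _ * expR _); first by field; rewrite gt_eqF.
by field; rewrite ?gt_eqF ?pnatr_eq0//=.
Qed.

Lemma integral_heat1M (r s a b : R) : 0 < r -> 0 < s ->
  (\int[leb]_y (heat1 r (a - y) * heat1 s (y - b))%:E = (heat1 (r + s) (a - b))%:E)%E.
Proof.
move=> r0 s0; have rs0 : 0 < r + s by rewrite addr_gt0.
under eq_integral do rewrite heat1M// EFinM.
rewrite ge0_integralZl//; last 3 first.
- apply/measurable_EFinP; apply: measurableT_comp; first exact: measurable_heat1.
  exact: measurable_funB.
- by move=> y _; rewrite lee_fin heat1_ge0.
- by rewrite lee_fin heat1_ge0.
by rewrite integral_heat1 ?mule1// divr_gt0 ?mulr_gt0.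
Qed.

End heat1.

Section heat_kernel.
Context {R : realType} {d : nat}.
Local Notation mu := (@lebesgue_rV R d).
Implicit Types x y z : 'rV[R]_d.

Lemma heat_kernelE (t : R) x : 0 < t ->
  heat_kernel t x = \prod_(i < d) heat1 t (x ord0 i).
Proof.
move=> t0; rewrite /heat_kernel /heat1 big_split/=; congr (_ * _).
  rewrite prodr_const card_ord -powR_mulrn ?powR_ge0// -powRrM; congr (_ `^ _).
  by rewrite mulNr mulrC.
rewrite -expR_sum; congr expR.
by rewrite enorm_sqr mulr_suml -sumrN.
Qed.

Lemma heat_kernel_ge0 (t : R) x : 0 <= heat_kernel t x.
Proof. by rewrite mulr_ge0 ?powR_ge0 ?expR_ge0. Qed.

Lemma heat_kernelB (t : R) x y : heat_kernel t (x - y) = heat_kernel t (y - x).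
Proof. by rewrite /heat_kernel enormB. Qed.

Lemma heat_kernel_le (t : R) x : 0 < t ->
  heat_kernel t x <= (4 * pi * t) `^ (- (d%:R / 2)).
Proof.
move=> t0; rewrite ler_piMr ?powR_ge0// -expR0 ler_expR oppr_le0.
by rewrite divr_ge0 ?sqr_ge0 ?mulr_ge0 ?ltW.
Qed.

Lemma integral_heat_kernel (t : R) x : 0 < t ->
  (\int[mu]_y (heat_kernel t (x - y))%:E = 1)%E.
Proof.
move=> t0; under eq_integral => y _.
  rewrite heat_kernelE//; under eq_bigr do rewrite !mxE.
  over.
rewrite (@ge0_integral_prod_rV _ _ (fun i a => heat1 t (x ord0 i - a)))/=; last 2 first.
  move=> i; apply: measurableT_comp; first exact: measurable_heat1.
  exact: measurable_funB.
- by move=> i a; exact: heat1_ge0.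
by rewrite big1// => i _; rewrite integral_heat1.
Qed.

Lemma integral_heat_kernelM (r s : R) x z : 0 < r -> 0 < s ->
  (\int[mu]_y (heat_kernel r (x - y) * heat_kernel s (y - z))%:E =
   (heat_kernel (r + s) (x - z))%:E)%E.
Proof.
move=> r0 s0; under eq_integral => y _.
  rewrite !heat_kernelE// -big_split/=; under eq_bigr do rewrite !mxE.
  over.
rewrite (@ge0_integral_prod_rV _ _ (fun i a => heat1 r (x ord0 i - a) * heat1 s (a - z ord0 i)))/=.
- rewrite heat_kernelE ?addr_gt0// -prodEFin; apply: eq_bigr => i _.
  by rewrite integral_heat1M// !mxE.
- move=> i; apply: measurable_funM; apply: measurableT_comp; 
    (exact: measurable_heat1 || exact: measurable_funB).
- by move=> i a; rewrite mulr_ge0 ?heat1_ge0.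
Qed.

Lemma measurable_heat_kernel2 :
  measurable_fun [set: R * 'rV[R]_d] (fun z : R * 'rV[R]_d => heat_kernel z.1 z.2).
Proof.
apply: measurable_funM.
  apply: (measurableT_comp (measurable_powR _)); exact: measurable_funM.
apply: measurableT_comp => //; apply: measurableT_comp => //.
apply: measurable_funM.
  apply: measurable_funX; exact: (measurableT_comp measurable_enorm).
by apply: (measurableT_comp measurable_inv); exact: measurable_funM.
Qed.

Lemma measurable_heat_kernel (t : R) :
  measurable_fun [set: 'rV[R]_d] (heat_kernel t).
Proof.
exact: (measurableT_comp measurable_heat_kernel2 (measurable_pair1 t)).
Qed.

End heat_kernel.

(** * Derivatives of the heat kernel *)

Section directional_derivative.
Context {R : realType} {V : normedModType R}.

(** Restriction to a line turns a directional derivative into one on [R], where the chain rule and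
    the integral theorems are stated. *)
Lemma is_derive_line (f : V -> R) (x v : V) (df : R) :
  is_derive x v f df <-> is_derive (0 : R) 1 (fun h => f (h *: v + x)) df.
Proof.
have E : (fun h : R => h^-1 *: ((f \o shift x) (h *: v) - f x)) =
    (fun h : R => h^-1 *: (((fun h => f (h *: v + x)) \o shift 0) (h *: 1) -
      f (0 *: v + x))).
  apply/funext => h /=; congr (_ *: (f _ - f _)).
    by rewrite addr0 -[h *: 1]/(h * 1) mulr1.
  by rewrite scale0r add0r.
by split => -[D1 D2]; split; move: D1 D2; rewrite /derivable /derive ?E// -?E.
Qed.

Lemma is_derive_comp1 (g : R -> R) (f : V -> R) (x v : V) (df dg : R) :
  is_derive (f x) 1 g dg -> is_derive x v f df ->
  is_derive x v (g \o f) (dg * df).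
Proof.
move=> Dg /is_derive_line Df; apply/is_derive_line.
by apply: is_derive1_comp => //=; rewrite scale0r add0r.
Qed.

End directional_derivative.

Section heat_derivatives.
Context {R : realType} {d : nat}.
Implicit Types (x : 'rV[R]_d) (i j k : 'I_d).

Lemma is_derive_coord x k i :
  is_derive x (delta_mx ord0 k) (fun y : 'rV[R]_d => y ord0 i) (k == i)%:R.
Proof.
apply/is_derive_line.
have -> : (fun h : R => (h *: delta_mx ord0 k + x) ord0 i) =
    (fun h => h * (k == i)%:R + x ord0 i).
  by apply/funext => h; rewrite !mxE eqxx/= eq_sym.
apply: is_derive_eq; rewrite !scaler0 ?add0r ?addr0.
by rewrite -[_ *: _]/(_ * _) mulr1.
Qed.

Lemma is_derive_enorm_sqr x k :
  is_derive x (delta_mx ord0 k) (fun y : 'rV[R]_d => enorm y ^+ 2) (2 * x ord0 k).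
Proof.
have -> : (fun y : 'rV[R]_d => enorm y ^+ 2) =
    \sum_(i < d) ((fun y : 'rV[R]_d => y ord0 i) ^+ 2).
  by apply/funext => y; rewrite enorm_sqr fct_sumE.
have Dc i := is_derive_coord x k i.
apply: is_derive_eq.
rewrite (bigD1 k)//= big1 ?addr0; last first.
  by move=> i ik; rewrite eq_sym (negbTE ik) scaler0.
by rewrite eqxx -[_ *: _]/(_ * _) mulr1 expr1.
Qed.

(** The coefficient of [- |x|^2] in the Gaussian exponent. *)
Definition heat_c (t : R) : R := (4 * t)^-1.

(** Closed forms of the derivatives of orders one to three, each a polynomial in [x] times the
    kernel; the polynomial factor is what the bounds have to absorb. *)
Definition dheat (t : R) k x : R := - (2 * heat_c t * x ord0 k) * heat_kernel t x.

Definition ddheat (t : R) j k x : R :=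
  (4 * heat_c t ^+ 2 * x ord0 j * x ord0 k - 2 * heat_c t * (j == k)%:R) *
  heat_kernel t x.

Definition dddheat (t : R) i j k x : R :=
  (4 * heat_c t ^+ 2 * ((j == k)%:R * x ord0 i + (i == k)%:R * x ord0 j +
     (i == j)%:R * x ord0 k) -
   8 * heat_c t ^+ 3 * x ord0 i * x ord0 j * x ord0 k) *
  heat_kernel t x.

Lemma is_derive_heat_kernel (t : R) k x :
  is_derive x (delta_mx ord0 k) (heat_kernel t) (dheat t k x).
Proof.
pose g (a : R) : R := (4 * pi * t) `^ (- (d%:R / 2)) * expR (- (a / (4 * t))).
have -> : heat_kernel t = g \o (fun y : 'rV[R]_d => enorm y ^+ 2) by [].
apply: (is_derive_eq (f' := (- (heat_c t * heat_kernel t x)) * (2 * x ord0 k))).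
  apply: is_derive_comp1; last exact: is_derive_enorm_sqr.
  have -> : g = ((4 * pi * t) `^ (- (d%:R / 2))) \*: (expR \o (fun a => - (heat_c t) * a)).
    by apply/funext => a; rewrite /g /=; congr (_ * expR _); rewrite mulNr [in RHS]mulrC.
  apply: is_derive_eq.
  rewrite /heat_kernel/= /heat_c -![_ *: _]/(_ * _) ?mulr1.
  by rewrite mulNr [_^-1 * enorm x ^+ 2]mulrC; ring.
by rewrite /dheat; ring.
Qed.

Lemma is_derive_dheat (t : R) j k x :
  is_derive x (delta_mx ord0 j) (dheat t k) (ddheat t j k x).
Proof.
have Dk := is_derive_coord x j k; have DK := is_derive_heat_kernel t j x.
have -> : dheat t k = (- (2 * heat_c t)) \*:
    ((fun y : 'rV[R]_d => y ord0 k) * heat_kernel t).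
  apply/funext => y; rewrite /dheat -mulNr -mulrA; reflexivity.
apply: is_derive_eq; rewrite /ddheat /dheat -![_ *: _]/(_ * _); ring.
Qed.

Lemma is_derive_ddheat (t : R) i j k x :
  is_derive x (delta_mx ord0 i) (ddheat t j k) (dddheat t i j k x).
Proof.
have Dj := is_derive_coord x i j; have Dk := is_derive_coord x i k.
have DK := is_derive_heat_kernel t i x.
have -> : ddheat t j k = ((4 * heat_c t ^+ 2) \*:
    ((fun y : 'rV[R]_d => y ord0 j) * (fun y : 'rV[R]_d => y ord0 k)) -
    cst (2 * heat_c t * (j == k)%:R)) * heat_kernel t.
  apply/funext => y; rewrite /ddheat -[in LHS](mulrA (4 * _)); reflexivity.
apply: is_derive_eq; rewrite /dddheat /dheat /cst -![_ *: _]/(_ * _) /=.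
rewrite -[X in X * (- _ * _)]/(4 * heat_c t ^+ 2 * (x ord0 j * x ord0 k) -
  2 * heat_c t * (j == k)%:R); ring.
Qed.

Lemma partial_heat_kernel (t : R) k : partial k (heat_kernel t) = dheat t k.
Proof.
by apply/funext => x; have D := is_derive_heat_kernel t k x; exact: derive_val.
Qed.

Lemma partial_dheat (t : R) j k : partial j (dheat t k) = ddheat t j k.
Proof.
by apply/funext => x; have D := is_derive_dheat t j k x; exact: derive_val.
Qed.

Lemma partial_ddheat (t : R) i j k : partial i (ddheat t j k) = dddheat t i j k.
Proof.
by apply/funext => x; have D := is_derive_ddheat t i j k x; exact: derive_val.
Qed.

Lemma oseen_kernelE (t : R) i j k x : oseen_kernel t i j k x =
  (i == j)%:R * dheat t k x +
  \int[@lebesgue_measure R]_(s in `]t, +oo[) dddheat s i j k x.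
Proof.
rewrite /oseen_kernel partial_heat_kernel; congr (_ + _).
by under eq_Rintegral do rewrite partial_heat_kernel partial_dheat partial_ddheat.
Qed.

End heat_derivatives.

(** * Fubini and differentiation for real-valued integrals *)

Section Rintegral_extra.
Context {R : realType} dT (T : measurableType dT).
Variable m : {measure set T -> \bar R}.
Implicit Types (f g : T -> R) (D : set T).

Lemma Rintegral_integrableE D f : measurable D -> m.-integrable D (EFin \o f) ->
  (\int[m]_(x in D) f x)%:E = (\int[m]_(x in D) (f x)%:E)%E.
Proof. by move=> mD fi; rewrite /Rintegral fineK// integrable_fin_num. Qed.

Lemma integrable_EFinP D f : measurable D -> measurable_fun D f ->
  (\int[m]_(x in D) (`|f x|)%:E < +oo)%E -> m.-integrable D (EFin \o f).
Proof. by move=> mD mf fi; apply/integrableP; split=> //; exact/measurable_EFinP. Qed.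

(** The right-hand side is taken in [\bar R]: if [f] is not integrable it is [+oo] and the bound is
    still true. *)
Lemma normr_Rintegral_le D f : measurable D -> measurable_fun D f ->
  (`|\int[m]_(x in D) f x|%:E <= \int[m]_(x in D) (`|f x|)%:E)%E.
Proof.
move=> mD mf; have [foo|] := ltP (\int[m]_(x in D) (`|f x|)%:E)%E +oo%E.
  have fi := integrable_EFinP mD mf foo.
  rewrite EFin_normr_Rintegral//; apply: le_abse_integral => //.
  exact/measurable_EFinP.
by rewrite leye_eq => /eqP ->; rewrite leey.
Qed.

Lemma le_integrable_EFin D f g : measurable D -> measurable_fun D f ->
  (forall x, D x -> `|f x| <= g x) -> m.-integrable D (EFin \o g) ->
  m.-integrable D (EFin \o f).
Proof.
move=> mD mf fg gi; apply: (le_integrable mD _ _ gi).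
  exact/measurable_EFinP.
by move=> x Dx; rewrite /= lee_fin (le_trans (fg _ Dx))// ler_norm.
Qed.

End Rintegral_extra.

Section Rintegral_fubini.
Context {R : realType} d1 d2 (T1 : measurableType d1) (T2 : measurableType d2).
Variables (m1 : {sigma_finite_measure set T1 -> \bar R})
  (m2 : {sigma_finite_measure set T2 -> \bar R}).
Variable f : T1 * T2 -> R.
Hypothesis mf : measurable_fun [set: T1 * T2] f.
Hypothesis foo : (\int[m1]_x \int[m2]_y (`|f (x, y)|)%:E < +oo)%E.

Let mEf : measurable_fun [set: T1 * T2] (EFin \o f).
Proof. exact/measurable_EFinP. Qed.

Let fi : (m1 \x m2)%E.-integrable setT (EFin \o f).
Proof. exact/integrable12ltyP. Qed.

Lemma integrable_Rintegral_param :
  m1.-integrable setT (EFin \o (fun x => \int[m2]_y f (x, y))).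
Proof.
have mF := @measurable_Rintegral_param _ _ _ _ _ m2 _ mf.
apply: integrable_EFinP => //; apply: le_lt_trans foo.
apply: ge0_le_integral => //.
- by apply/measurable_EFinP; exact: measurableT_comp.
- apply: (@measurable_integral_param _ _ _ _ _ m2 (EFin \o (Num.norm \o f))).
  by apply/measurable_EFinP; exact: measurableT_comp.
- move=> x _; apply: normr_Rintegral_le => //.
  exact: (measurableT_comp mf (measurable_pair1 x)).
Qed.

Lemma Rintegral_fubini :
  \int[m1]_x \int[m2]_y f (x, y) = \int[m2]_y \int[m1]_x f (x, y).
Proof.
congr fine.
(* Where an inner integral diverges, [fine] returns a default value; this happens on a null set
   only. *)
transitivity (\int[m1]_x \int[m2]_y (f (x, y))%:E)%E.
  apply: ae_eq_integral => //.
  - by apply/measurable_EFinP; exact: measurable_Rintegral_param.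
  - exact: (@measurable_integral_param _ _ _ _ _ m2 _ mEf).
  have := ae_integrable1 fi; apply: filterS => x /= xi _.
  by rewrite Rintegral_integrableE.
rewrite (Fubini fi).
apply/esym; apply: ae_eq_integral => //.
- apply/measurable_EFinP.
  exact: (@measurable_Rintegral_param _ _ _ _ _ m1 _ (measurableT_comp mf (@measurable_swap _ _ T2 T1))).
- exact: (@measurable_integral_param _ _ _ _ _ m1 _ (measurableT_comp mEf (@measurable_swap _ _ T2 T1))).
have := ae_integrable2 fi; apply: filterS => x /= xi _.
by rewrite Rintegral_integrableE.
Qed.

End Rintegral_fubini.

Section conv_partial.
Context {R : realType} {d : nat}.
Local Notation mu := (@lebesgue_rV R d).
Implicit Types x y z v : 'rV[R]_d.

Lemma measurable_fun_subrV dT (T : measurableType dT) (f g : T -> 'rV[R]_d) :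
  measurable_fun [set: T] f -> measurable_fun [set: T] g ->
  measurable_fun [set: T] (fun x : T => f x - g x).
Proof.
move=> /measurable_fun_rVP mf /measurable_fun_rVP mg.
apply/measurable_fun_rVP => i; under eq_fun do rewrite !mxE.
exact: measurable_funB.
Qed.

Lemma measurable_subrV x : measurable_fun [set: 'rV[R]_d] (fun y : 'rV[R]_d => x - y).
Proof. exact: measurable_fun_subrV. Qed.

Lemma measurable_subrVr x : measurable_fun [set: 'rV[R]_d] (fun y : 'rV[R]_d => y - x).
Proof. exact: measurable_fun_subrV. Qed.

Lemma integrable_heat_kernel (r : R) x : 0 < r ->
  mu.-integrable [set: 'rV[R]_d] (fun y => (heat_kernel r (x - y))%:E).
Proof.
move=> r0; apply: integrable_EFinP => //.
  exact: (measurableT_comp (measurable_heat_kernel r) (measurable_subrV x)).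
under eq_integral do rewrite ger0_norm ?heat_kernel_ge0//.
by rewrite integral_heat_kernel// ltry.
Qed.

Lemma integrable_heat_kernelM (r C : R) (g : 'rV[R]_d -> R) x : 0 < r ->
  measurable_fun [set: 'rV[R]_d] g -> (forall y, `|g y| <= C) ->
  mu.-integrable [set: 'rV[R]_d] (fun y => (heat_kernel r (x - y) * g y)%:E).
Proof.
move=> r0 mg gC.
apply: (@le_integrable_EFin _ _ _ mu _ _ (fun y => heat_kernel r (x - y) * C)) => //.
- apply: measurable_funM => //.
  exact: (measurableT_comp (measurable_heat_kernel r) (measurable_subrV x)).
- move=> y _; rewrite normrM ger0_norm ?heat_kernel_ge0//.
  by rewrite ler_wpM2l ?heat_kernel_ge0.
rewrite (_ : _ \o _ = (fun y => C%:E * (heat_kernel r (x - y))%:E)%E); last first.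
  by apply/funext => y /=; rewrite mulrC EFinM.
by apply: integrableZl => //; exact: integrable_heat_kernel.
Qed.

(* Differentiate [int K_r (x - y) g (y - z) dy = G (x - z)] in [z]. *)
Lemma heat_kernel_conv_derive (r C : R) (g G dg dG : 'rV[R]_d -> R) v : 0 < r ->
  measurable_fun [set: 'rV[R]_d] g -> (forall y, `|g y| <= C) ->
  (forall y, is_derive y v g (dg y)) -> (forall y, `|dg y| <= C) ->
  (forall y, is_derive y v G (dG y)) ->
  (forall x z, \int[mu]_y (heat_kernel r (x - y) * g (y - z)) = G (x - z)) ->
  forall x z, \int[mu]_y (heat_kernel r (x - y) * dg (y - z)) = dG (x - z).
Proof.
move=> r0 mg gC Dg dgC DG gG x z.
have line (f df : 'rV[R]_d -> R) w (h : R) : (forall y, is_derive y v f (df y)) ->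
    is_derive h 1 (fun h => f (h *: v + w)) (df (h *: v + w)).
  move=> Df; have /is_derive_line D0 := Df (h *: v + w).
  have -> : (fun h => f (h *: v + w)) =
      (fun h' => f (h' *: v + (h *: v + w))) \o (fun a => a - h).
    by apply/funext => a /=; rewrite addrA -scalerDl subrK.
  have D1 : is_derive h 1 (fun a : R => a - h) 1.
    by apply: is_derive_eq; rewrite subr0.
  by rewrite -[df _]mulr1; apply: is_derive1_comp; rewrite /= subrr.
pose f h y := heat_kernel r (x - y) * g (h *: v + (y - z)).
have df (h : R) y : is_derive h 1 (f ^~ y) (heat_kernel r (x - y) * dg (h *: v + (y - z))).
  have D := line _ _ (y - z) h Dg.
  rewrite (_ : f ^~ y = heat_kernel r (x - y) \*: (fun h => g (h *: v + (y - z))))//.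
  exact: is_deriveZ.
have mgh h : measurable_fun [set: 'rV[R]_d] (fun y => g (h *: v + (y - z))).
  rewrite (_ : (fun y => _) = g \o (fun y => y - (z - h *: v))); last first.
    by apply/funext => y /=; rewrite opprB addrCA.
  exact: (measurableT_comp mg (measurable_subrVr _)).
have C0 : 0 <= C by exact: le_trans (gC 0).
have fi h : mu.-integrable [set: 'rV[R]_d] (EFin \o f h).
  exact: (integrable_heat_kernelM (C := C)).
(* Dominated differentiation at [h = 0] with majorant [C K_r (x - y)]: the increment in [z] moves
   the bounded factor [g] and leaves [K_r] alone. *)
have := @differentiation_under_integral R _ _ mu f setT measurableT 0 (-1) 1.
have I0 : `]-1, 1[%classic (0 : R) by rewrite /= in_itv/= ltrN10 ltr01.
move=> /(_ I0 (fun h _ => fi h)).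
move=> /(_ (fun h y _ _ => @ex_derive _ _ _ _ _ _ _ (df h y))).
move=> /(_ (fun y => heat_kernel r (x - y) * C)).
move=> /(_ (fun y => mulr_ge0 (heat_kernel_ge0 _ _) C0)).
have ci : mu.-integrable [set: 'rV[R]_d] (EFin \o (fun y => heat_kernel r (x - y) * C)).
  apply: (@integrable_heat_kernelM _ C (cst C)) => // y.
  by rewrite ger0_norm.
move=> /(_ ci) DI.
transitivity (\int[mu]_y partial1of2 f 0 y).
  apply: eq_Rintegral => y _; rewrite /partial1of2 derive1E.
  by have /= D := df 0 y; rewrite derive_val scale0r add0r.
rewrite -DI; last first.
  move=> h y _ _; rewrite /partial1of2 derive1E.
  have /= D := df h y; rewrite derive_val normrM ger0_norm ?heat_kernel_ge0//.
  by rewrite ler_wpM2l ?heat_kernel_ge0.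
rewrite derive1E (_ : (fun h => _) = (fun h => G (h *: v + (x - z)))); last first.
  apply/funext => h.
  have -> : h *: v + (x - z) = x - (z - h *: v) by rewrite opprB addrCA.
  rewrite -gG.
  by apply: eq_Rintegral => y _; rewrite /f opprB addrCA.
have D := line _ _ (x - z) 0 DG.
by rewrite derive_val scale0r add0r.
Qed.

End conv_partial.

(** * Pointwise bounds on the derivatives of the heat kernel *)

Section heat_bounds.
Context {R : realType} {d : nat}.
Local Notation leb := (@lebesgue_measure R).
Implicit Types (x y z : 'rV[R]_d) (i j k : 'I_d) (s t r : R).

(** The inverse of the diffusion length [sqrt (4 t)]: [xi = heat_q t * |x|] is the self-similar
    variable, and each space derivative costs one factor [heat_q t]. *)
Definition heat_q (t : R) : R := (4 * t) `^ (- 2^-1).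

(** The factor [2^(d/2)] is the price of doubling the time in the kernel, and [128] dominates the
    polynomial prefactors of the first three derivatives. *)
Definition heat_D : R := 128 * 2 `^ (d%:R / 2).

Lemma heat_D_ge0 : 0 <= heat_D. Proof. by rewrite mulr_ge0 ?powR_ge0. Qed.

Lemma heat_q_ge0 t : 0 <= heat_q t. Proof. exact: powR_ge0. Qed.

Lemma heat_q2 t : 0 < t -> heat_q t ^+ 2 = heat_c t.
Proof.
move=> t0; have t40 : 0 <= 4 * t by rewrite mulr_ge0// ltW.
rewrite /heat_q -powR_mulrn ?powR_ge0// -powRrM mulNr mulVf ?pnatr_eq0//.
by rewrite powR_inv1.
Qed.

(* Polynomial weights are absorbed by doubling the time: with [xi = |x| / sqrt (4 t)],
   [(1 + xi^2 / 4)^2 <= exp (xi^2 / 2)]. *)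
Lemma heat_kernel_weight t x : 0 < t ->
  (1 + heat_c t * enorm x ^+ 2 / 4) ^+ 2 * heat_kernel t x <=
  2 `^ (d%:R / 2) * heat_kernel (2 * t) x.
Proof.
move=> t0; have t40 : 0 <= 4 * pi * t by rewrite !mulr_ge0 ?pi_ge0 ?ltW.
have -> : 2 `^ (d%:R / 2) * heat_kernel (2 * t) x =
    (4 * pi * t) `^ (- (d%:R / 2)) * (expR (- (heat_c t * enorm x ^+ 2 / 2))).
  rewrite /heat_kernel mulrA; congr (_ * expR _).
    rewrite (_ : 4 * pi * (2 * t) = 2 * (4 * pi * t)); last by ring.
    rewrite powRM// mulrA -powRD ?subrr ?powRr0 ?mul1r//.
    by rewrite pnatr_eq0 implybT.
  by rewrite /heat_c; field; rewrite gt_eqF.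
rewrite /heat_kernel mulrCA ler_wpM2l ?powR_ge0//.
set u := heat_c t * enorm x ^+ 2 / 4.
have c0 : 0 <= heat_c t by rewrite invr_ge0 mulr_ge0// ltW.
have u0 : 0 <= u by rewrite divr_ge0// mulr_ge0 ?sqr_ge0.
have -> : - (heat_c t * enorm x ^+ 2 / 2) = u + u + - (enorm x ^+ 2 / (4 * t)).
  by rewrite /u /heat_c; field; rewrite gt_eqF.
have u1 : 0 <= 1 + u by rewrite addr_ge0.
by rewrite 2!expRD ler_wpM2r ?expR_ge0// expr2 ler_pM// expR_ge1Dx.
Qed.

(** Reduces a bound on a derivative of the kernel to a polynomial inequality in [xi] for its
    prefactor. *)
Lemma heat_weighted_le t x (P A : R) : 0 < t -> 0 <= A ->
  P <= A * (128 * (1 + heat_c t * enorm x ^+ 2 / 4) ^+ 2) ->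
  P * heat_kernel t x <= A * (heat_D * heat_kernel (2 * t) x).
Proof.
move=> t0 A0 PA; apply: (le_trans (ler_wpM2r (heat_kernel_ge0 _ _) PA)).
have := ler_wpM2l (mulr_ge0 A0 (ler0n R 128)) (heat_kernel_weight x t0).
by rewrite /heat_D !mulrA.
Qed.

Lemma norm_dheat_le t k x : 0 < t ->
  `|dheat t k x| <= heat_q t * (heat_D * heat_kernel (2 * t) x).
Proof.
move=> t0; rewrite normrM (ger0_norm (heat_kernel_ge0 _ _)).
apply: heat_weighted_le; rewrite ?heat_q_ge0//.
have q0 := heat_q_ge0 t; have xe := ler_coord_enorm x k; have e0 := enorm_ge0 x.
rewrite normrN -heat_q2// normrM normrM ger0_norm// (ger0_norm (sqr_ge0 _)).
set xi := heat_q t * enorm x.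
have xi0 : 0 <= xi by rewrite mulr_ge0.
apply: (@le_trans _ _ (heat_q t * (2 * xi))).
  by rewrite /xi expr2 -!mulrA mulrCA !ler_wpM2l// mulrCA !ler_wpM2l.
rewrite ler_wpM2l// -exprMn -/xi; nra.
Qed.

Lemma norm_ddheat_le t j k x : 0 < t ->
  `|ddheat t j k x| <= heat_q t ^+ 2 * (heat_D * heat_kernel (2 * t) x).
Proof.
move=> t0; rewrite normrM (ger0_norm (heat_kernel_ge0 _ _)).
apply: heat_weighted_le; rewrite ?sqr_ge0//.
have q0 := heat_q_ge0 t; have xj := ler_coord_enorm x j.
have xk := ler_coord_enorm x k; have e0 := enorm_ge0 x.
rewrite -heat_q2//; set xi := heat_q t * enorm x.
rewrite -exprMn -/xi; have xi0 : 0 <= xi by rewrite mulr_ge0.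
rewrite (_ : _ - _ = heat_q t ^+ 2 * (4 * ((heat_q t * x ord0 j) * (heat_q t * x ord0 k)) - 2 * (j == k)%:R)); last by ring.
rewrite normrM ger0_norm ?sqr_ge0// ler_wpM2l ?sqr_ge0//.
have b01 : `|(j == k)%:R| <= 1 :> R by case: eqVneq => _; rewrite ?normr1 ?normr0.
have yj : `|heat_q t * x ord0 j| <= xi by rewrite normrM ger0_norm// ler_wpM2l.
have yk : `|heat_q t * x ord0 k| <= xi by rewrite normrM ger0_norm// ler_wpM2l.
apply: (@le_trans _ _ (4 * (xi * xi) + 2 * 1)); last by nra.
apply: (le_trans (ler_normB _ _)); apply: lerD.
  by rewrite normrM (ger0_norm (ler0n _ 4)) ler_wpM2l// normrM ler_pM.
by rewrite normrM (ger0_norm (ler0n _ 2)) ler_wpM2l.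
Qed.

Lemma norm_dddheat_le t i j k x : 0 < t ->
  `|dddheat t i j k x| <= heat_q t ^+ 3 * (heat_D * heat_kernel (2 * t) x).
Proof.
move=> t0; rewrite normrM (ger0_norm (heat_kernel_ge0 _ _)).
have q0 := heat_q_ge0 t.
apply: heat_weighted_le; rewrite ?exprn_ge0//.
have e0 := enorm_ge0 x.
rewrite -heat_q2//; set xi := heat_q t * enorm x.
rewrite -exprMn -/xi; have xi0 : 0 <= xi by rewrite mulr_ge0.
have y_le l : `|heat_q t * x ord0 l| <= xi.
  by rewrite normrM ger0_norm// ler_wpM2l// ler_coord_enorm.
have := y_le i; have := y_le j; have := y_le k.
set yi := heat_q t * x ord0 i; set yj := heat_q t * x ord0 j.
set yk := heat_q t * x ord0 k => hk hj hi.
rewrite (_ : _ - _ = heat_q t ^+ 3 * (4 * ((j == k)%:R * yi + (i == k)%:R * yj + (i == j)%:R * yk) - 8 * (yi * yj * yk))); last by rewrite /yi /yj /yk; ring.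
rewrite normrM ger0_norm ?exprn_ge0// ler_wpM2l ?exprn_ge0//.
have b01 (b : bool) (y : R) : `|y| <= xi -> `|b%:R * y| <= xi.
  by case: b => yx; rewrite ?mul1r ?mul0r ?normr0.
apply: (@le_trans _ _ (4 * (xi + xi + xi) + 8 * (xi * xi * xi))); last by nra.
apply: (le_trans (ler_normB _ _)); apply: lerD.
  rewrite normrM (ger0_norm (ler0n _ 4)) ler_wpM2l//.
  apply: (le_trans (ler_normD _ _)); apply: lerD; last exact: b01.
  by apply: (le_trans (ler_normD _ _)); apply: lerD; exact: b01.
rewrite normrM (ger0_norm (ler0n _ 8)) ler_wpM2l// normrM ler_pM//.
by rewrite normrM ler_pM.
Qed.

Lemma measurable_heat_c : measurable_fun [set: R] (@heat_c R).
Proof. by apply: (measurableT_comp measurable_inv); exact: measurable_funM. Qed.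

Lemma measurable_dheat2 k :
  measurable_fun [set: R * 'rV[R]_d] (fun z : R * 'rV[R]_d => dheat z.1 k z.2).
Proof.
have mx l : measurable_fun [set: R * 'rV[R]_d] (fun z : R * 'rV[R]_d => z.2 ord0 l).
  exact: (measurableT_comp (@measurable_coord _ R d l)).
have mc : measurable_fun [set: R * 'rV[R]_d] (fun z : R * 'rV[R]_d => heat_c z.1).
  exact: (measurableT_comp measurable_heat_c).
apply: measurable_funM; last exact: measurable_heat_kernel2.
by apply: measurableT_comp => //; do 2 (apply: measurable_funM => //).
Qed.

Lemma measurable_dddheat2 i j k :
  measurable_fun [set: R * 'rV[R]_d] (fun z : R * 'rV[R]_d => dddheat z.1 i j k z.2).
Proof.
have mx l : measurable_fun [set: R * 'rV[R]_d] (fun z : R * 'rV[R]_d => z.2 ord0 l).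
  exact: (measurableT_comp (@measurable_coord _ R d l)).
have mc : measurable_fun [set: R * 'rV[R]_d] (fun z : R * 'rV[R]_d => heat_c z.1).
  exact: (measurableT_comp measurable_heat_c).
apply: measurable_funM; last exact: measurable_heat_kernel2.
apply: measurable_funB.
  apply: measurable_funM; first by apply: measurable_funM => //; exact: measurable_funX.
  apply: measurable_funD; last exact: measurable_funM.
  by apply: measurable_funD; exact: measurable_funM.
do 3 (apply: measurable_funM => //).
by apply: measurable_funM => //; exact: measurable_funX.
Qed.

Lemma heat_kernel2_le t s x : 0 < t -> t <= s ->
  heat_kernel (2 * s) x <= (4 * pi * t) `^ (- (d%:R / 2)).
Proof.
move=> t0 ts; have s0 : 0 < s by exact: lt_le_trans ts.
have p4 : (0 : R) < 4 * pi by rewrite mulr_gt0// pi_gt0.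
apply: (le_trans (heat_kernel_le _ _)); first by rewrite mulr_gt0.
rewrite !powRN lef_pV2 ?posrE ?powR_gt0 ?mulr_gt0//.
have s20 : 0 < 2 * s by rewrite mulr_gt0.
apply: ge0_ler_powR; rewrite ?nnegrE ?divr_ge0// ?(ltW (mulr_gt0 p4 _))//.
by rewrite ler_pM2l//; lra.
all: exact: pi_gt0.
Qed.

Lemma measurable_heat_q : measurable_fun [set: R] heat_q.
Proof. by apply: (measurableT_comp (measurable_powR _)); exact: measurable_funM. Qed.

Lemma heat_q_cvg0 : heat_q s @[s --> +oo] --> (0 : R).
Proof.
apply/cvgrPdist_lt => e e0; near=> s.
have s0 : 0 < s by near: s; exact: nbhs_pinfty_gt.
rewrite sub0r normrN ger0_norm ?heat_q_ge0// -ltr_sqr ?nnegrE ?heat_q_ge0 ?ltW//.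
rewrite heat_q2// /heat_c invf_plt ?posrE ?mulr_gt0 ?exprn_gt0//.
rewrite -ltr_pdivrMl//; near: s; apply: nbhs_pinfty_gt; exact: num_real.
Unshelve. all: by end_near. Qed.

Lemma is_derive_heat_q s : 0 < s -> is_derive s 1 heat_q (- 2 * heat_q s ^+ 3).
Proof.
move=> s0; have s40 : 0 < 4 * s by rewrite mulr_gt0.
have -> : heat_q = (fun a => a `^ (- 2^-1)) \o (fun a => 4 * a) by [].
have D4 : is_derive s 1 (fun a : R => 4 * a) 4.
  by apply: is_derive_eq; rewrite -[_ *: _]/(_ * _) mulr1.
have Dp := is_derive1_powR (- 2^-1) s40.
have := is_derive1_comp Dp D4; congr is_derive.
rewrite /heat_q -[in RHS]powR_mulrn ?powR_ge0// -powRrM.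
rewrite (_ : - 2^-1 - 1 = - 2^-1 * 3%:R :> R); last by lra.
by set X := _ `^ _; lra.
Qed.

(** Since [heat_q' = - 2 heat_q^3], an antiderivative is [- heat_q / 2]. Third derivatives
    integrated over []t, +oo[] thus have the size of a first derivative at time [t], so the nonlocal
    part of the Oseen kernel is no worse than its local part. *)
Lemma integral_heat_q3 t : 0 < t ->
  (\int[leb]_(s in `]t, +oo[) (heat_q s ^+ 3)%:E = (heat_q t / 2)%:E)%E.
Proof.
move=> t0.
have cq s : 0 < s -> {for s, continuous heat_q}.
  move=> s0; apply/differentiable_continuous/derivable1_diffP.
  by have D := is_derive_heat_q s0; exact: ex_derive.
have cq3 s : 0 < s -> {for s, continuous (fun a => heat_q a ^+ 3)}.
  move=> s0; apply/differentiable_continuous/derivable1_diffP.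
  have D := is_derive_heat_q s0.
  have -> : (fun a => heat_q a ^+ 3) = heat_q ^+ 3 by apply/funext => a; rewrite exprfctE.
  exact: ex_derive.
rewrite integral_itv_obnd_cbnd; last first.
  apply/measurable_EFinP; apply: measurable_funTS; apply: measurable_funX.
  exact: measurable_heat_q.
rewrite (@ge0_continuous_FTC2y _ _ (fun s => - 2^-1 * heat_q s) _ 0).
- by rewrite -EFinB; congr EFin; lra.
- by move=> x _; rewrite exprn_ge0// heat_q_ge0.
- apply/continuous_within_itvcyP; split.
    move=> s; rewrite /= in_itv/= andbT => ts.
    by apply: cq3; exact: lt_trans ts.
  apply: cvg_at_right_filter.
  exact: cq3.
- rewrite -[X in _ --> X](mulr0 (- 2^-1 : R)); apply: cvgMr; exact: heat_q_cvg0.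
- by move=> x tx; have D := is_derive_heat_q (lt_trans t0 tx); exact: ex_derive.
- by apply: cvg_at_right_filter; apply: cvgMr; exact: cq.
- move=> x; rewrite in_itv/= andbT => tx; rewrite derive1E.
  have D := is_derive_heat_q (lt_trans t0 tx).
  rewrite (_ : (fun s => _) = (- 2^-1) \*: heat_q)// derive_val.
  by rewrite -[_ *: _]/(_ * _) mulrA; lra.
Qed.

End heat_bounds.

(** * Size of the Oseen kernel *)

Section oseen.
Context {R : realType} {d : nat}.
Local Notation mu := (@lebesgue_rV R d).
Local Notation leb := (@lebesgue_measure R).
Implicit Types (x y z : 'rV[R]_d) (i j k : 'I_d) (s t r : R).
Local Notation D := (@heat_D R d).

(** The maximum of [heat_kernel t], attained at the origin. *)
Definition heat_peak t : R := (4 * pi * t) `^ (- (d%:R / 2)).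

Lemma heat_peak_ge0 t : 0 <= heat_peak t. Proof. exact: powR_ge0. Qed.

Lemma measurable_dddheat i j k x :
  measurable_fun [set: R] (fun s => dddheat s i j k x).
Proof.
exact: (measurableT_comp (measurable_dddheat2 i j k) (measurable_pair2 x)).
Qed.

Lemma measurable_heat_kernel_time (c : R) x :
  measurable_fun [set: R] (fun s => heat_kernel (c * s) x).
Proof.
apply: (measurableT_comp (measurableT_comp measurable_heat_kernel2 (measurable_pair2 x))).
exact: measurable_funM.
Qed.

Lemma measurable_oseen_kernel2 i j k : measurable_fun [set: R * 'rV[R]_d]
  (fun z : R * 'rV[R]_d => oseen_kernel z.1 i j k z.2).
Proof.
under eq_fun do rewrite oseen_kernelE.
apply: measurable_funD.
  by apply: measurable_funM => //; exact: measurable_dheat2.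
under eq_fun do rewrite Rintegral_mkcond.
(* The endpoint of the time integral moves with the parameter, so the domain is encoded as a test
   inside the integrand. *)
pose f (w : (R * 'rV[R]_d) * R) : R :=
  if w.1.1 < w.2 then dddheat w.2 i j k w.1.2 else 0.
rewrite (_ : (fun z : R * 'rV[R]_d => _) = (fun z : R * 'rV[R]_d => \int[leb]_s f (z, s))); last first.
  apply/funext => z; apply: eq_Rintegral => s _.
  by rewrite patchE mem_setE in_itv/= andbT.
apply: measurable_Rintegral_param.
apply: measurable_fun_if => //.
- apply: measurable_fun_ltr => //; exact: (measurableT_comp measurable_fst).
- apply: measurable_funTS.
  have mg : measurable_fun [set: (R * 'rV[R]_d) * R]
      (fun w : (R * 'rV[R]_d) * R => (w.2, w.1.2)).
    apply: measurable_fun_pair => //.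
    exact: (measurableT_comp measurable_snd).
  exact: (measurableT_comp (measurable_dddheat2 i j k) mg).
Qed.

Lemma measurable_oseen_kernel t i j k :
  measurable_fun [set: 'rV[R]_d] (oseen_kernel t i j k).
Proof.
exact: (measurableT_comp (measurable_oseen_kernel2 i j k) (measurable_pair1 t)).
Qed.

(** One majorant for all index triples. As a superposition of heat kernels with values in [\bar R]
    it can be handled by Tonelli before its finiteness is known. *)
Definition oseen_majorant t x : \bar R :=
  ((heat_q t * (D * heat_kernel (2 * t) x))%:E +
   \int[leb]_(s in `]t, +oo[) (heat_q s ^+ 3 * (D * heat_kernel (2 * s) x))%:E)%E.

Lemma measurable_majorant_integrand x :
  measurable_fun [set: R] (fun s => heat_q s ^+ 3 * (D * heat_kernel (2 * s) x)).
Proof.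
apply: measurable_funM; first by apply: measurable_funX; exact: measurable_heat_q.
by apply: measurable_funM => //; exact: measurable_heat_kernel_time.
Qed.

Lemma majorant_integrand_ge0 s x :
  0 <= heat_q s ^+ 3 * (D * heat_kernel (2 * s) x).
Proof.
by rewrite mulr_ge0 ?exprn_ge0 ?heat_q_ge0// mulr_ge0 ?heat_D_ge0 ?heat_kernel_ge0.
Qed.

Lemma integral_norm_dddheat_le t i j k x : 0 < t ->
  (\int[leb]_(s in `]t, +oo[) (`|dddheat s i j k x|)%:E <=
   \int[leb]_(s in `]t, +oo[) (heat_q s ^+ 3 * (D * heat_kernel (2 * s) x))%:E)%E.
Proof.
move=> t0; apply: ge0_le_integral => //.
- apply/measurable_EFinP; apply: measurableT_comp => //.
  by apply: measurable_funTS; exact: measurable_dddheat.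
- apply/measurable_EFinP; apply: measurable_funTS.
  exact: measurable_majorant_integrand.
- move=> s /=; rewrite in_itv/= andbT => ts; rewrite lee_fin.
  by apply: norm_dddheat_le; exact: lt_trans ts.
Qed.

Lemma norm_oseen_kernel_le t i j k x : 0 < t ->
  (`|oseen_kernel t i j k x|%:E <= oseen_majorant t x)%E.
Proof.
move=> t0; rewrite oseen_kernelE.
have : (`|(i == j)%:R * dheat t k x|%:E <=
    (heat_q t * (D * heat_kernel (2 * t) x))%:E)%E.
  rewrite lee_fin; case: eqP => _; rewrite ?mul1r ?mul0r ?normr0 ?norm_dheat_le//.
  by rewrite mulr_ge0 ?heat_q_ge0// mulr_ge0 ?heat_D_ge0 ?heat_kernel_ge0.
move=> h1.
have h2 : (`|\int[leb]_(s in `]t, +oo[) dddheat s i j k x|%:E <=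
    \int[leb]_(s in `]t, +oo[) (heat_q s ^+ 3 * (D * heat_kernel (2 * s) x))%:E)%E.
  apply: le_trans (integral_norm_dddheat_le _ _ _ _ t0).
  apply: normr_Rintegral_le => //.
  by apply: measurable_funTS; exact: measurable_dddheat.
apply: le_trans (leeD h1 h2); rewrite -EFinD lee_fin.
exact: ler_normD.
Qed.

Lemma ge0_integralZ_heat_q3 t (c : R) : 0 < t -> 0 <= c ->
  (\int[leb]_(s in `]t, +oo[) (heat_q s ^+ 3 * c)%:E = (heat_q t / 2 * c)%:E)%E.
Proof.
move=> t0 c0; under eq_integral do rewrite EFinM.
rewrite ge0_integralZr//.
- by rewrite integral_heat_q3.
- apply/measurable_EFinP; apply: measurable_funTS; apply: measurable_funX.
  exact: measurable_heat_q.
- by move=> s _; rewrite lee_fin exprn_ge0// heat_q_ge0.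
Qed.

Lemma oseen_majorant_le t x : 0 < t ->
  (oseen_majorant t x <= (2 * heat_q t * (D * heat_peak t))%:E)%E.
Proof.
move=> t0; have q0 := heat_q_ge0 t; have D0 := @heat_D_ge0 R d.
have P0 := heat_peak_ge0 t.
apply: (@le_trans _ _ ((heat_q t * (D * heat_peak t))%:E + (heat_q t / 2 * (D * heat_peak t))%:E)%E).
  apply: leeD; first by rewrite lee_fin !ler_wpM2l// heat_kernel2_le.
  rewrite -ge0_integralZ_heat_q3 ?mulr_ge0//; apply: ge0_le_integral => //.
  - by move=> s _; rewrite lee_fin majorant_integrand_ge0.
  - apply/measurable_EFinP; apply: measurable_funTS.
    exact: measurable_majorant_integrand.
  - apply/measurable_EFinP; apply: measurable_funTS; apply: measurable_funM => //.
    by apply: measurable_funX; exact: measurable_heat_q.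
  - move=> s /=; rewrite in_itv/= andbT => ts; rewrite lee_fin.
    rewrite ler_wpM2l ?exprn_ge0 ?heat_q_ge0// ler_wpM2l//.
    by rewrite heat_kernel2_le// ltW.
rewrite -EFinD lee_fin; have : 0 <= heat_q t * (D * heat_peak t) by rewrite !mulr_ge0.
lra.
Qed.

Lemma oseen_kernel_sup t i j k x : 0 < t ->
  `|oseen_kernel t i j k x| <= 2 * heat_q t * (D * heat_peak t).
Proof.
move=> t0; rewrite -lee_fin.
exact: le_trans (norm_oseen_kernel_le _ _ _ _ t0) (oseen_majorant_le _ t0).
Qed.

Let maj t (w : 'rV[R]_d * R) : R := if t < w.2 then
  heat_q w.2 ^+ 3 * (D * heat_kernel (2 * w.2) w.1) else 0.

Let maj_ge0 t w : 0 <= maj t w.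
Proof. by rewrite /maj; case: ifP => // _; exact: majorant_integrand_ge0. Qed.

Let measurable_maj t : measurable_fun [set: 'rV[R]_d * R] (maj t).
Proof.
apply: measurable_fun_if => //.
  exact: measurable_fun_ltr.
apply: measurable_funTS; apply: measurable_funM.
  by apply: measurable_funX; exact: (measurableT_comp measurable_heat_q).
apply: measurable_funM => //.
have mg : measurable_fun [set: 'rV[R]_d * R] (fun w : 'rV[R]_d * R => (2 * w.2, w.1)).
  by apply: measurable_fun_pair => //; exact: measurable_funM.
exact: (measurableT_comp measurable_heat_kernel2 mg).
Qed.

Let majE t y :
  (\int[leb]_(s in `]t, +oo[) (heat_q s ^+ 3 * (D * heat_kernel (2 * s) y))%:E =
    \int[leb]_s (maj t (y, s))%:E)%E.
Proof.
rewrite integral_mkcond; apply: eq_integral => s _.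
by rewrite patchE mem_setE in_itv/= andbT /maj/=; case: ifP.
Qed.

Lemma measurable_oseen_majorant t : measurable_fun [set: 'rV[R]_d] (oseen_majorant t).
Proof.
apply: emeasurable_funD.
  apply/measurable_EFinP; apply: measurable_funM => //; apply: measurable_funM => //.
  exact: measurable_heat_kernel.
under eq_fun do rewrite majE.
by apply: (@measurable_integral_param _ _ _ _ _ leb (EFin \o maj t)); apply/measurable_EFinP; exact: measurable_maj.
Qed.

(** By Tonelli every heat kernel contributes its mass one, which leaves [D] times [heat_q t] plus
    the integral of [heat_q^3] over []t, +oo[]. *)
Lemma integral_oseen_majorant t x : 0 < t ->
  (\int[mu]_y oseen_majorant t (x - y)%R = (3 / 2 * heat_q t * D)%:E)%E.
Proof.
move=> t0; have q0 := heat_q_ge0 t; have D0 := @heat_D_ge0 R d.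
have mK s : measurable_fun [set: 'rV[R]_d] (fun y => heat_kernel (2 * s) (x - y)).
  exact: (measurableT_comp (measurable_heat_kernel _) (measurable_subrV x)).
have IK s : 0 < s -> (\int[mu]_y (D * heat_kernel (2 * s) (x - y))%:E = D%:E)%E.
  move=> s0; under eq_integral do rewrite EFinM.
  rewrite ge0_integralZl//; first by rewrite integral_heat_kernel ?mule1 ?mulr_gt0.
  - exact/measurable_EFinP.
  - by move=> y _; rewrite lee_fin heat_kernel_ge0.
pose f (w : 'rV[R]_d * R) : R := maj t (x - w.1, w.2).
have mf : measurable_fun [set: 'rV[R]_d * R] f.
  apply: (measurableT_comp (measurable_maj t)); apply: measurable_fun_pair => //.
  exact: (measurableT_comp (measurable_subrV x)).
rewrite /oseen_majorant ge0_integralD//; last 4 first.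
- by move=> y _; rewrite lee_fin mulr_ge0// mulr_ge0// heat_kernel_ge0.
- by apply/measurable_EFinP; apply: measurable_funM => //; exact: measurable_funM.
- by move=> y _; apply: integral_ge0 => s _; rewrite lee_fin majorant_integrand_ge0.
- under eq_fun do rewrite majE.
  by apply: (@measurable_integral_param _ _ _ _ _ leb (EFin \o f)); apply/measurable_EFinP; exact: mf.
rewrite (_ : 3 / 2 * heat_q t * D = heat_q t * D + heat_q t / 2 * D); last by lra.
rewrite EFinD; congr (_ + _)%E.
  under eq_integral do rewrite EFinM.
  rewrite ge0_integralZl ?lee_fin//; first by rewrite IK// EFinM.
  - by apply/measurable_EFinP; exact: measurable_funM.
  - by move=> y _; rewrite lee_fin mulr_ge0// heat_kernel_ge0.
under eq_integral do rewrite majE.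
transitivity (\int[leb]_s \int[mu]_y (f (y, s))%:E)%E.
  apply: (@fubini_tonelli _ _ _ _ R mu leb (EFin \o f)); first by apply/measurable_EFinP; exact: mf.
  by move=> w; rewrite lee_fin; exact: maj_ge0.
rewrite -ge0_integralZ_heat_q3// [RHS]integral_mkcond; apply: eq_integral => s _.
rewrite patchE mem_setE in_itv/= andbT /f /maj/=; case: ifP => ts; last exact: integral0.
have s0 := lt_trans t0 ts.
under eq_integral do rewrite EFinM.
rewrite ge0_integralZl ?lee_fin ?exprn_ge0 ?heat_q_ge0//.
- by rewrite IK// EFinM.
- by apply/measurable_EFinP; exact: measurable_funM.
- by move=> y _; rewrite lee_fin mulr_ge0// heat_kernel_ge0.
Qed.

Lemma integral_oseen_kernel t i j k x : 0 < t ->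
  (\int[mu]_y `|oseen_kernel t i j k (x - y)|%:E <= (3 / 2 * heat_q t * D)%:E)%E.
Proof.
move=> t0; rewrite -(integral_oseen_majorant x)//; apply: ge0_le_integral => //.
- apply/measurable_EFinP; apply: measurableT_comp => //.
  exact: (measurableT_comp (measurable_oseen_kernel t i j k) (measurable_subrV x)).
- exact: (measurableT_comp (measurable_oseen_majorant t) (measurable_subrV x)).
- by move=> y _; exact: norm_oseen_kernel_le.
Qed.

(** The majorant is even in space, so the same bound serves for both mass conditions of Schur's
    test. *)
Lemma integral_oseen_kernell t i j k y : 0 < t ->
  (\int[mu]_x `|oseen_kernel t i j k (x - y)|%:E <= (3 / 2 * heat_q t * D)%:E)%E.
Proof.
move=> t0; rewrite -(integral_oseen_majorant y)//; apply: ge0_le_integral => //.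
- apply/measurable_EFinP; apply: measurableT_comp => //.
  exact: (measurableT_comp (measurable_oseen_kernel t i j k) (measurable_subrVr y)).
- exact: (measurableT_comp (measurable_oseen_majorant t) (measurable_subrV y)).
move=> x _; apply: le_trans (norm_oseen_kernel_le _ _ _ _ t0) _.
rewrite /oseen_majorant heat_kernelB.
by under eq_integral do rewrite heat_kernelB.
Qed.

End oseen.

(** * Semigroup identities for the kernels *)

Section oseen_semigroup.
Context {R : realType} {d : nat}.
Local Notation mu := (@lebesgue_rV R d).
Local Notation leb := (@lebesgue_measure R).
Implicit Types (x y z : 'rV[R]_d) (i j k : 'I_d) (s t r : R).
Local Notation D := (@heat_D R d).
Local Notation P := (@heat_peak R d).

Lemma Rintegral_heat_kernelM r s x z : 0 < r -> 0 < s ->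
  \int[mu]_y (heat_kernel r (x - y) * heat_kernel s (y - z)) =
  heat_kernel (r + s) (x - z).
Proof. by move=> r0 s0; rewrite /Rintegral integral_heat_kernelM. Qed.

Lemma measurable_dheat s k : measurable_fun [set: 'rV[R]_d] (dheat s k).
Proof. exact: (measurableT_comp (measurable_dheat2 k) (measurable_pair1 s)). Qed.

Lemma measurable_ddheat s j k : measurable_fun [set: 'rV[R]_d] (ddheat s j k).
Proof.
have mx l : measurable_fun [set: 'rV[R]_d] (fun x : 'rV[R]_d => x ord0 l).
  exact: (@measurable_coord _ R d l).
apply: measurable_funM; last exact: measurable_heat_kernel.
by apply: measurable_funB => //; do 2 (apply: measurable_funM => //).
Qed.

(** A single constant for all orders, because [heat_kernel_conv_derive] takes the same bound for a
    function and for its derivative. *)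
Let heat_bound s : 0 < s -> exists C : R, forall i j k x,
  [/\ `|heat_kernel s x| <= C, `|dheat s k x| <= C, `|ddheat s j k x| <= C &
      `|dddheat s i j k x| <= C].
Proof.
move=> s0.
pose B := D * P s.
have B0 : 0 <= B by rewrite mulr_ge0 ?heat_D_ge0 ?heat_peak_ge0.
have KB x : D * heat_kernel (2 * s) x <= B.
  by rewrite ler_wpM2l ?heat_D_ge0// heat_kernel2_le.
pose q := heat_q s.
have q0 : 0 <= q by exact: heat_q_ge0.
have P0 : 0 <= P s :> R by exact: heat_peak_ge0.
have [p1 [p2 p3]] : 0 <= q * B /\ 0 <= q ^+ 2 * B /\ 0 <= q ^+ 3 * B.
  by rewrite !mulr_ge0// exprn_ge0.
exists (P s + q * B + q ^+ 2 * B + q ^+ 3 * B) => i j k x; split.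
- apply: (@le_trans _ _ (P s)); last by lra.
  by rewrite ger0_norm ?heat_kernel_ge0// heat_kernel_le.
- apply: (@le_trans _ _ (q * B)); last by lra.
  by apply: (le_trans (norm_dheat_le _ _ s0)); rewrite ler_wpM2l.
- apply: (@le_trans _ _ (q ^+ 2 * B)); last by lra.
  by apply: (le_trans (norm_ddheat_le _ _ _ s0)); rewrite ler_wpM2l// exprn_ge0.
- apply: (@le_trans _ _ (q ^+ 3 * B)); last by lra.
  by apply: (le_trans (norm_dddheat_le _ _ _ _ s0)); rewrite ler_wpM2l// exprn_ge0.
Qed.

(** First of three steps that differentiate the semigroup law of the heat kernel; orders one and
    three are the ones that occur in the Oseen kernel. *)
Lemma heat_kernel_conv_dheat r s k x z : 0 < r -> 0 < s ->
  \int[mu]_y (heat_kernel r (x - y) * dheat s k (y - z)) = dheat (r + s) k (x - z).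
Proof.
move=> r0 s0; have [C bC] := heat_bound s0.
apply: (@heat_kernel_conv_derive _ _ _ C (heat_kernel s) (heat_kernel (r + s))
  _ _ (delta_mx ord0 k)) => //.
- exact: measurable_heat_kernel.
- by move=> y; have [] := bC k k k y.
- by move=> y; exact: is_derive_heat_kernel.
- by move=> y; have [] := bC k k k y.
- by move=> y; exact: is_derive_heat_kernel.
- by move=> ? ?; exact: Rintegral_heat_kernelM.
Qed.

Lemma heat_kernel_conv_ddheat r s j k x z : 0 < r -> 0 < s ->
  \int[mu]_y (heat_kernel r (x - y) * ddheat s j k (y - z)) = ddheat (r + s) j k (x - z).
Proof.
move=> r0 s0; have [C bC] := heat_bound s0.
apply: (@heat_kernel_conv_derive _ _ _ C (dheat s k) (dheat (r + s) k)
  _ _ (delta_mx ord0 j)) => //.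
- exact: measurable_dheat.
- by move=> y; have [] := bC k k k y.
- by move=> y; exact: is_derive_dheat.
- by move=> y; have [] := bC k j k y.
- by move=> y; exact: is_derive_dheat.
- by move=> ? ?; exact: heat_kernel_conv_dheat.
Qed.

Lemma heat_kernel_conv_dddheat r s i j k x z : 0 < r -> 0 < s ->
  \int[mu]_y (heat_kernel r (x - y) * dddheat s i j k (y - z)) =
  dddheat (r + s) i j k (x - z).
Proof.
move=> r0 s0; have [C bC] := heat_bound s0.
apply: (@heat_kernel_conv_derive _ _ _ C (ddheat s j k) (ddheat (r + s) j k)
  _ _ (delta_mx ord0 i)) => //.
- exact: measurable_ddheat.
- by move=> y; have [] := bC k j k y.
- by move=> y; exact: is_derive_ddheat.
- by move=> y; have [] := bC i j k y.
- by move=> y; exact: is_derive_ddheat.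
- by move=> ? ?; exact: heat_kernel_conv_ddheat.
Qed.

(** The local part is [heat_kernel_conv_dheat]. In the nonlocal part Fubini brings the convolution
    inside the time integral, where it advances the time [s] by [r]; the shift then carries []t,
    +oo[] to []r + t, +oo[]. *)
Lemma heat_kernel_conv_oseen r t i j k x z : 0 < r -> 0 < t ->
  \int[mu]_y (heat_kernel r (x - y) * oseen_kernel t i j k (y - z)) =
  oseen_kernel (r + t) i j k (x - z).
Proof.
move=> r0 t0.
have mKr : measurable_fun [set: 'rV[R]_d] (fun y => heat_kernel r (x - y)).
  exact: (measurableT_comp (measurable_heat_kernel r) (measurable_subrV x)).
pose f (w : 'rV[R]_d * R) : R := heat_kernel r (x - w.1) *
  (if t < w.2 then dddheat w.2 i j k (w.1 - z) else 0).
have mf : measurable_fun [set: 'rV[R]_d * R] f.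
  apply: measurable_funM; first exact: (measurableT_comp mKr).
  apply: measurable_fun_if => //; first exact: measurable_fun_ltr.
  apply: measurable_funTS.
  have mg : measurable_fun [set: 'rV[R]_d * R]
      (fun w : 'rV[R]_d * R => (w.2, w.1 - z)).
    apply: measurable_fun_pair => //.
    exact: (measurableT_comp (measurable_subrVr z)).
  exact: (measurableT_comp (measurable_dddheat2 i j k) mg).
(* Absolute integrability for Fubini: [K_r] is bounded by its peak, and the rest by the mass of the
   majorant. *)
have foo : (\int[mu]_y \int[leb]_s (`|f (y, s)|)%:E < +oo)%E.
  apply: (@le_lt_trans _ _ (\int[mu]_y ((P r)%:E * oseen_majorant t (y - z)%R))%E).
    apply: ge0_le_integral => //.
    - by move=> y _; apply: integral_ge0.
    - apply: (@measurable_integral_param _ _ _ _ _ leb (EFin \o (Num.norm \o f))).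
      by apply/measurable_EFinP; exact: measurableT_comp.
    - apply: emeasurable_funM => //.
      exact: (measurableT_comp (measurable_oseen_majorant t) (measurable_subrVr z)).
    move=> y _.
    have -> : (\int[leb]_s (`|f (y, s)|)%:E = (heat_kernel r (x - y))%:E *
        \int[leb]_(s in `]t, +oo[) (`|dddheat s i j k (y - z)|)%:E)%E.
      rewrite -ge0_integralZl//; first last.
      - by rewrite lee_fin heat_kernel_ge0.
      - by apply/measurable_EFinP; apply: measurableT_comp => //;
          apply: measurable_funTS; exact: measurable_dddheat.
      rewrite [RHS]integral_mkcond; apply: eq_integral => s _.
      rewrite patchE mem_setE in_itv/= andbT /f/=.
      by case: ifP => _; rewrite ?mulr0 ?normr0// normrM (ger0_norm (heat_kernel_ge0 _ _)).
    apply: lee_pmul.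
    - by rewrite lee_fin heat_kernel_ge0.
    - exact: integral_ge0.
    - by rewrite lee_fin heat_kernel_le.
    apply: le_trans (integral_norm_dddheat_le _ _ _ _ t0) _.
    rewrite leeDr// lee_fin mulr_ge0 ?heat_q_ge0// mulr_ge0 ?heat_D_ge0 ?heat_kernel_ge0//.
  rewrite ge0_integralZl//; last 3 first.
  - exact: (measurableT_comp (measurable_oseen_majorant t) (measurable_subrVr z)).
  - by move=> y _; exact: le_trans (norm_oseen_kernel_le i j k _ t0).
  - by rewrite lee_fin heat_peak_ge0.
  under eq_integral.
    move=> y _; rewrite (_ : oseen_majorant t (y - z) = oseen_majorant t (z - y)); last first.
      rewrite /oseen_majorant heat_kernelB.
      by under eq_integral do rewrite heat_kernelB.
    over.
  by rewrite integral_oseen_majorant// -EFinM ltry.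
have [C bC] := heat_bound t0.
have intd : mu.-integrable [set: 'rV[R]_d]
    (fun y => (heat_kernel r (x - y) * ((i == j)%:R * dheat t k (y - z)))%:E).
  apply: (integrable_heat_kernelM (C := C)) => //.
    apply: measurable_funM => //.
    exact: (measurableT_comp (measurable_dheat t k) (measurable_subrVr z)).
  move=> y; have [CK Cd _ _] := bC i j k (y - z).
  by case: eqP => _; rewrite ?mul1r ?mul0r ?normr0//; exact: le_trans Cd.
have fiE y : \int[leb]_s f (y, s) =
    heat_kernel r (x - y) * \int[leb]_(s in `]t, +oo[) dddheat s i j k (y - z).
  have foo' : leb.-integrable `]t, +oo[ (EFin \o (fun s => dddheat s i j k (y - z))).
    apply: integrable_EFinP => //.
      by apply: measurable_funTS; exact: measurable_dddheat.
    apply: le_lt_trans (integral_norm_dddheat_le _ _ _ _ t0) _.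
    apply: (@le_lt_trans _ _ (oseen_majorant t (y - z))).
      by rewrite leeDr// lee_fin mulr_ge0 ?heat_q_ge0// mulr_ge0 ?heat_D_ge0 ?heat_kernel_ge0.
    exact: le_lt_trans (oseen_majorant_le _ t0) (ltry _).
  rewrite -RintegralZl// [RHS]Rintegral_mkcond; apply: eq_Rintegral => s _.
  rewrite patchE mem_setE in_itv/= andbT /f/=.
  by case: ifP => _; rewrite ?mulr0.
under eq_Rintegral do rewrite oseen_kernelE mulrDr -fiE.
rewrite RintegralD//; last exact: (@integrable_Rintegral_param _ _ _ _ _ mu leb f mf foo).
rewrite (@Rintegral_fubini _ _ _ _ _ mu leb f mf foo) oseen_kernelE; congr (_ + _).
  under eq_Rintegral do rewrite mulrCA.
  rewrite RintegralZl//; first by rewrite heat_kernel_conv_dheat.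
  apply: (integrable_heat_kernelM (C := C)) => //.
    exact: (measurableT_comp (measurable_dheat t k) (measurable_subrVr z)).
  by move=> y; have [] := bC i j k (y - z).
rewrite -Rintegral_shift_itvy; last by apply: measurable_funTS; exact: measurable_dddheat.
rewrite [RHS]Rintegral_mkcond; apply: eq_Rintegral => s _.
rewrite patchE mem_setE in_itv/= andbT /f/=; case: ifP => ts.
  by rewrite heat_kernel_conv_dddheat// (lt_trans t0).
under eq_Rintegral do rewrite mulr0.
by rewrite /Rintegral integral0.
Qed.

End oseen_semigroup.

(** * Schur and Minkowski inequalities *)

Section ge0_integral_tools.
Context {R : realType}.

Lemma lee_poweR (x y : \bar R) (r : R) : 0 <= r -> (0 <= x)%E -> (x <= y)%E ->
  (x `^ r <= y `^ r)%E.
Proof.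
move=> r0 x0 xy; apply: gt0_ler_poweR => //; rewrite in_itv/= leey andbT//.
exact: le_trans xy.
Qed.

End ge0_integral_tools.

Section jensen.
Context {R : realType} dT (T : measurableType dT).
Variable m : {measure set T -> \bar R}.
Implicit Types (k f : T -> R).

(** Jensen for a weight of mass at most [a]: Hoelder applied to [k^(1/q) f] and [k^(1/q')]. *)
Lemma weighted_jensen (q a : R) k f : 1 < q -> 0 <= a ->
  measurable_fun [set: T] k -> measurable_fun [set: T] f ->
  (forall x, 0 <= k x) -> (forall x, 0 <= f x) ->
  (\int[m]_x (k x)%:E <= a%:E)%E ->
  ((\int[m]_x (k x * f x)%:E) `^ q <=
   (a `^ (q - 1))%:E * \int[m]_x (k x * f x `^ q)%:E)%E.
Proof.
move=> q1 a0 mk mf k0 f0 ka.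
have q0 : 0 < q by exact: lt_trans q1.
have qn0 : q != 0 by rewrite gt_eqF.
pose q' := q / (q - 1).
have q'0 : 0 < q' by rewrite divr_gt0// subr_gt0.
have qq' : q^-1 + q'^-1 = 1.
  by rewrite /q'; field; rewrite qn0 gt_eqF// subr_gt0.
pose F x := k x `^ q^-1 * f x; pose G x := k x `^ q'^-1.
have mF : measurable_fun [set: T] F.
  by apply: measurable_funM => //; exact: (measurableT_comp (measurable_powR _)).
have mG : measurable_fun [set: T] G by exact: (measurableT_comp (measurable_powR _)).
have H := hoelder m mF mG q0 q'0 qq'.
have E1 : (\int[m]_x (k x * f x)%:E = 'N[m]_1[EFin \o (F \* G)%R])%E.
  rewrite Lnorm1; apply: eq_integral => x _ /=; congr EFin.
  rewrite ger0_norm ?mulr_ge0 ?powR_ge0// /F /G mulrAC -powRD ?qq' ?oner_eq0//.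
  by rewrite powRr1.
have E2 : ('N[m]_q%:E[EFin \o F] `^ q = \int[m]_x (k x * f x `^ q)%:E)%E.
  rewrite poweR_Lnorm//; apply: eq_integral => x _ /=.
  rewrite ger0_norm ?mulr_ge0 ?powR_ge0//; congr EFin.
  by rewrite /F powRM ?powR_ge0// -powRrM mulVf// powRr1.
have E3 : ('N[m]_q'%:E[EFin \o G] `^ q <= (a `^ (q - 1))%:E)%E.
  have q'n0 : q' != 0 by rewrite gt_eqF.
  have -> : q = q' * (q - 1) by rewrite /q' divfK// subr_eq0 gt_eqF.
  rewrite poweRrM poweR_Lnorm// (_ : q' * (q - 1) - 1 = q - 1); last first.
    by rewrite /q' divfK// subr_eq0 gt_eqF.
  rewrite -poweR_EFin; apply: lee_poweR.
  - by rewrite subr_ge0 ltW.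
  - by apply: integral_ge0 => x _; exact: poweR_ge0.
  apply: le_trans ka; rewrite le_eqVlt; apply/orP; left; apply/eqP.
  apply: eq_integral => x _ /=.
  by rewrite ger0_norm ?powR_ge0// -powRrM mulVf// powRr1.
rewrite E1; apply: (@le_trans _ _ (('N[m]_q%:E[EFin \o F] * 'N[m]_q'%:E[EFin \o G]) `^ q)%E).
  by apply: lee_poweR; [exact: ltW|exact: Lnorm_ge0|exact: H].
rewrite poweRM ?Lnorm_ge0// E2 muleC; apply: lee_pmul => //.
  exact: poweR_ge0.
by apply: integral_ge0 => x _; rewrite lee_fin mulr_ge0// powR_ge0.
Qed.

End jensen.

Section schur.
Context {R : realType} d1 d2 (T1 : measurableType d1) (T2 : measurableType d2).
Variables (m1 : {sigma_finite_measure set T1 -> \bar R})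
  (m2 : {sigma_finite_measure set T2 -> \bar R}).
Variable k : T1 * T2 -> R.
Hypotheses (mk : measurable_fun [set: T1 * T2] k) (k0 : forall w, 0 <= k w).

Let mk1 x : measurable_fun [set: T2] (fun y => k (x, y)).
Proof. exact: (measurableT_comp mk (measurable_pair1 x)). Qed.

Let mk2 y : measurable_fun [set: T1] (fun x => k (x, y)).
Proof. exact: (measurableT_comp mk (measurable_pair2 y)). Qed.

Let mkf (f : T2 -> R) : measurable_fun [set: T2] f ->
  measurable_fun [set: T1 * T2] (fun w : T1 * T2 => k w * f w.2).
Proof. by move=> mf; apply: measurable_funM => //; exact: (measurableT_comp mf). Qed.

Lemma measurable_kernel_op (f : T2 -> R) : measurable_fun [set: T2] f ->
  measurable_fun [set: T1] (fun x => \int[m2]_y (k (x, y) * f y)%:E)%E.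
Proof.
move=> mf; apply: (@measurable_integral_param _ _ _ _ _ m2 (fun w => (k w * f w.2)%:E)).
by apply/measurable_EFinP; exact: mkf.
Qed.

Lemma kernel_op_integral_le (b : R) (f : T2 -> R) : 0 <= b ->
  (forall y, (\int[m1]_x (k (x, y))%:E <= b%:E)%E) ->
  measurable_fun [set: T2] f -> (forall y, 0 <= f y) ->
  (\int[m1]_x \int[m2]_y (k (x, y) * f y)%:E <= b%:E * \int[m2]_y (f y)%:E)%E.
Proof.
move=> b0 kb mf f0.
rewrite (@fubini_tonelli _ _ _ _ R m1 m2 (fun w => (k w * f w.2)%:E)); last 2 first.
- by apply/measurable_EFinP; exact: mkf.
- by move=> w; rewrite lee_fin mulr_ge0.
rewrite -ge0_integralZl//; last 2 first.
- exact/measurable_EFinP.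
- by move=> y _; rewrite lee_fin.
apply: ge0_le_integral => //.
- by move=> y _; apply: integral_ge0 => x _; rewrite lee_fin mulr_ge0.
- have := @measurable_integral_param _ _ _ T2 T1 m1 (fun w => (k (w.2, w.1) * f w.1)%:E).
  apply; apply/measurable_EFinP; apply: measurable_funM.
    exact: (measurableT_comp mk (@measurable_swap _ _ T2 T1)).
  exact: (measurableT_comp mf).
- by apply: emeasurable_funM => //; exact/measurable_EFinP.
move=> y _ /=; under eq_integral do rewrite EFinM.
rewrite ge0_integralZr ?lee_fin//; first by rewrite lee_wpmul2r ?lee_fin.
- exact/measurable_EFinP.
- by move=> x _; rewrite lee_fin.
Qed.

(** Jensen in [y] costs [a^(q - 1)] and Tonelli in [x] costs [b]. Keeping the two masses apart
    matters for sparse data, where only [a] is small. *)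
Lemma schur_test (q a b : R) (f : T2 -> R) : 1 < q -> 0 <= a -> 0 <= b ->
  (forall x, (\int[m2]_y (k (x, y))%:E <= a%:E)%E) ->
  (forall y, (\int[m1]_x (k (x, y))%:E <= b%:E)%E) ->
  measurable_fun [set: T2] f -> (forall y, 0 <= f y) ->
  (\int[m1]_x (\int[m2]_y (k (x, y) * f y)%:E) `^ q <=
   (a `^ (q - 1) * b)%:E * \int[m2]_y (f y `^ q)%:E)%E.
Proof.
move=> q1 a0 b0 ka kb mf f0.
have mfq : measurable_fun [set: T2] (fun y => f y `^ q).
  exact: (measurableT_comp (measurable_powR _)).
apply: (@le_trans _ _ (\int[m1]_x ((a `^ (q - 1))%:E * \int[m2]_y (k (x, y) * f y `^ q)%:E))%E).
  apply: ge0_le_integral => //.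
  - by move=> x _; exact: poweR_ge0.
  - by apply: (measurableT_comp (measurable_poweR _)); exact: measurable_kernel_op.
  - by apply: emeasurable_funM => //; exact: (measurable_kernel_op mfq).
  - by move=> x _; apply: weighted_jensen.
rewrite ge0_integralZl ?lee_fin ?powR_ge0//; last 2 first.
- exact: (measurable_kernel_op mfq).
- by move=> x _; apply: integral_ge0 => y _; rewrite lee_fin mulr_ge0 ?powR_ge0.
rewrite EFinM -muleA; apply: lee_wpmul2l; first by rewrite lee_fin powR_ge0.
by apply: kernel_op_integral_le => // y; exact: powR_ge0.
Qed.

(* With [J = int k f^p], Jensen gives [(int k f^2)^(p/2) <= a^(p/2-1) J], and
   [J] is bounded pointwise by [b int f^p]. *)
Lemma schur_test_sqr (p a b : R) (f : T2 -> R) : 2 < p -> 0 <= a -> 0 <= b ->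
  (forall x, (\int[m2]_y (k (x, y))%:E <= a%:E)%E) ->
  (forall y, (\int[m1]_x (k (x, y))%:E <= a%:E)%E) ->
  (forall w, k w <= b) ->
  measurable_fun [set: T2] f -> (forall y, 0 <= f y) ->
  (\int[m1]_x (\int[m2]_y (k (x, y) * f y ^+ 2)%:E) `^ p <=
   (a `^ (p - 1) * b)%:E * (\int[m2]_y (f y `^ p)%:E * \int[m2]_y (f y `^ p)%:E))%E.
Proof.
move=> p2 a0 b0 ka ka' kb mf f0.
pose q := p / 2; have q1 : 1 < q by rewrite /q; lra.
have mf2 : measurable_fun [set: T2] (fun y => f y ^+ 2) by exact: measurable_funX.
have mfp : measurable_fun [set: T2] (fun y => f y `^ p).
  exact: (measurableT_comp (measurable_powR _)).
set G := (\int[m2]_y (f y `^ p)%:E)%E.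
have G0 : (0 <= G)%E by apply: integral_ge0 => y _; rewrite lee_fin powR_ge0.
pose J x := (\int[m2]_y (k (x, y) * f y `^ p)%:E)%E.
have J0 x : (0 <= J x)%E.
  by apply: integral_ge0 => y _; rewrite lee_fin mulr_ge0 ?powR_ge0.
have mJ : measurable_fun [set: T1] J by exact: (measurable_kernel_op mfp).
have JG x : (J x <= b%:E * G)%E.
  rewrite -ge0_integralZl//; last 2 first.
  - exact/measurable_EFinP.
  - by move=> y _; rewrite lee_fin powR_ge0.
  apply: ge0_le_integral => //.
  - by move=> y _; rewrite lee_fin mulr_ge0 ?powR_ge0.
  - by apply/measurable_EFinP; exact: measurable_funM.
  - by apply: emeasurable_funM => //; exact/measurable_EFinP.
  - by move=> y _; rewrite -EFinM lee_fin ler_wpM2r ?powR_ge0.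
(* The [p]-th power is the square of the [p/2]-th, so Jensen gives [a^(p - 2) J^2]; one factor [J]
   is then replaced by its bound [b G]. *)
have HJ x : ((\int[m2]_y (k (x, y) * f y ^+ 2)%:E) `^ p <=
    (a `^ (p - 2) * b)%:E * G * J x)%E.
  have -> : p = q * 2 by rewrite /q; lra.
  rewrite poweRrM.
  have := @weighted_jensen _ _ _ m2 q a (fun y => k (x, y)) (fun y => f y ^+ 2) q1 a0
    (mk1 x) mf2 (fun y => k0 _) (fun y => sqr_ge0 _) (ka x).
  under [X in (_ <= _ * X)%E -> _]eq_integral.
    move=> y _; rewrite -powR_mulrn// -powRrM (_ : 2%:R * q = p); last by rewrite /q; lra.
    over.
  rewrite -/(J x) => H.
  apply: (@le_trans _ _ (((a `^ (q - 1))%:E * J x) `^ 2)%E).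
    by apply: lee_poweR => //; exact: poweR_ge0.
  rewrite poweRM ?lee_fin ?powR_ge0// poweR_EFin -powRrM.
  rewrite (_ : (q - 1) * 2 = q * 2 - 2); last by lra.
  rewrite EFinM -!muleA; apply: lee_wpmul2l; first by rewrite lee_fin powR_ge0.
  rewrite (_ : (J x `^ 2 = J x * J x)%E); first by rewrite muleA lee_wpmul2r.
  have := J0 x; case: (J x) => [r|_|//].
    by rewrite lee_fin => r0; rewrite poweR_EFin powR_mulrn// -EFinM expr2.
  by rewrite /poweR pnatr_eq0/= mulyy.
apply: (@le_trans _ _ (\int[m1]_x ((a `^ (p - 2) * b)%:E * G * J x))%E).
  apply: ge0_le_integral => //.
  - by move=> x _; exact: poweR_ge0.
  - by apply: (measurableT_comp (measurable_poweR _)); exact: (measurable_kernel_op mf2).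
  - exact: emeasurable_funM.
rewrite ge0_integralZl//; last by rewrite mule_ge0// lee_fin mulr_ge0 ?powR_ge0.
have JI : (\int[m1]_x J x <= a%:E * G)%E.
  by apply: kernel_op_integral_le => // y; exact: powR_ge0.
apply: (@le_trans _ _ ((a `^ (p - 2) * b)%:E * G * (a%:E * G))%E).
  by apply: lee_wpmul2l => //; rewrite mule_ge0// lee_fin mulr_ge0 ?powR_ge0.
rewrite muleACA -EFinM mulrAC (_ : a `^ (p - 2) * a = a `^ (p - 1))//.
have [->|an0] := eqVneq a 0; first by rewrite mulr0 powR0// gt_eqF//; lra.
rewrite -[X in _ * X](powRr1 a0) -powRD; last by rewrite an0 implybT.
by congr (_ `^ _); lra.
Qed.

End schur.

Section singular_integral.
Context {R : realType}.
Local Notation leb := (@lebesgue_measure R).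

Lemma measurable_powR_sub (r th : R) : measurable_fun [set: R] (fun s => (r - s) `^ th).
Proof. by apply: (measurableT_comp (measurable_powR _)); exact: measurable_funB. Qed.

Lemma is_derive_powR_sub (r th s : R) : th != 0 -> s < r ->
  is_derive s 1 (fun a => - th^-1 * (r - a) `^ th) ((r - s) `^ (th - 1)).
Proof.
move=> th0 sr; have rs0 : 0 < r - s by rewrite subr_gt0.
have D1 : is_derive s 1 (fun a : R => r - a) (-1).
  by apply: is_derive_eq; rewrite add0r mul1r.
have D2 := @is_derive1_comp _ (fun y => y `^ th) (fun a => r - a) _ _ _ (is_derive1_powR th rs0) D1.
rewrite (_ : (fun a => _) = (- th^-1) \*: ((powR (R:=R))^~ th \o (fun a => r - a)))//.
apply: is_derive_eq; rewrite -[_ *: _]/(_ * _).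
by rewrite mulrN1 mulrNN mulrA mulVf// mul1r.
Qed.

(** For [th < 1] the integrand is singular at [s = r]; the interval is exhausted by
    [[0, r - 1/(n+1)]], on which the fundamental theorem applies. *)
Lemma integral_powR_sub_le (r th : R) : 0 < r -> 0 < th ->
  (\int[leb]_(s in `]0%R, r[) ((r - s) `^ (th - 1))%:E <= (th^-1 * r `^ th)%:E)%E.
Proof.
move=> r0 th0.
have thn0 : th != 0 by rewrite gt_eqF.
pose f s := ((r - s) `^ (th - 1))%:E.
have mf D : measurable_fun D f.
  by apply/measurable_EFinP; apply: measurable_funTS; exact: measurable_powR_sub.
have f0 s : (0 <= f s)%E by rewrite lee_fin powR_ge0.
apply: (@le_trans _ _ (\int[leb]_(s in `[0%R, r[) f s)%E).
  apply: ge0_subset_integral => //.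
  - exact: mf.
  - by move=> x _; exact: f0.
  - by move=> x /=; rewrite !in_itv/= => /andP[/ltW -> ->].
rewrite itv_bnd_open_bigcup.
have := @ge0_nondecreasing_set_cvg_integral _ (measurableTypeR R) R
  (fun n => `[0, (r - n.+1%:R^-1)]%classic) f leb.
move=> /(_ _ _ (fun _ => mf _) (fun _ _ _ => f0 _)) cvgI.
have {}cvgI : (\int[leb]_(x in `[0%R, (r - n.+1%:R^-1)%R]) f x)%E @[n --> \oo] -->
    (\int[leb]_(x in \bigcup_i `[0%R, (r - i.+1%:R^-1)%R]%classic) f x)%E.
  apply: cvgI => //.
  apply/nondecreasing_seqP => n; rewrite subsetEset; apply: subset_itvl.
  by rewrite bnd_simp lerB// lef_pV2 ?posrE// ler_nat.
rewrite -(cvg_lim _ cvgI)//; apply: lime_le; first by apply/cvg_ex; eexists; exact: cvgI.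
apply: nearW => n.
set b := r - n.+1%:R^-1.
have br : b < r by rewrite ltrBlDr ltrDl invr_gt0.
have B0 : 0 <= th^-1 * r `^ th by rewrite mulr_ge0 ?powR_ge0// invr_ge0 ltW.
(* For the first few [n] the interval can be empty or a single point. *)
have [b0|b0] := leP b 0.
  have : (\int[leb]_(x in `[0%R, b]) f x <= \int[leb]_(x in [set 0%R]) f x)%E.
    apply: ge0_subset_integral => //; first exact: mf.
    move=> x /=; rewrite in_itv/= => /andP[x0 xb].
    by apply/eqP; rewrite eq_le x0 (le_trans xb b0).
  by rewrite integral_set1 => /le_trans; apply; rewrite lee_fin.
have Dx x : x < r -> is_derive x 1 (fun a => - th^-1 * (r - a) `^ th) ((r - x) `^ (th - 1)).
  by move=> xr; exact: is_derive_powR_sub.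
have cF x : x < r -> {for x, continuous (fun a => - th^-1 * (r - a) `^ th)}.
  move=> xr; apply/differentiable_continuous/derivable1_diffP.
  by have D := Dx x xr; exact: ex_derive.
have cf x : x < r -> {for x, continuous (fun s => (r - s) `^ (th - 1))}.
  move=> xr; apply/differentiable_continuous/derivable1_diffP.
  have rx0 : 0 < r - x by rewrite subr_gt0.
  have D1 : is_derive x 1 (fun a : R => r - a) (-1).
    by apply: is_derive_eq; rewrite add0r mul1r.
  by have D2 := @is_derive1_comp _ (fun y => y `^ (th - 1)) (fun a => r - a) _ _ _ (is_derive1_powR (th - 1) rx0) D1; exact: ex_derive.
rewrite (@continuous_FTC2 _ _ (fun a => - th^-1 * (r - a) `^ th))//.
- rewrite -EFinB lee_fin subr0 !mulNr opprK gerDr oppr_le0.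
  by rewrite mulr_ge0 ?powR_ge0// invr_ge0 ltW.
- apply: continuous_in_subspaceT => x; rewrite inE/= in_itv/= => /andP[_ xb].
  by apply: cf; exact: le_lt_trans br.
- split.
  + move=> x; rewrite in_itv/= => /andP[_ xb].
    by have D := Dx x (lt_trans xb br); exact: ex_derive.
  + by apply: cvg_at_right_filter; exact: cF.
  + by apply: cvg_at_left_filter; exact: cF.
- move=> x; rewrite in_itv/= => /andP[_ xb]; rewrite derive1E.
  by have D := Dx x (lt_trans xb br); rewrite derive_val.
Qed.

End singular_integral.

Section minkowski_integral.
Context {R : realType} dT (T : measurableType dT) dS (S : measurableType dS).
Variables (m : {sigma_finite_measure set T -> \bar R})
  (n : {sigma_finite_measure set S -> \bar R}).

(* Jensen for the measure [kap ds] applied to [F / kap]. *)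
Lemma minkowski_integral (q c : R) (D : set S) (F : T * S -> R) (kap : S -> R) :
  1 < q -> 0 <= c -> measurable D -> measurable_fun [set: T * S] F ->
  (forall w, 0 <= F w) -> measurable_fun [set: S] kap ->
  (forall s, D s -> 0 < kap s) -> (\int[n]_(s in D) (kap s)%:E <= c%:E)%E ->
  (forall s, D s -> (\int[m]_x (F (x, s) `^ q)%:E <= (kap s `^ q)%:E)%E) ->
  (\int[m]_x (\int[n]_(s in D) (F (x, s))%:E) `^ q <= (c `^ q)%:E)%E.
Proof.
move=> q1 c0 mD mF F0 mkap kap0 kapc Fq.
pose k := kap \_ D.
have mk : measurable_fun [set: S] k.
  by rewrite -measurable_restrictT//; exact: measurable_funTS.
have k0 s : 0 <= k s by rewrite /k patchE; case: ifPn => // /set_mem/kap0/ltW.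
(* Off [D] the weight [k] is [0], and there the quotient is [0] as well, so [k * f] is [F]
   restricted to [D]. *)
pose f x s := F (x, s) / k s.
have f0 x s : 0 <= f x s by rewrite divr_ge0.
have mf2 : measurable_fun [set: T * S] (fun w : T * S => f w.1 w.2).
  apply: measurable_funM; first by under eq_fun do rewrite -surjective_pairing.
  apply: (measurableT_comp measurable_inv).
  exact: (measurableT_comp mk).
have mf x : measurable_fun [set: S] (f x).
  exact: (measurableT_comp mf2 (measurable_pair1 x)).
have kf x : (\int[n]_(s in D) (F (x, s))%:E = \int[n]_s (k s * f x s)%:E)%E.
  rewrite integral_mkcond; apply: eq_integral => s _; rewrite patchE /f /k patchE.
  case: ifPn => [/set_mem Ds|_]; last by rewrite mul0r.
  by rewrite mulrC divfK// gt_eqF// kap0.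
have kc : (\int[n]_s (k s)%:E <= c%:E)%E.
  by move: kapc; rewrite integral_mkcond; under eq_integral do rewrite restrict_EFin.
pose G (w : T * S) := k w.2 * f w.1 w.2 `^ q.
have mG : measurable_fun [set: T * S] G.
  apply: measurable_funM; first exact: (measurableT_comp mk).
  exact: (measurableT_comp (measurable_powR _)).
have G0 w : 0 <= G w by rewrite mulr_ge0 ?powR_ge0.
have mGi : measurable_fun [set: T] (fun x => \int[n]_s (G (x, s))%:E)%E.
  by apply: (@measurable_integral_param _ _ _ _ _ n (EFin \o G)); apply/measurable_EFinP.
apply: (@le_trans _ _ (\int[m]_x ((c `^ (q - 1))%:E * \int[n]_s (G (x, s))%:E))%E).
  apply: ge0_le_integral => //.
  - by move=> x _; exact: poweR_ge0.
  - apply: (measurableT_comp (measurable_poweR _)).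
    under eq_fun do rewrite kf.
    apply: (@measurable_integral_param _ _ _ _ _ n (fun w => (k w.2 * f w.1 w.2)%:E)).
    apply/measurable_EFinP; apply: measurable_funM => //.
    exact: (measurableT_comp mk).
  - exact: emeasurable_funM.
  - by move=> x _; rewrite kf; apply: weighted_jensen.
rewrite ge0_integralZl ?lee_fin ?powR_ge0//; last first.
  by move=> x _; apply: integral_ge0 => s _; rewrite lee_fin.
apply: (@le_trans _ _ ((c `^ (q - 1))%:E * c%:E)%E); last first.
  rewrite -EFinM lee_fin mulrC mulr_powRB1//.
  exact: lt_trans q1.
apply: lee_wpmul2l; first by rewrite lee_fin powR_ge0.
rewrite (@fubini_tonelli _ _ _ _ R m n (EFin \o G)); last 2 first.
- exact/measurable_EFinP.
- by move=> w; rewrite lee_fin.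
apply: le_trans kc; apply: ge0_le_integral => //.
- by move=> s _; apply: integral_ge0 => x _; rewrite lee_fin.
- have := @measurable_integral_param _ _ _ S T m (fun w => (G (w.2, w.1))%:E).
  apply; apply/measurable_EFinP.
  exact: (measurableT_comp mG (@measurable_swap _ _ S T)).
- exact/measurable_EFinP.
move=> s _; rewrite /G /=.
have [Ds|nDs] := pselect (D s); last first.
  under eq_integral do rewrite /k patchE memNset// mul0r.
  by rewrite integral0 lee_fin.
have ks : 0 < k s by rewrite /k patchE mem_set// kap0.
have mFs : measurable_fun [set: T] (fun x => F (x, s) `^ q).
  apply: (measurableT_comp (measurable_powR _)).
  exact: (measurableT_comp mF (measurable_pair2 s)).
under eq_integral.
  move=> x _; rewrite /f powRM ?invr_ge0// mulrCA mulrC EFinM; over.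
rewrite ge0_integralZl//; last 3 first.
- exact/measurable_EFinP.
- by move=> x _; rewrite lee_fin powR_ge0.
- by rewrite lee_fin mulr_ge0 ?powR_ge0.
apply: (@le_trans _ _ ((k s * (k s)^-1 `^ q)%:E * (kap s `^ q)%:E)%E).
  by apply: lee_wpmul2l; [rewrite lee_fin mulr_ge0 ?powR_ge0|exact: Fq].
have -> : kap s = k s by rewrite /k patchE mem_set.
by rewrite -EFinM lee_fin -mulrA -powRM ?invr_ge0// mulVf ?gt_eqF// powR1 mulr1.
Qed.

End minkowski_integral.

(** * Norm bounds uniform in finite and infinite [p] *)

Section Lp_bounds.
Context {R : realType} dT (T : measurableType dT).
Variable m : {sigma_finite_measure set T -> \bar R}.
Implicit Types (g h : T -> R) (p : \bar R) (M : R).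

(** For nonnegative [g] and [M] this says that the [L^p] norm is at most [M], with the root cleared
    when [p] is finite; [Lnorm_leP] is the translation. *)
Definition Lp_le p g M : Prop :=
  match p with
  | r%:E => (\int[m]_x (g x `^ r)%:E <= (M `^ r)%:E)%E
  | _ => {ae m, forall x, g x <= M}
  end.

(* For [p = +oo] the bound holds everywhere, so that bounds depending on a
   parameter can be integrated pointwise. *)
Definition Lp_ub p g M : Prop :=
  match p with
  | r%:E => (\int[m]_x (g x `^ r)%:E <= (M `^ r)%:E)%E
  | _ => forall x, g x <= M
  end.

Lemma Lp_ub_le p g M : Lp_ub p g M -> Lp_le p g M.
Proof. by case: p => //= gM; exact: aeW. Qed.

Lemma Lnorm_leP p g M : (1 <= p)%E -> 0 <= M -> (forall x, 0 <= g x) ->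
  ('N[m]_p[EFin \o g] <= M%:E)%E <-> Lp_le p g M.
Proof.
move=> p1 M0 g0; rewrite unlock /Lnorm; case: p p1 => [r||]//.
- rewrite lee_fin => r1; have r0 : 0 < r by exact: lt_le_trans r1.
  rewrite /Lp_le; under eq_integral do rewrite /= ger0_norm//.
  have I0 : (0 <= \int[m]_x (g x `^ r)%:E)%E.
    by apply: integral_ge0 => x _; rewrite lee_fin powR_ge0.
  split=> H.
    have := lee_poweR (ltW r0) (poweR_ge0 _ _) H.
    by rewrite -poweRrM mulVf ?gt_eqF// poweRe1// poweR_EFin.
  have ri : 0 <= r^-1 by rewrite invr_ge0 ltW.
  have := lee_poweR ri I0 H.
  by rewrite poweR_EFin -powRrM mulfV ?gt_eqF// powRr1.
- move=> _; rewrite /Lp_le; case: ifPn => [_|].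
    split=> [/ess_supP|H].
      by apply: filterS => x; rewrite /= lee_fin ger0_norm.
    by apply/ess_supP; move: H; apply: filterS => x; rewrite /= lee_fin ger0_norm.
  (* On a space of measure zero the norm for [p = +oo] is [0], and every property holds almost
     everywhere. *)
  rewrite -leNgt => m0; split=> // _.
  exists setT; split => //.
  by apply/eqP; rewrite eq_le m0 measure_ge0.
Qed.

Lemma Lp_ub_leM p g M M' : (0 <= p)%E -> 0 <= M -> M <= M' ->
  Lp_ub p g M -> Lp_ub p g M'.
Proof.
case: p => [r||]//= r0 M0 MM' H.
  apply: (le_trans H); rewrite lee_fin ge0_ler_powR// nnegrE//.
  exact: le_trans MM'.
by move=> x; exact: le_trans (H x) _.
Qed.

Lemma Lp_le_mono p g h M : (0 <= p)%E -> measurable_fun [set: T] g ->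
  measurable_fun [set: T] h -> (forall x, 0 <= g x) ->
  {ae m, forall x, g x <= h x} -> Lp_le p h M -> Lp_le p g M.
Proof.
move=> p0 mg mh g0 gh; case: p p0 => [r||]; last by [].
  rewrite lee_fin => r0; apply: le_trans; apply: ae_ge0_le_integral => //.
  - by move=> x _; rewrite lee_fin powR_ge0.
  - by apply/measurable_EFinP; exact: (measurableT_comp (measurable_powR _)).
  - by move=> x _; rewrite lee_fin powR_ge0.
  - by apply/measurable_EFinP; exact: (measurableT_comp (measurable_powR _)).
  - apply: filterS gh => x gh _; rewrite lee_fin ge0_ler_powR ?nnegrE//.
    exact: le_trans gh.
by move=> _; apply: filterS2 gh => x; exact: le_trans.
Qed.

(* [g^n <= M^n + M^(n-r) g^r], by comparing [g] with [M]. *)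
Lemma kernel_pow_le p (n : nat) (a b M : R) (k g : T -> R) :
  (1 <= p)%E -> (n%:R%:E <= p)%E -> 0 < M -> 0 <= b ->
  measurable_fun [set: T] k -> (forall x, 0 <= k x) -> (forall x, k x <= b) ->
  (\int[m]_x (k x)%:E <= a%:E)%E ->
  measurable_fun [set: T] g -> (forall x, 0 <= g x) -> Lp_le p g M ->
  (\int[m]_x (k x * g x ^+ n)%:E <= ((a + b) * M ^+ n)%:E)%E.
Proof.
move=> p1 np M0 b0 mk k0 kb ka mg g0.
have mgn : measurable_fun [set: T] (fun x => g x ^+ n) by exact: measurable_funX.
have Mn0 : 0 <= M ^+ n by rewrite exprn_ge0 // ltW.
have Ik : (\int[m]_x (k x * M ^+ n)%:E <= (a * M ^+ n)%:E)%E.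
  under eq_integral do rewrite EFinM.
  rewrite ge0_integralZr ?lee_fin//; last 2 first.
  - exact/measurable_EFinP.
  - by move=> x _; rewrite lee_fin.
  by rewrite EFinM lee_wpmul2r ?lee_fin.
case: p p1 np => [r||]//; last first.
  move=> _ _ gM; apply: (@le_trans _ _ (\int[m]_x (k x * M ^+ n)%:E)%E).
    apply: ae_ge0_le_integral => //.
    - by move=> x _; rewrite lee_fin mulr_ge0 ?exprn_ge0.
    - by apply/measurable_EFinP; exact: measurable_funM.
    - by move=> x _; rewrite lee_fin mulr_ge0.
    - by apply/measurable_EFinP; exact: measurable_funM.
    - apply: filterS gM => x gM _; rewrite lee_fin ler_wpM2l//.
      by rewrite lerXn2r ?nnegrE// ltW.
  by apply: (le_trans Ik); rewrite lee_fin ler_wpM2r// lerDl.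
rewrite !lee_fin => r1 nr H.
have mgr : measurable_fun [set: T] (fun x => g x `^ r).
  exact: (measurableT_comp (measurable_powR _)).
have key x : g x ^+ n <= M ^+ n + M `^ (n%:R - r) * g x `^ r.
  have [gM|Mg] := leP (g x) M.
    apply: (@le_trans _ _ (M ^+ n)); first by rewrite lerXn2r ?nnegrE// ltW.
    by rewrite lerDl mulr_ge0 ?powR_ge0.
  have gx0 : 0 < g x by exact: lt_trans Mg.
  apply: (@le_trans _ _ (M `^ (n%:R - r) * g x `^ r)); last by rewrite lerDr.
  rewrite -powR_mulrn// (_ : n%:R = (n%:R - r) + r); last by rewrite subrK.
  rewrite powRD; last by apply/implyP => _; rewrite gt_eqF.
  rewrite addrK ler_wpM2r ?powR_ge0//.
  rewrite -[n%:R - r]opprB !powRN lef_pV2 ?posrE ?powR_gt0//.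
  rewrite ge0_ler_powR ?nnegrE ?subr_ge0// ltW//.
apply: (@le_trans _ _ (\int[m]_x ((k x * M ^+ n)%:E +
    (b * M `^ (n%:R - r))%:E * (g x `^ r)%:E))%E).
  apply: ge0_le_integral => //.
  - by move=> x _; rewrite lee_fin mulr_ge0 ?exprn_ge0.
  - by apply/measurable_EFinP; exact: measurable_funM.
  - apply: emeasurable_funD; first by apply/measurable_EFinP; exact: measurable_funM.
    by apply: emeasurable_funM => //; exact/measurable_EFinP.
  - move=> x _; rewrite -EFinM -EFinD lee_fin.
    apply: (@le_trans _ _ (k x * (M ^+ n + M `^ (n%:R - r) * g x `^ r))).
      by rewrite ler_wpM2l.
    by rewrite mulrDr lerD2l mulrA ler_wpM2r ?powR_ge0// ler_wpM2r ?powR_ge0.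
rewrite ge0_integralD//; last 4 first.
- by move=> x _; rewrite lee_fin mulr_ge0.
- by apply/measurable_EFinP; exact: measurable_funM.
- by move=> x _; rewrite -EFinM lee_fin !mulr_ge0 ?powR_ge0.
- by apply: emeasurable_funM => //; exact/measurable_EFinP.
rewrite mulrDl EFinD; apply: leeD => //.
rewrite ge0_integralZl//; last 3 first.
- exact/measurable_EFinP.
- by move=> x _; rewrite lee_fin powR_ge0.
- by rewrite lee_fin mulr_ge0 ?powR_ge0.
apply: (@le_trans _ _ ((b * M `^ (n%:R - r))%:E * (M `^ r)%:E)%E).
  by apply: lee_wpmul2l => //; rewrite lee_fin mulr_ge0 ?powR_ge0.
rewrite -EFinM lee_fin -mulrA -powRD; last by apply/implyP => _; rewrite gt_eqF.
by rewrite subrK powR_mulrn// ltW.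
Qed.

End Lp_bounds.

Section Lp_operators.
Context {R : realType} d1 d2 (T1 : measurableType d1) (T2 : measurableType d2).
Variables (m1 : {sigma_finite_measure set T1 -> \bar R})
  (m2 : {sigma_finite_measure set T2 -> \bar R}).

Lemma fine_powR_le (x : \bar R) (r : R) : 0 < r -> (0 <= x)%E ->
  ((fine x `^ r)%:E <= x `^ r)%E.
Proof.
move=> r0; case: x => [x||]//= _.
by rewrite powR0 ?gt_eqF// leey.
Qed.

Let e (p : \bar R) : R := fine p^-1%E.

Let eE (r : R) : 1 < r -> e r%:E = r^-1.
Proof. by move=> r1; rewrite /e inver gt_eqF// (lt_trans _ r1). Qed.

Let ey : e +oo%E = 0. Proof. by rewrite /e invey. Qed.

Variable k : T1 * T2 -> R.
Hypotheses (mk : measurable_fun [set: T1 * T2] k) (k0 : forall w, 0 <= k w).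
Variables (a b : R).
Hypotheses (a0 : 0 <= a) (b0 : 0 <= b).
Hypothesis ka : forall x, (\int[m2]_y (k (x, y))%:E <= a%:E)%E.

Let mk1 x : measurable_fun [set: T2] (fun y => k (x, y)).
Proof. exact: (measurableT_comp mk (measurable_pair1 x)). Qed.

Let kernel_oo (f : T2 -> R) M x : 0 <= M -> measurable_fun [set: T2] f ->
  (forall y, 0 <= f y) -> {ae m2, forall y, f y <= M} ->
  fine (\int[m2]_y (k (x, y) * f y)%:E)%E <= a * M.
Proof.
move=> M0 mf f0 fM.
have H : (\int[m2]_y (k (x, y) * f y)%:E <= (a * M)%:E)%E.
  apply: (@le_trans _ _ (\int[m2]_y ((k (x, y))%:E * M%:E))%E).
    apply: ae_ge0_le_integral => //.
    - by move=> y _; rewrite lee_fin mulr_ge0.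
    - by apply/measurable_EFinP; exact: measurable_funM.
    - by move=> y _; rewrite -EFinM lee_fin mulr_ge0.
    - by apply: emeasurable_funM => //; exact/measurable_EFinP.
    - by apply: filterS fM => y fM _; rewrite -EFinM lee_fin ler_wpM2l.
  rewrite ge0_integralZr ?lee_fin//; last 2 first.
  - exact/measurable_EFinP.
  - by move=> y _; rewrite lee_fin.
  by rewrite EFinM lee_wpmul2r ?lee_fin.
rewrite -lee_fin fineK//; rewrite ge0_fin_numE; first exact: le_lt_trans H (ltry _).
by apply: integral_ge0 => y _; rewrite lee_fin mulr_ge0.
Qed.

(** With [e p = 1/p] the bound also reads correctly for [p = +oo], where [e p = 0] and only the mass
    in [y] enters. *)
Lemma schur_Lp p M (f : T2 -> R) : (1 < p)%E -> 0 <= M ->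
  (forall y, (\int[m1]_x (k (x, y))%:E <= b%:E)%E) ->
  measurable_fun [set: T2] f -> (forall y, 0 <= f y) -> Lp_le m2 p f M ->
  Lp_ub m1 p (fun x => fine (\int[m2]_y (k (x, y) * f y)%:E)%E)
    (a `^ (1 - e p) * b `^ e p * M).
Proof.
move=> p1 M0 kb mf f0; case: p p1 => [r||]//; last first.
  by move=> _ fM x; rewrite ey subr0 powRr1// powRr0 mulr1 kernel_oo.
rewrite lte_fin => r1 fM /=; have r0 : 0 < r by exact: lt_trans r1.
rewrite eE//; apply: (@le_trans _ _ (\int[m1]_x (\int[m2]_y (k (x, y) * f y)%:E) `^ r)%E).
  apply: ge0_le_integral => //.
  - by move=> x _; rewrite lee_fin powR_ge0.
  - apply/measurable_EFinP; apply: (measurableT_comp (measurable_powR _)).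
    by apply: measurableT_comp => //; exact: measurable_kernel_op.
  - by apply: (measurableT_comp (measurable_poweR _)); exact: measurable_kernel_op.
  - move=> x _; apply: fine_powR_le => //.
    by apply: integral_ge0 => y _; rewrite lee_fin mulr_ge0.
apply: (le_trans (schur_test mk k0 r1 a0 b0 ka kb mf f0)).
apply: (@le_trans _ _ ((a `^ (r - 1) * b)%:E * (M `^ r)%:E)%E).
  by apply: lee_wpmul2l => //; rewrite lee_fin mulr_ge0 ?powR_ge0.
rewrite -EFinM lee_fin powRM ?mulr_ge0 ?powR_ge0// powRM ?powR_ge0// -!powRrM.
by rewrite mulrBl mul1r mulVf ?gt_eqF// powRr1.
Qed.

(** The square of an [L^p] function is only in [L^(p/2)]; the supremum [b] of the kernel, to the
    power [1/p], pays for the return to [L^p]. *)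
Lemma schur_sqr_Lp p M (f : T2 -> R) : (2%:E < p)%E -> 0 <= M ->
  (forall y, (\int[m1]_x (k (x, y))%:E <= a%:E)%E) -> (forall w, k w <= b) ->
  measurable_fun [set: T2] f -> (forall y, 0 <= f y) -> Lp_le m2 p f M ->
  Lp_ub m1 p (fun x => fine (\int[m2]_y (k (x, y) * f y ^+ 2)%:E)%E)
    (a `^ (1 - e p) * b `^ e p * M ^+ 2).
Proof.
move=> p2 M0 ka' kb mf f0.
have mf2 : measurable_fun [set: T2] (fun y => f y ^+ 2) by exact: measurable_funX.
case: p p2 => [r||]//; last first.
  move=> _ fM x; rewrite ey subr0 powRr1// powRr0 mulr1.
  apply: kernel_oo => //; [by rewrite sqr_ge0|by move=> y; rewrite sqr_ge0|].
  by move: fM; apply: filterS => y fM; rewrite lerXn2r ?nnegrE.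
rewrite lte_fin => r2 fM /=; have r1 : 1 < r by lra.
have r0 : 0 < r by exact: lt_trans r1.
rewrite eE//; apply: (@le_trans _ _ (\int[m1]_x (\int[m2]_y (k (x, y) * f y ^+ 2)%:E) `^ r)%E).
  apply: ge0_le_integral => //.
  - by move=> x _; rewrite lee_fin powR_ge0.
  - apply/measurable_EFinP; apply: (measurableT_comp (measurable_powR _)).
    by apply: measurableT_comp => //; exact: (@measurable_kernel_op _ _ _ _ _ m2 _ mk _ mf2).
  - by apply: (measurableT_comp (measurable_poweR _)); exact: (@measurable_kernel_op _ _ _ _ _ m2 _ mk _ mf2).
  - move=> x _; apply: fine_powR_le => //.
    by apply: integral_ge0 => y _; rewrite lee_fin mulr_ge0 ?sqr_ge0.
apply: (le_trans (schur_test_sqr mk k0 r2 a0 b0 ka ka' kb mf f0)).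
apply: (@le_trans _ _ ((a `^ (r - 1) * b)%:E * ((M `^ r)%:E * (M `^ r)%:E))%E).
  apply: lee_wpmul2l; first by rewrite lee_fin mulr_ge0 ?powR_ge0.
  have I0 : (0 <= \int[m2]_y (f y `^ r)%:E)%E.
    by apply: integral_ge0 => y _; rewrite lee_fin powR_ge0.
  exact: lee_pmul.
rewrite -!EFinM lee_fin powRM ?mulr_ge0 ?powR_ge0 ?sqr_ge0// powRM ?powR_ge0// -!powRrM.
by rewrite mulrBl mul1r mulVf ?gt_eqF// powRr1// expr2 powRM.
Qed.

End Lp_operators.

Section minkowski_Lp.
Context {R : realType} dT (T : measurableType dT) dS (S : measurableType dS).
Variables (m : {sigma_finite_measure set T -> \bar R})
  (n : {sigma_finite_measure set S -> \bar R}).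

(** Almost everywhere finiteness is stated separately because [fine] would turn a divergent integral
    into [0] and hide it. *)
Lemma minkowski_Lp (p : \bar R) (c : R) (D : set S) (F : T * S -> R) (kap : S -> R) :
  (1 < p)%E -> 0 <= c -> measurable D -> measurable_fun [set: T * S] F ->
  (forall w, 0 <= F w) -> measurable_fun [set: S] kap ->
  (forall s, D s -> 0 < kap s) -> (\int[n]_(s in D) (kap s)%:E <= c%:E)%E ->
  (forall s, D s -> Lp_ub m p (fun x => F (x, s)) (kap s)) ->
  {ae m, forall x, (\int[n]_(s in D) (F (x, s))%:E < +oo)%E} /\
  Lp_ub m p (fun x => fine (\int[n]_(s in D) (F (x, s))%:E)%E) c.
Proof.
move=> p1 c0 mD mF F0 mkap kap0 kapc.
have I0 x : (0 <= \int[n]_(s in D) (F (x, s))%:E)%E.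
  by apply: integral_ge0 => s _; rewrite lee_fin.
have mI : measurable_fun [set: T] (fun x => \int[n]_(s in D) (F (x, s))%:E)%E.
  pose G (w : T * S) : R := F w * \1_D w.2.
  rewrite (_ : (fun x => _) = (fun x => \int[n]_s (G (x, s))%:E)%E); last first.
    apply/funext => x; rewrite integral_mkcond; apply: eq_integral => s _.
    by rewrite patchE /G/= indicE; case: ifP => _; rewrite ?mulr1 ?mulr0.
  apply: (@measurable_integral_param _ _ _ _ _ n (EFin \o G)); apply/measurable_EFinP.
  apply: measurable_funM => //; apply: (@measurableT_comp _ _ _ _ _ _ (\1_D : S -> R)) => //.
case: p p1 => [r||]//; last first.
  move=> _ Fk.
  have H x : (\int[n]_(s in D) (F (x, s))%:E <= c%:E)%E.
    apply: le_trans kapc; apply: ge0_le_integral => //.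
    - by move=> s _; rewrite lee_fin.
    - apply/measurable_EFinP; apply: measurable_funTS.
      exact: (measurableT_comp mF (measurable_pair1 x)).
    - by apply/measurable_EFinP; exact: measurable_funTS.
    - by move=> s Ds; rewrite lee_fin; exact: Fk.
  split; first by apply: aeW => x; exact: le_lt_trans (H x) (ltry _).
  move=> x; rewrite -lee_fin fineK// ge0_fin_numE//.
  exact: le_lt_trans (H x) (ltry _).
rewrite lte_fin => r1 Fk /=; have r0 : 0 < r by exact: lt_trans r1.
have H := minkowski_integral r1 c0 mD mF F0 mkap kap0 kapc Fk.
split; last first.
  apply: le_trans H; apply: ge0_le_integral => //.
  - by move=> x _; rewrite lee_fin powR_ge0.
  - apply/measurable_EFinP; apply: (measurableT_comp (measurable_powR _)).
    exact: measurableT_comp.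
  - exact: (measurableT_comp (measurable_poweR _)).
  - by move=> x _; exact: fine_powR_le.
have : m.-integrable setT (fun x => (\int[n]_(s in D) (F (x, s))%:E) `^ r)%E.
  apply/integrableP; split; first exact: (measurableT_comp (measurable_poweR _)).
  under eq_integral do rewrite gee0_abs ?poweR_ge0//.
  exact: le_lt_trans H (ltry _).
move=> /integrable_ae => /(_ measurableT); apply: filterS => x /(_ I).
have := I0 x; case: (integral _ _ _) => [y||]//=; first by rewrite ltry.
by move=> _; rewrite /poweR gt_eqF.
Qed.

End minkowski_Lp.

(** * The Duhamel operator *)

Section fields.
Context {R : realType} {d : nat}.
Local Notation mu := (@lebesgue_rV R d).
Local Notation field := ('rV[R]_d -> 'rV[R]_d).
Implicit Types (x y z : 'rV[R]_d) (i j k : 'I_d) (s t r : R) (v w : field).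
Local Notation D := (@heat_D R d).
Local Notation P := (@heat_peak R d).

Lemma measurable_enorm_field v : measurable_fun [set: 'rV[R]_d] v ->
  measurable_fun [set: 'rV[R]_d] (fun y => enorm (v y)).
Proof. exact: (measurableT_comp measurable_enorm). Qed.

Lemma measurable_field_coord v i : measurable_fun [set: 'rV[R]_d] v ->
  measurable_fun [set: 'rV[R]_d] (fun y => v y ord0 i).
Proof. by move=> /measurable_fun_rVP. Qed.

(** Summing over the output index [i] too gives one scalar kernel that dominates every
    coordinate. *)
Definition oseen_sum t x : R :=
  \sum_(i < d) \sum_(j < d) \sum_(k < d) `|oseen_kernel t i j k x|.

Lemma oseen_sum_ge0 t x : 0 <= oseen_sum t x.
Proof. by do 3 (apply: sumr_ge0 => ? _). Qed.

Lemma measurable_oseen_sum2 : measurable_fun [set: R * 'rV[R]_d]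
  (fun z : R * 'rV[R]_d => oseen_sum z.1 z.2).
Proof.
do 3 (apply: measurable_sum => ?); apply: measurableT_comp => //.
exact: measurable_oseen_kernel2.
Qed.

(** A bound for the mass of [oseen_sum t]; the next constant bounds its supremum. The factor [d^3]
    counts the index triples. *)
Definition oseen_L1 t : R := d%:R ^+ 3 * (3 / 2 * D) * heat_q t.

Definition oseen_Loo t : R := d%:R ^+ 3 * (2 * D) * heat_q t * P t.

Lemma oseen_L1_ge0 t : 0 <= oseen_L1 t.
Proof. by rewrite !mulr_ge0 ?exprn_ge0 ?heat_D_ge0 ?heat_q_ge0. Qed.

Lemma oseen_Loo_ge0 t : 0 <= oseen_Loo t.
Proof. by rewrite !mulr_ge0 ?exprn_ge0 ?heat_D_ge0 ?heat_q_ge0 ?heat_peak_ge0. Qed.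

Let sum_cst (c : R) : \sum_(i < d) c = d%:R * c.
Proof. by rewrite sumr_const card_ord mulr_natl. Qed.

Lemma oseen_sum_le t x : 0 < t -> oseen_sum t x <= oseen_Loo t.
Proof.
move=> t0; pose B := 2 * heat_q t * (D * P t).
have -> : oseen_Loo t = \sum_(i < d) \sum_(j < d) \sum_(k < d) B.
  by rewrite !sum_cst /oseen_Loo /B; ring.
do 3 (apply: ler_sum => ? _); exact: oseen_kernel_sup.
Qed.

Let sum3_integral (f : 'I_d -> 'I_d -> 'I_d -> 'rV[R]_d -> R) (B : R) :
  (forall i j k, measurable_fun [set: 'rV[R]_d] (f i j k)) ->
  (forall i j k x, 0 <= f i j k x) ->
  (forall i j k, (\int[mu]_x (f i j k x)%:E <= B%:E)%E) ->
  (\int[mu]_x (\sum_(i < d) \sum_(j < d) \sum_(k < d) f i j k x)%:E <=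
   (d%:R ^+ 3 * B)%:E)%E.
Proof.
move=> mf f0 fB.
under eq_integral do rewrite -sumEFin.
rewrite ge0_integral_sum//; last 2 first.
- by move=> i; apply/measurable_EFinP; do 2 (apply: measurable_sum => ?).
- by move=> i x _; rewrite lee_fin; do 2 (apply: sumr_ge0 => ? _).
have -> : d%:R ^+ 3 * B = \sum_(i < d) \sum_(j < d) \sum_(k < d) B.
  by rewrite !sum_cst; ring.
rewrite -sumEFin; apply: lee_sum => i _.
under eq_integral do rewrite -sumEFin.
rewrite ge0_integral_sum//; last 2 first.
- by move=> j; apply/measurable_EFinP; apply: measurable_sum => ?.
- by move=> j x _; rewrite lee_fin; apply: sumr_ge0 => ? _.
rewrite -sumEFin; apply: lee_sum => j _.
under eq_integral do rewrite -sumEFin.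
rewrite ge0_integral_sum//; last 2 first.
- by move=> k; exact/measurable_EFinP.
- by move=> k x _; rewrite lee_fin.
by rewrite -sumEFin; apply: lee_sum => k _; exact: fB.
Qed.

Lemma oseen_L1E t : oseen_L1 t = d%:R ^+ 3 * (3 / 2 * heat_q t * D).
Proof. by rewrite /oseen_L1; ring. Qed.

Lemma integral_oseen_sum t x : 0 < t ->
  (\int[mu]_y (oseen_sum t (x - y))%:E <= (oseen_L1 t)%:E)%E.
Proof.
move=> t0; rewrite oseen_L1E; apply: sum3_integral => // i j k.
- apply: measurableT_comp => //.
  exact: (measurableT_comp (measurable_oseen_kernel t i j k) (measurable_subrV x)).
- exact: integral_oseen_kernel.
Qed.

Lemma integral_oseen_suml t y : 0 < t ->
  (\int[mu]_x (oseen_sum t (x - y))%:E <= (oseen_L1 t)%:E)%E.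
Proof.
move=> t0; rewrite oseen_L1E; apply: sum3_integral => // i j k.
- apply: measurableT_comp => //.
  exact: (measurableT_comp (measurable_oseen_kernel t i j k) (measurable_subrVr y)).
- exact: integral_oseen_kernell.
Qed.

Lemma measurable_subrV2 : measurable_fun [set: 'rV[R]_d * 'rV[R]_d]
  (fun w : 'rV[R]_d * 'rV[R]_d => w.1 - w.2).
Proof. exact: measurable_fun_subrV. Qed.

Lemma measurable_oseen_sum t : measurable_fun [set: 'rV[R]_d] (oseen_sum t).
Proof. exact: (measurableT_comp measurable_oseen_sum2 (measurable_pair1 t)). Qed.

Definition leray_integrand t i v x y : R :=
  \sum_(j < d) \sum_(k < d) oseen_kernel t i j k (x - y) * (v y ord0 j * v y ord0 k).

Let le_sum_term (g : 'I_d -> R) i : (forall j, 0 <= g j) -> g i <= \sum_(j < d) g j.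
Proof. by move=> g0; rewrite (bigD1 i)//= lerDl sumr_ge0. Qed.

Let sum2_mulr (f : 'I_d -> 'I_d -> R) (c : R) :
  \sum_(j < d) \sum_(k < d) f j k * c = (\sum_(j < d) \sum_(k < d) f j k) * c.
Proof. by rewrite mulr_suml; apply: eq_bigr => j _; rewrite mulr_suml. Qed.

Lemma norm_leray_integrand t i v x y :
  `|leray_integrand t i v x y| <= oseen_sum t (x - y) * enorm (v y) ^+ 2.
Proof.
apply: (@le_trans _ _ (\sum_(j < d) \sum_(k < d) `|oseen_kernel t i j k (x - y)| * enorm (v y) ^+ 2)).
  apply: (le_trans (ler_norm_sum _ _ _)); apply: ler_sum => j _.
  apply: (le_trans (ler_norm_sum _ _ _)); apply: ler_sum => k _.
  by rewrite !normrM ler_wpM2l// expr2 ler_pM// ler_coord_enorm.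
rewrite (sum2_mulr (fun j k => `|oseen_kernel t i j k (x - y)|)).
apply: ler_wpM2r; first exact: sqr_ge0.
rewrite /oseen_sum.
apply: (@le_sum_term (fun l => \sum_(j < d) \sum_(k < d) `|oseen_kernel t l j k (x - y)|) i).
by move=> l; do 2 (apply: sumr_ge0 => ? _).
Qed.

(** The difference of the quadratic terms is polarised, and [|v - w| |v|] and [|w| |v - w|] are
    split by Young's inequality with parameter [e]. This leaves only squares, the form for which the
    kernel has a weighted bound. *)
Lemma norm_leray_integrandB t i v w x y (e : R) : 0 < e ->
  `|leray_integrand t i v x y - leray_integrand t i w x y| <=
  oseen_sum t (x - y) * (e^-1 * enorm (v y - w y) ^+ 2 +
    e * (enorm (v y) ^+ 2 + enorm (w y) ^+ 2)).
Proof.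
move=> e0; pose Q := e^-1 * enorm (v y - w y) ^+ 2 +
    e * (enorm (v y) ^+ 2 + enorm (w y) ^+ 2).
rewrite -/Q.
have -> : leray_integrand t i v x y - leray_integrand t i w x y =
    \sum_(j < d) \sum_(k < d) oseen_kernel t i j k (x - y) *
      (v y ord0 j * v y ord0 k - w y ord0 j * w y ord0 k).
  rewrite /leray_integrand -sumrB; apply: eq_bigr => j _.
  by rewrite -sumrB; apply: eq_bigr => k _; rewrite mulrBr.
have key j k : `|v y ord0 j * v y ord0 k - w y ord0 j * w y ord0 k| <= Q.
  have -> : v y ord0 j * v y ord0 k - w y ord0 j * w y ord0 k =
    (v y - w y) ord0 j * v y ord0 k + w y ord0 j * (v y - w y) ord0 k.
    by rewrite !mxE; ring.
  have h0 := enorm_ge0 (v y - w y); have v0 := enorm_ge0 (v y); have w0 := enorm_ge0 (w y).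
  apply: (@le_trans _ _ (enorm (v y - w y) * enorm (v y) + enorm (w y) * enorm (v y - w y))).
    by apply: (le_trans (ler_normD _ _)); rewrite lerD// normrM ler_pM// ler_coord_enorm.
  rewrite /Q; move: h0 v0 w0; move: (enorm (v y - w y)) (enorm (v y)) (enorm (w y)) => h a b h0 a0 b0.
  have e1 : e * e^-1 = 1 by rewrite mulfV// gt_eqF.
  have ei : 0 < e^-1 by rewrite invr_gt0.
  have H1 : 0 <= e^-1 * (h - e * a) ^+ 2 by rewrite mulr_ge0 ?sqr_ge0// ltW.
  have H2 : 0 <= e^-1 * (h - e * b) ^+ 2 by rewrite mulr_ge0 ?sqr_ge0// ltW.
  (* Completing the squares exhibits the slack as a sum of nonnegative terms. *)
  have -> : e^-1 * h ^+ 2 + e * (a ^+ 2 + b ^+ 2) = h * a + b * h +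
    (e^-1 * (h - e * a) ^+ 2 + e^-1 * (h - e * b) ^+ 2) / 2 + e * (a ^+ 2 + b ^+ 2) / 2.
    by field; rewrite gt_eqF.
  rewrite -addrA lerDl addr_ge0//; first by rewrite divr_ge0// addr_ge0.
  by rewrite divr_ge0// mulr_ge0 ?addr_ge0 ?sqr_ge0// ltW.
have Q0 : 0 <= Q by exact: le_trans (key i i).
apply: (@le_trans _ _ (\sum_(j < d) \sum_(k < d) `|oseen_kernel t i j k (x - y)| * Q)).
  apply: (le_trans (ler_norm_sum _ _ _)); apply: ler_sum => j _.
  apply: (le_trans (ler_norm_sum _ _ _)); apply: ler_sum => k _.
  by rewrite normrM ler_wpM2l.
rewrite (sum2_mulr (fun j k => `|oseen_kernel t i j k (x - y)|)).
apply: ler_wpM2r; first exact: Q0.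
rewrite /oseen_sum.
apply: (@le_sum_term (fun l => \sum_(j < d) \sum_(k < d) `|oseen_kernel t l j k (x - y)|) i).
by move=> l; do 2 (apply: sumr_ge0 => ? _).
Qed.

Lemma measurable_leray_integrand3 v i : measurable_fun [set: 'rV[R]_d] v ->
  measurable_fun [set: (R * 'rV[R]_d) * 'rV[R]_d]
   (fun w : (R * 'rV[R]_d) * 'rV[R]_d => leray_integrand w.1.1 i v w.1.2 w.2).
Proof.
move=> mv; do 2 (apply: measurable_sum => ?).
apply: measurable_funM.
  have mg : measurable_fun [set: (R * 'rV[R]_d) * 'rV[R]_d]
      (fun w : (R * 'rV[R]_d) * 'rV[R]_d => (w.1.1, w.1.2 - w.2)).
    apply: measurable_fun_pair; first exact: (measurableT_comp measurable_fst).
    by apply: measurable_fun_subrV => //; exact: (measurableT_comp measurable_snd).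
  exact: (measurableT_comp (measurable_oseen_kernel2 _ _ _) mg).
by apply: measurable_funM; apply: (measurableT_comp (measurable_field_coord _ mv)).
Qed.

Lemma measurable_heat_leray_div2 v i : measurable_fun [set: 'rV[R]_d] v ->
  measurable_fun [set: R * 'rV[R]_d]
    (fun w : R * 'rV[R]_d => heat_leray_div w.1 v w.2 ord0 i).
Proof.
move=> mv; under eq_fun do rewrite mxE.
exact: (@measurable_Rintegral_param _ _ _ _ _ mu _ (measurable_leray_integrand3 i mv)).
Qed.

Lemma measurable_leray_integrand t v i x : measurable_fun [set: 'rV[R]_d] v ->
  measurable_fun [set: 'rV[R]_d] (leray_integrand t i v x).
Proof.
move=> mv; exact: (measurableT_comp (measurable_leray_integrand3 i mv) (measurable_pair1 (t, x))).
Qed.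

Lemma heat_leray_divE t v x i :
  heat_leray_div t v x ord0 i = \int[mu]_y leray_integrand t i v x y.
Proof. by rewrite mxE. Qed.

End fields.

Section Rintegral_sum.
Context {R : realType} dT (T : measurableType dT) (m : {measure set T -> \bar R}).

Lemma Rintegral_sum (I : Type) (s : seq I) (f : I -> T -> R) :
  (forall i, m.-integrable setT (EFin \o f i)) ->
  \int[m]_x (\sum_(i <- s) f i x) = \sum_(i <- s) \int[m]_x f i x.
Proof.
move=> fi; elim: s => [|i s IH].
  rewrite big_nil; under eq_Rintegral do rewrite big_nil.
  by rewrite /Rintegral integral0.
rewrite big_cons -IH -RintegralD//.
  by apply: eq_Rintegral => x _; rewrite big_cons.
have := @integrable_sum _ _ _ m setT measurableT _ s xpredT (fun i => EFin \o f i).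
move=> /(_ (fun i _ => fi i)); apply: eq_integrable => // x _ /=.
by rewrite -sumEFin.
Qed.

End Rintegral_sum.

Section Lp_ub_mono.
Context {R : realType} dT (T : measurableType dT).
Variable m : {sigma_finite_measure set T -> \bar R}.

Lemma Lp_ub_mono p (g h : T -> R) M : (0 <= p)%E -> measurable_fun [set: T] g ->
  measurable_fun [set: T] h -> (forall x, 0 <= g x) -> (forall x, g x <= h x) ->
  Lp_ub m p h M -> Lp_ub m p g M.
Proof.
move=> p0 mg mh g0 gh; case: p p0 => [r||] p0 hM; last by [].
  apply: (Lp_le_mono (m := m) (p := r%:E) (h := h) p0) => //; exact: aeW.
by move=> x; exact: le_trans (hM x).
Qed.

End Lp_ub_mono.

Section field_operators.
Context {R : realType} {d : nat}.
Local Notation mu := (@lebesgue_rV R d).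
Local Notation field := ('rV[R]_d -> 'rV[R]_d).
Implicit Types (x y z : 'rV[R]_d) (i j k : 'I_d) (s t r tau : R) (v w : field).
Local Notation D := (@heat_D R d).
Local Notation P := (@heat_peak R d).
Local Notation L1 := (@oseen_L1 R d).
Local Notation Loo := (@oseen_Loo R d).
Variable p : \bar R.
Hypothesis p2 : (2%:E < p)%E.

Let p1 : (1 <= p)%E.
Proof. by apply: le_trans (ltW p2); rewrite lee_fin ler1n. Qed.

Let p0 : (0 <= p)%E. Proof. exact: le_trans p1. Qed.

Local Notation bounded v M := (Lp_le mu p (fun y => enorm (v y)) M).

Lemma Lp_norm_leP v M : 0 <= M -> (Lp_norm p v <= M%:E)%E <-> bounded v M.
Proof. by move=> M0; apply: Lnorm_leP => // y; exact: enorm_ge0. Qed.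

Lemma heat_norm_integral t v M x : 0 < t -> 0 < M ->
  measurable_fun [set: 'rV[R]_d] v -> bounded v M ->
  (\int[mu]_y (heat_kernel t (x - y) * enorm (v y))%:E <= ((1 + P t) * M)%:E)%E.
Proof.
move=> t0 M0 mv vM.
apply: (@kernel_pow_le _ _ _ mu p 1 1 (P t) M (fun y => heat_kernel t (x - y))
  (fun y => enorm (v y))) => //.
- exact: heat_peak_ge0.
- exact: (measurableT_comp (measurable_heat_kernel t) (measurable_subrV x)).
- by move=> y; exact: heat_kernel_ge0.
- by move=> y; exact: heat_kernel_le.
- by rewrite integral_heat_kernel.
- exact: measurable_enorm_field.
- by move=> y; exact: enorm_ge0.
Qed.

Lemma measurable_heat_integrand2 t v i : measurable_fun [set: 'rV[R]_d] v ->
  measurable_fun [set: 'rV[R]_d * 'rV[R]_d]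
    (fun w : 'rV[R]_d * 'rV[R]_d => heat_kernel t (w.1 - w.2) * v w.2 ord0 i).
Proof.
move=> mv; apply: measurable_funM.
  exact: (measurableT_comp (measurable_heat_kernel t) measurable_subrV2).
exact: (measurableT_comp (measurable_field_coord i mv)).
Qed.

Lemma measurable_heat t v : measurable_fun [set: 'rV[R]_d] v ->
  measurable_fun [set: 'rV[R]_d] (heat t v).
Proof.
move=> mv; apply/measurable_fun_rVP => i; under eq_fun do rewrite mxE.
exact: (@measurable_Rintegral_param _ _ _ _ _ mu _ (measurable_heat_integrand2 t i mv)).
Qed.

Lemma heat_integrable t v M x i : 0 < t -> 0 < M ->
  measurable_fun [set: 'rV[R]_d] v -> bounded v M ->
  mu.-integrable setT (EFin \o (fun y => heat_kernel t (x - y) * v y ord0 i)).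
Proof.
move=> t0 M0 mv vM; apply: integrable_EFinP => //.
  exact: (measurableT_comp (measurable_heat_integrand2 t i mv) (measurable_pair1 x)).
apply: le_lt_trans (le_lt_trans (heat_norm_integral x t0 M0 mv vM) (ltry _)).
apply: ge0_le_integral => //.
- apply/measurable_EFinP; apply: measurableT_comp => //.
  exact: (measurableT_comp (measurable_heat_integrand2 t i mv) (measurable_pair1 x)).
- apply/measurable_EFinP; apply: measurable_funM; last exact: measurable_enorm_field.
  exact: (measurableT_comp (measurable_heat_kernel t) (measurable_subrV x)).
- move=> y _; rewrite lee_fin normrM (ger0_norm (heat_kernel_ge0 _ _)).
  by rewrite ler_wpM2l ?heat_kernel_ge0// ler_coord_enorm.
Qed.

(** The bound [B], uniform in [y], together with the mass one of [K_r], gives the absolute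
    integrability that Fubini asks for. *)
Let Rintegral_heat_swap r (f : 'rV[R]_d * 'rV[R]_d -> R) (B : R) x : 0 < r ->
  measurable_fun setT f ->
  (forall y, (\int[mu]_z `|f (y, z)|%:E <= B%:E)%E) ->
  \int[mu]_y (heat_kernel r (x - y) * \int[mu]_z f (y, z)) =
  \int[mu]_z \int[mu]_y (heat_kernel r (x - y) * f (y, z)).
Proof.
move=> r0 mf fB.
have mK : measurable_fun [set: 'rV[R]_d] (fun y => heat_kernel r (x - y)).
  exact: (measurableT_comp (measurable_heat_kernel r) (measurable_subrV x)).
pose g (w : 'rV[R]_d * 'rV[R]_d) : R := heat_kernel r (x - w.1) * f w.
have mg : measurable_fun setT g.
  by apply: measurable_funM => //; exact: (measurableT_comp mK).
have mf1 y : measurable_fun setT (fun z => f (y, z)).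
  exact: (measurableT_comp mf (measurable_pair1 y)).
have B0 : 0 <= B by rewrite -lee_fin; apply: le_trans (fB 0); exact: integral_ge0.
have fE y : (\int[mu]_z `|g (y, z)|%:E = (heat_kernel r (x - y))%:E * \int[mu]_z `|f (y, z)|%:E)%E.
  rewrite -ge0_integralZl//; last 2 first.
  - by apply/measurable_EFinP; exact: measurableT_comp.
  - by rewrite lee_fin heat_kernel_ge0.
  by apply: eq_integral => z _; rewrite /g normrM (ger0_norm (heat_kernel_ge0 _ _)).
have goo : (\int[mu]_y \int[mu]_z `|g (y, z)|%:E < +oo)%E.
  apply: (@le_lt_trans _ _ (\int[mu]_y ((heat_kernel r (x - y))%:E * B%:E))%E).
    apply: ge0_le_integral => //.
    - by move=> y _; exact: integral_ge0.
    - apply: (@measurable_integral_param _ _ _ _ _ mu (EFin \o (Num.norm \o g))).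
      by apply/measurable_EFinP; exact: measurableT_comp.
    - by apply: emeasurable_funM => //; exact/measurable_EFinP.
    - by move=> y _; rewrite fE lee_wpmul2l ?lee_fin ?heat_kernel_ge0.
  rewrite ge0_integralZr//; last 2 first.
  - exact/measurable_EFinP.
  - by move=> y _; rewrite lee_fin heat_kernel_ge0.
  by rewrite integral_heat_kernel// mul1e ltry.
rewrite -(@Rintegral_fubini _ _ _ _ _ mu mu g mg goo); apply: eq_Rintegral => y _.
rewrite /g /= RintegralZl//; apply: integrable_EFinP => //.
exact: le_lt_trans (fB y) (ltry _).
Qed.

Lemma heat_heat r t v M x : 0 < r -> 0 < t -> 0 < M ->
  measurable_fun [set: 'rV[R]_d] v -> bounded v M ->
  heat r (heat t v) x = heat (r + t) v x.
Proof.
move=> r0 t0 M0 mv vM; apply/rowP => i; rewrite !mxE.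
under eq_Rintegral do rewrite mxE.
rewrite (@Rintegral_heat_swap r _ ((1 + P t) * M) _ r0 (measurable_heat_integrand2 t i mv)).
  apply: eq_Rintegral => z _ /=; under eq_Rintegral do rewrite mulrA.
  rewrite RintegralZr//; first by rewrite Rintegral_heat_kernelM.
  apply: (integrable_heat_kernelM (C := P t)) => //.
    exact: (measurableT_comp (measurable_heat_kernel t) (measurable_subrVr z)).
  by move=> y; rewrite ger0_norm ?heat_kernel_ge0// heat_kernel_le.
move=> y /=; apply: le_trans (heat_norm_integral y t0 M0 mv vM).
apply: ge0_le_integral => //.
- apply/measurable_EFinP; apply: measurableT_comp => //.
  exact: (measurableT_comp (measurable_heat_integrand2 t i mv) (measurable_pair1 y)).
- apply/measurable_EFinP; apply: measurable_funM; last exact: measurable_enorm_field.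
  exact: (measurableT_comp (measurable_heat_kernel t) (measurable_subrV y)).
- move=> z _; rewrite lee_fin normrM (ger0_norm (heat_kernel_ge0 _ _)).
  by rewrite ler_wpM2l ?heat_kernel_ge0// ler_coord_enorm.
Qed.

Lemma oseen_sqr_integral tau v M x : 0 < tau -> 0 < M ->
  measurable_fun [set: 'rV[R]_d] v -> bounded v M ->
  (\int[mu]_y (oseen_sum tau (x - y) * enorm (v y) ^+ 2)%:E <=
   ((L1 tau + Loo tau) * M ^+ 2)%:E)%E.
Proof.
move=> t0 M0 mv vM; apply: (kernel_pow_le p1) => //.
- exact: ltW.
- exact: oseen_Loo_ge0.
- exact: (measurableT_comp (measurable_oseen_sum tau) (measurable_subrV x)).
- by move=> y; exact: oseen_sum_ge0.
- by move=> y; exact: oseen_sum_le.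
- exact: integral_oseen_sum.
- exact: measurable_enorm_field.
- by move=> y; exact: enorm_ge0.
Qed.

Let measurable_oseen_sqr tau v x : measurable_fun [set: 'rV[R]_d] v ->
  measurable_fun setT (fun y => oseen_sum tau (x - y) * enorm (v y) ^+ 2).
Proof.
move=> mv; apply: measurable_funM.
  exact: (measurableT_comp (measurable_oseen_sum tau) (measurable_subrV x)).
by apply: measurable_funX; exact: measurable_enorm_field.
Qed.

Lemma norm_leray_integral tau v M x i : 0 < tau -> 0 < M ->
  measurable_fun [set: 'rV[R]_d] v -> bounded v M ->
  (\int[mu]_y `|leray_integrand tau i v x y|%:E <=
   ((L1 tau + Loo tau) * M ^+ 2)%:E)%E.
Proof.
move=> t0 M0 mv vM; apply: le_trans (oseen_sqr_integral x t0 M0 mv vM).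
apply: ge0_le_integral => //.
- apply/measurable_EFinP; apply: measurableT_comp => //.
  exact: measurable_leray_integrand.
- by apply/measurable_EFinP; exact: measurable_oseen_sqr.
- by move=> y _; rewrite lee_fin norm_leray_integrand.
Qed.

Lemma leray_integrable tau v M x i : 0 < tau -> 0 < M ->
  measurable_fun [set: 'rV[R]_d] v -> bounded v M ->
  mu.-integrable setT (EFin \o leray_integrand tau i v x).
Proof.
move=> t0 M0 mv vM; apply: integrable_EFinP => //.
  exact: measurable_leray_integrand.
exact: le_lt_trans (norm_leray_integral x i t0 M0 mv vM) (ltry _).
Qed.

Lemma heat_leray_div_le tau v M x i : 0 < tau -> 0 < M ->
  measurable_fun [set: 'rV[R]_d] v -> bounded v M ->
  `|heat_leray_div tau v x ord0 i| <= (L1 tau + Loo tau) * M ^+ 2.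
Proof.
move=> t0 M0 mv vM; rewrite heat_leray_divE -lee_fin.
apply: le_trans (norm_leray_integral x i t0 M0 mv vM).
by apply: normr_Rintegral_le => //; exact: measurable_leray_integrand.
Qed.

(** Continuity in the field, pointwise in [x]. The size [e] of [v - w] is also taken as the Young
    parameter, so that [e^-1 e^2] and [e M^2] are both of order [e]. *)
Lemma heat_leray_divB_le tau v w M e x i : 0 < tau -> 0 < M -> 0 < e ->
  measurable_fun [set: 'rV[R]_d] v -> measurable_fun [set: 'rV[R]_d] w ->
  bounded v M -> bounded w M -> bounded (fun y => v y - w y) e ->
  `|heat_leray_div tau v x ord0 i - heat_leray_div tau w x ord0 i| <=
  e * ((L1 tau + Loo tau) * (1 + 2 * M ^+ 2)).
Proof.
move=> t0 M0 e0 mv mw vM wM vwe.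
have mvw : measurable_fun [set: 'rV[R]_d] (fun y => v y - w y).
  exact: measurable_fun_subrV.
rewrite !heat_leray_divE -RintegralB//; last 2 first.
- exact: (leray_integrable x i t0 M0 mv vM).
- exact: (leray_integrable x i t0 M0 mw wM).
set K := L1 tau + Loo tau.
rewrite -lee_fin; apply: (@le_trans _ _ (\int[mu]_y ((e^-1)%:E * (oseen_sum tau (x - y) * enorm (v y - w y) ^+ 2)%:E +
   (e%:E * (oseen_sum tau (x - y) * enorm (v y) ^+ 2)%:E +
    e%:E * (oseen_sum tau (x - y) * enorm (w y) ^+ 2)%:E)))%E).
  apply: (@le_trans _ _ (\int[mu]_y `|leray_integrand tau i v x y - leray_integrand tau i w x y|%:E)%E).
    apply: normr_Rintegral_le => //.
    by apply: measurable_funB; exact: measurable_leray_integrand.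
  apply: ge0_le_integral => //.
  - apply/measurable_EFinP; apply: measurableT_comp => //.
    by apply: measurable_funB; exact: measurable_leray_integrand.
  - apply: emeasurable_funD; last apply: emeasurable_funD; apply: emeasurable_funM => //;
      by apply/measurable_EFinP; exact: measurable_oseen_sqr.
  - move=> y _; rewrite -!EFinM -!EFinD lee_fin.
    apply: (le_trans (norm_leray_integrandB tau i v w x y e0)).
    by rewrite le_eqVlt; apply/orP; left; apply/eqP; ring.
have ge0 (f : field) y : (0 <= (oseen_sum tau (x - y) * enorm (f y) ^+ 2)%:E)%E.
  by rewrite lee_fin mulr_ge0 ?oseen_sum_ge0 ?sqr_ge0.
have mE (f : field) : measurable_fun [set: 'rV[R]_d] f ->
    measurable_fun setT (fun y => (oseen_sum tau (x - y) * enorm (f y) ^+ 2)%:E).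
  by move=> mf; apply/measurable_EFinP; exact: measurable_oseen_sqr.
have ei0 : 0 <= e^-1 by rewrite invr_ge0 ltW.
have mC c (f : field) : measurable_fun [set: 'rV[R]_d] f ->
    measurable_fun setT (fun y => c%:E * (oseen_sum tau (x - y) * enorm (f y) ^+ 2)%:E)%E.
  by move=> mf; apply: emeasurable_funM => //; exact: mE.
have C0 c (f : field) y : 0 <= c -> (0 <= c%:E * (oseen_sum tau (x - y) * enorm (f y) ^+ 2)%:E)%E.
  by move=> c0; rewrite mule_ge0.
have e00 := ltW e0.
rewrite ge0_integralD//; last 4 first.
- by move=> y _; exact: (C0 _ (fun y => v y - w y)).
- exact: (mC _ (fun y => v y - w y)).
- by move=> y _; rewrite adde_ge0 ?C0.
- by apply: emeasurable_funD; exact: mC.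
rewrite ge0_integralD//; last 4 first.
- by move=> y _; exact: C0.
- exact: mC.
- by move=> y _; exact: C0.
- exact: mC.
have ZE c (f : field) : 0 <= c -> measurable_fun [set: 'rV[R]_d] f ->
    (\int[mu]_y (c%:E * (oseen_sum tau (x - y) * enorm (f y) ^+ 2)%:E) =
     c%:E * \int[mu]_y (oseen_sum tau (x - y) * enorm (f y) ^+ 2)%:E)%E.
  by move=> c0 mf'; rewrite ge0_integralZl//; exact: mE.
rewrite (ZE _ (fun y => v y - w y))// ZE// ZE//.
have -> : e * (K * (1 + 2 * M ^+ 2)) = e^-1 * (K * e ^+ 2) + (e * (K * M ^+ 2) + e * (K * M ^+ 2)).
  by field; rewrite gt_eqF.
rewrite !EFinD !EFinM; apply: leeD; last apply: leeD.
- apply: lee_wpmul2l; rewrite ?lee_fin// -EFinM.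
  exact: (oseen_sqr_integral x t0 e0 mvw vwe).
- apply: lee_wpmul2l; rewrite ?lee_fin// -EFinM.
  exact: (oseen_sqr_integral x t0 M0 mv vM).
- apply: lee_wpmul2l; rewrite ?lee_fin// -EFinM.
  exact: (oseen_sqr_integral x t0 M0 mw wM).
Qed.

Lemma heat_heat_leray_div r tau v M x : 0 < r -> 0 < tau -> 0 < M ->
  measurable_fun [set: 'rV[R]_d] v -> bounded v M ->
  heat r (heat_leray_div tau v) x = heat_leray_div (r + tau) v x.
Proof.
move=> r0 t0 M0 mv vM; apply/rowP => i; rewrite (heat_leray_divE (r + tau) v x i).
transitivity (\int[mu]_y (heat_kernel r (x - y) *
    \int[mu]_z leray_integrand tau i v y z)).
  by rewrite mxE; apply: eq_Rintegral => y _; rewrite (heat_leray_divE tau v y i).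
pose f (w : 'rV[R]_d * 'rV[R]_d) : R := leray_integrand tau i v w.1 w.2.
have mf : measurable_fun setT f.
  have mg : measurable_fun [set: 'rV[R]_d * 'rV[R]_d]
      (fun w : 'rV[R]_d * 'rV[R]_d => ((tau, w.1), w.2)).
    by apply: measurable_fun_pair => //; exact: measurable_fun_pair.
  exact: (measurableT_comp (measurable_leray_integrand3 i mv) mg).
rewrite (@Rintegral_heat_swap r f ((L1 tau + Loo tau) * M ^+ 2) _ r0 mf).
  apply: eq_Rintegral => z _; rewrite /f /leray_integrand /=.
  have Ki j k : mu.-integrable setT (EFin \o (fun y => heat_kernel r (x - y) *
      (oseen_kernel tau i j k (y - z) * (v z ord0 j * v z ord0 k)))).
    apply: (integrable_heat_kernelM (C := 2 * heat_q tau * (D * P tau) * `|v z ord0 j * v z ord0 k|)) => //.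
      apply: measurable_funM => //.
      exact: (measurableT_comp (measurable_oseen_kernel tau i j k) (measurable_subrVr z)).
    by move=> y; rewrite normrM ler_wpM2r// oseen_kernel_sup.
  transitivity (\int[mu]_y \sum_(j < d) \sum_(k < d) heat_kernel r (x - y) *
      (oseen_kernel tau i j k (y - z) * (v z ord0 j * v z ord0 k))).
    apply: eq_Rintegral => y _; rewrite mulr_sumr; apply: eq_bigr => j _.
    by rewrite mulr_sumr.
  rewrite Rintegral_sum; last first.
    move=> j; have := @integrable_sum _ _ _ mu setT measurableT _ (index_enum 'I_d)
      xpredT _ (fun k _ => Ki j k).
    by apply: eq_integrable => // y _ /=; rewrite -sumEFin.
  apply: eq_bigr => j _; rewrite Rintegral_sum//; apply: eq_bigr => k _.
  under eq_Rintegral do rewrite mulrA.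
  rewrite RintegralZr//; first by rewrite heat_kernel_conv_oseen.
  apply: (integrable_heat_kernelM (C := 2 * heat_q tau * (D * P tau))) => //.
    exact: (measurableT_comp (measurable_oseen_kernel tau i j k) (measurable_subrVr z)).
  by move=> y; exact: oseen_kernel_sup.
by move=> y; exact: (norm_leray_integral y i t0 M0 mv vM).
Qed.

End field_operators.

(** * The Duhamel integral in [L^p] *)

Section duhamel_bound.
Context {R : realType} {d : nat}.
Local Notation mu := (@lebesgue_rV R d).
Local Notation leb := (@lebesgue_measure R).
Local Notation field := ('rV[R]_d -> 'rV[R]_d).
Implicit Types (x y z : 'rV[R]_d) (i j : 'I_d) (s t r tau M : R) (v w : field) (u : R -> field).
Local Notation D := (@heat_D R d).
Local Notation P := (@heat_peak R d).
Local Notation L1 := (@oseen_L1 R d).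
Local Notation Loo := (@oseen_Loo R d).
Variable p : \bar R.
Hypothesis d0 : (0 < d)%N.
Hypothesis p2 : (2%:E < p)%E.
Hypothesis dp : (d%:R%:E < p)%E.

Let p1 : (1 < p)%E.
Proof. by apply: lt_trans p2; rewrite lte_fin ltr1n. Qed.

Let p0 : (0 <= p)%E. Proof. by apply: le_trans (ltW p1). Qed.

Local Notation bounded v M := (Lp_le mu p (fun y => enorm (v y)) M).
Local Notation alpha := (scaling_exponent d p).
Local Notation e := (fine p^-1%E).

Lemma inv_p_itv : 0 <= e <= 1.
Proof.
move: p1; case: p => [q||]//; last by rewrite invey/= lexx ler01.
rewrite lte_fin => q1; have q0 : 0 < q by exact: lt_trans q1.
by rewrite inver gt_eqF//= invr_ge0 ltW//= invf_le1// ltW.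
Qed.

Lemma scaling_exponent_gt0 : 0 < alpha.
Proof.
rewrite /scaling_exponent divr_gt0// subr_gt0.
move: p1 dp; case: p => [q||]//; last by rewrite invey mulr0.
rewrite !lte_fin => q1 dq; have q0 : 0 < q by exact: lt_trans q1.
by rewrite inver gt_eqF//= ltr_pdivrMr// mul1r.
Qed.

Definition oseen_C : R := d%:R ^+ 3 * (2 * D).

Lemma oseen_C_gt0 : 0 < oseen_C.
Proof. by rewrite mulr_gt0 ?exprn_gt0 ?ltr0n// !mulr_gt0// powR_gt0. Qed.

Lemma le_powRN (a b c : R) : 0 < a -> a <= b -> 0 <= c -> b `^ (- c) <= a `^ (- c).
Proof.
move=> a0 ab c0; have b0 : 0 < b by exact: lt_le_trans ab.
by rewrite !powRN lef_pV2 ?posrE ?powR_gt0// ge0_ler_powR// nnegrE ltW.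
Qed.

Let pi4 : (1 : R) <= 4 * pi. Proof. have := @pi_ge2 R; lra. Qed.

Lemma heat_q_le tau : 0 < tau -> heat_q tau <= tau `^ (- 2^-1).
Proof. by move=> t0; apply: le_powRN; rewrite ?invr_ge0//; lra. Qed.

Lemma heat_peak_le tau : 0 < tau -> P tau <= tau `^ (- (d%:R / 2)).
Proof.
move=> t0; apply: le_powRN; rewrite ?divr_ge0//.
by rewrite -[leLHS]mul1r ler_wpM2r// ltW.
Qed.

(** The mass scales like [tau^(-1/2)] and the supremum like [tau^(-1/2 - d/2)]; with weights
    [1 - 1/p] and [1/p] the exponent is [- 1/2 - d/(2p) = alpha - 1]. *)
Lemma oseen_interpolation tau : 0 < tau ->
  L1 tau `^ (1 - e) * Loo tau `^ e <= oseen_C * tau `^ (alpha - 1).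
Proof.
move=> t0; have /andP[e0 e1] := inv_p_itv; have C0 := oseen_C_gt0.
have q0 := heat_q_ge0 tau; have D0 := @heat_D_ge0 R d.
have P0 : 0 <= P tau by exact: heat_peak_ge0.
have h1 : L1 tau <= oseen_C * tau `^ (- 2^-1).
  apply: (@le_trans _ _ (oseen_C * heat_q tau)).
    rewrite /oseen_L1 /oseen_C ler_wpM2r// ler_wpM2l ?exprn_ge0// ler_wpM2r//.
    lra.
  by rewrite ler_wpM2l ?(ltW C0)// heat_q_le.
have h2 : Loo tau <= oseen_C * (tau `^ (- 2^-1) * tau `^ (- (d%:R / 2))).
  rewrite /oseen_Loo -/oseen_C -mulrA ler_wpM2l ?(ltW C0)// ler_pM//.
    exact: heat_q_le.
  exact: heat_peak_le.
move: h1 h2 C0; move: oseen_C => C h1 h2 C0.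
apply: (@le_trans _ _ ((C * tau `^ (- 2^-1)) `^ (1 - e) *
   (C * (tau `^ (- 2^-1) * tau `^ (- (d%:R / 2)))) `^ e)).
  have L10 : 0 <= L1 tau by exact: oseen_L1_ge0.
  have Loo0 : 0 <= Loo tau by exact: oseen_Loo_ge0.
  have e1' : 0 <= 1 - e by rewrite subr_ge0.
  apply: ler_pM; [exact: powR_ge0|exact: powR_ge0| |].
    by apply: (ge0_ler_powR e1' _ _ h1); rewrite nnegrE ?(le_trans L10 h1).
  by apply: (ge0_ler_powR e0 _ _ h2); rewrite nnegrE ?(le_trans Loo0 h2).
rewrite !powRM ?mulr_ge0 ?powR_ge0 ?(ltW C0)// -!powRrM.
rewrite mulrACA.
have -> : C `^ (1 - e) * C `^ e = C.
  by rewrite -powRD ?subrK ?powRr1 ?(ltW C0)//; apply/implyP => _; rewrite gt_eqF.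
have tn a b : tau `^ a * tau `^ b = tau `^ (a + b).
  by rewrite powRD//; apply/implyP => _; rewrite gt_eqF.
rewrite !tn.
rewrite le_eqVlt; apply/orP; left; apply/eqP; congr (_ * _ `^ _).
by rewrite /scaling_exponent; field.
Qed.

Lemma heat_leray_div_Lp tau v M i : 0 < tau -> 0 < M ->
  measurable_fun [set: 'rV[R]_d] v -> bounded v M ->
  Lp_ub mu p (fun x => `|heat_leray_div tau v x ord0 i|)
    (oseen_C * M ^+ 2 * tau `^ (alpha - 1)).
Proof.
move=> t0 M0 mv vM.
pose k (w : 'rV[R]_d * 'rV[R]_d) := oseen_sum tau (w.1 - w.2).
have mk : measurable_fun setT k.
  exact: (measurableT_comp (measurable_oseen_sum tau) measurable_subrV2).
have k0 (w : 'rV[R]_d * 'rV[R]_d) : 0 <= k w by exact: oseen_sum_ge0.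
have L10 : 0 <= L1 tau by exact: oseen_L1_ge0.
have Loo0 : 0 <= Loo tau by exact: oseen_Loo_ge0.
have := @schur_sqr_Lp _ _ _ _ _ mu mu k mk k0 (L1 tau) (Loo tau) L10 Loo0
  (fun x => integral_oseen_sum x t0) p M (fun y => enorm (v y)) p2 (ltW M0)
  (fun y => integral_oseen_suml y t0) (fun _ => oseen_sum_le _ t0)
  (measurable_enorm_field mv) (fun y => enorm_ge0 _) vM.
set g := (fun x : 'rV[R]_d => fine _) => H.
have mg : measurable_fun setT g.
  apply: measurableT_comp => //.
  apply: (@measurable_kernel_op _ _ _ _ _ mu k mk (fun y => enorm (v y) ^+ 2)).
  by apply: measurable_funX; exact: measurable_enorm_field.
apply: (Lp_ub_leM (M := L1 tau `^ (1 - e) * Loo tau `^ e * M ^+ 2)) => //.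
- by apply: mulr_ge0; [rewrite mulr_ge0 ?powR_ge0|exact: sqr_ge0].
- rewrite (mulrAC _ (M ^+ 2)) ler_wpM2r ?sqr_ge0//; exact: oseen_interpolation.
apply: Lp_ub_mono H => //.
- apply: measurableT_comp => //.
  exact: (measurableT_comp (measurable_heat_leray_div2 i mv) (measurable_pair1 tau)).
move=> x; rewrite -lee_fin /g.
have Foo := oseen_sqr_integral p2 x t0 M0 mv vM.
rewrite fineK; last first.
  rewrite ge0_fin_numE; first exact: le_lt_trans Foo (ltry _).
  by apply: integral_ge0 => y _; rewrite lee_fin mulr_ge0 ?sqr_ge0.
rewrite heat_leray_divE.
apply: (@le_trans _ _ (\int[mu]_y `|leray_integrand tau i v x y|%:E)%E).
  by apply: normr_Rintegral_le => //; exact: measurable_leray_integrand.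
apply: ge0_le_integral => //.
- apply/measurable_EFinP; apply: measurableT_comp => //.
  exact: measurable_leray_integrand.
- apply/measurable_EFinP; apply: measurable_funM.
    exact: (measurableT_comp (measurable_oseen_sum tau) (measurable_subrV x)).
  by apply: measurable_funX; exact: measurable_enorm_field.
- by move=> y _; rewrite lee_fin norm_leray_integrand.
Qed.

(** What the Duhamel estimates use of a solution: measurable time slices, one bound [M], and
    continuity in [L^p] in epsilon-delta form. It is stable under restriction and time shift, and
    joint measurability is derived from it. *)
Definition good_family u T M : Prop :=
  0 < M /\ (forall s, 0 < s < T -> [/\ measurable_fun [set: 'rV[R]_d] (u s),
    bounded (u s) M &
    forall eps : R, 0 < eps -> exists2 delta : R, 0 < delta & forall s' : R, 0 < s' < T ->
      `|s' - s| < delta -> bounded (fun y => u s' y - u s y) eps]).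

Definition duhamel_integrand u T r i (z : R * 'rV[R]_d) : R :=
  if 0 < z.1 < T then heat_leray_div (r - z.1) (u z.1) z.2 ord0 i else 0.

(** Only the field is sampled, at the times [k/(n+1)], while the kernel keeps the exact time
    [r - s]. Each sampled integrand is a step-wise choice of jointly measurable functions, and they
    converge pointwise by the continuity of [heat_leray_div] in the field. *)
Lemma measurable_duhamel_integrand u T M r i : good_family u T M -> T <= r ->
  measurable_fun [set: R * 'rV[R]_d] (duhamel_integrand u T r i).
Proof.
move=> [M0 gu] Tr.
pose N n (z : R * 'rV[R]_d) : nat := Num.truncn (z.1 * n.+1%:R).
pose sn n k : R := k%:R / n.+1%:R.
pose g n k (z : R * 'rV[R]_d) : R := if (0 < z.1 < T) && (0 < sn n k < T)
  then heat_leray_div (r - z.1) (u (sn n k)) z.2 ord0 i else 0.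
have mN n k : measurable (N n @^-1` [set k]).
  have mz : measurable_fun [set: R * 'rV[R]_d] (fun z : R * 'rV[R]_d => z.1 * n.+1%:R).
    exact: measurable_funM.
  have mle m : measurable [set z | (N n z <= m)%N].
    rewrite (_ : [set z | _] = (fun z : R * 'rV[R]_d => z.1 * n.+1%:R) @^-1` `]-oo, m.+1%:R[).
      by rewrite -[X in measurable X]setTI; exact: mz.
    by apply/seteqP; split => z /=; rewrite in_itv/= /N truncn_le_nat.
  case: k => [|k].
    rewrite (_ : _ @^-1` _ = [set z | (N n z <= 0)%N])//.
    by apply/seteqP; split => z /=; rewrite leqn0 => /eqP.
  rewrite (_ : _ @^-1` _ = [set z | (N n z <= k.+1)%N] `\` [set z | (N n z <= k)%N]).
    exact: measurableD.
  apply/seteqP; split => z /=.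
    by move=> ->; split=> //; rewrite ltnn.
  move=> [h1 h2]; apply/eqP; rewrite eqn_leq h1/= ltnNge; exact/negP.
have mg n k : measurable_fun setT (g n k).
  rewrite /g; have [/andP[s0 sT]|ns] := boolP (0 < sn n k < T); last first.
    by under eq_fun do rewrite andbF; exact: measurable_cst.
  under eq_fun do rewrite andbT.
  apply: measurable_fun_if => //.
    by apply: measurable_and; exact: measurable_fun_ltr.
  have ssn : 0 < sn n k < T by rewrite s0.
  have [mu' _ _] := gu _ ssn.
  apply: measurable_funTS.
  have mh : measurable_fun [set: R * 'rV[R]_d] (fun z : R * 'rV[R]_d => (r - z.1, z.2)).
    by apply: measurable_fun_pair => //; exact: measurable_funB.
  exact: (measurableT_comp (measurable_heat_leray_div2 i mu') mh).
apply: (@measurable_fun_cvg _ _ R setT (fun n (a : R * 'rV[R]_d) => g n (N n a) a)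
  (duhamel_integrand u T r i)).
  by move=> n; exact: measurable_fun_glue_nat.
move=> [s x] _; rewrite /duhamel_integrand /=.
have [/andP[s0 sT]|ns] := boolP (0 < s < T); last first.
  apply: cvg_near_cst; apply: nearW => n; rewrite /g /=.
  by rewrite (negbTE ns).
have tau0 : 0 < r - s by rewrite subr_gt0; exact: lt_le_trans Tr.
have sT' : 0 < s < T by rewrite s0.
have [ms sM cs] := gu s sT'.
set K := (L1 (r - s) + Loo (r - s)) * (1 + 2 * M ^+ 2).
have K0 : 0 <= K.
  apply: mulr_ge0; first by apply: addr_ge0; [exact: oseen_L1_ge0|exact: oseen_Loo_ge0].
  by apply: addr_ge0 => //; apply: mulr_ge0 => //; exact: sqr_ge0.
apply/cvgrPdist_lt => eps eps0.
(* The bound to beat is [e' * K], and [K] may vanish. *)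
pose e' := eps / (K + 1).
have e'0 : 0 < e' by rewrite divr_gt0// ltr_wpDl.
have [delta delta0 Hd] := cs e' e'0.
near=> n.
have n0 : 0 < n.+1%:R :> R by rewrite ltr0n.
have Nle : (N n (s, x))%:R <= s * n.+1%:R by rewrite truncn_le mulr_ge0// ltW.
have Nlt : s * n.+1%:R < (N n (s, x))%:R + 1 by rewrite natr1; exact: truncnS_gt.
have nd : n.+1%:R^-1 < delta.
  by near: n; exact: near_infty_natSinv_lt (PosNum delta0).
(* The sample time lies within [1/(n+1)] below [s]; this keeps it positive, since [g] is zero when
   the sample falls outside []0, T[]. *)
have ns : n.+1%:R^-1 < s.
  by near: n; exact: near_infty_natSinv_lt (PosNum s0).
have sns : sn n (N n (s, x)) <= s by rewrite /sn ler_pdivrMr.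
have snd : s - n.+1%:R^-1 < sn n (N n (s, x)).
  rewrite /sn ltr_pdivlMr// mulrBl mulVf ?gt_eqF//; lra.
have snT : 0 < sn n (N n (s, x)) < T.
  apply/andP; split; last exact: le_lt_trans sns sT.
  by apply: lt_trans snd; rewrite subr_gt0.
have [msn snM _] := gu _ snT.
rewrite /g sT' snT /=.
apply: (@le_lt_trans _ _ (e' * K)); last first.
  rewrite /e' mulrAC ltr_pdivrMr ?ltr_wpDl//.
  by rewrite ltr_pM2l// ltrDl.
rewrite distrC; apply: (heat_leray_divB_le p2) => //.
apply: Hd => //; rewrite distrC ger0_norm ?subr_ge0//.
by apply: lt_trans nd; rewrite ltrBlDl -ltrBlDr.
Unshelve. all: by end_near. Qed.

Lemma good_family_sub u T T' M : good_family u T M -> T' <= T -> good_family u T' M.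
Proof.
move=> [M0 gu] TT; split=> // s /andP[s0 sT].
have sT' : 0 < s < T by rewrite s0 (lt_le_trans sT).
have [ms sM cs] := gu s sT'; split => // eps /cs[delta d0' H]; exists delta => // s'.
by move=> /andP[s'0 s'T]; apply: H; rewrite s'0 (lt_le_trans s'T).
Qed.

Lemma good_family_shift u t1 r M : good_family u (t1 + r) M -> 0 <= t1 ->
  good_family (fun s => u (t1 + s)) r M.
Proof.
move=> [M0 gu] t10; split=> // s /andP[s0 sT].
have sT' : 0 < t1 + s < t1 + r by rewrite ltr_wpDl//= ltrD2l.
have [ms sM cs] := gu _ sT'; split => // eps /cs[delta d0' H]; exists delta => // s'.
move=> /andP[s'0 s'T] ss; apply: H; first by rewrite ltr_wpDl//= ltrD2l.
by rewrite opprD addrACA subrr add0r.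
Qed.

Lemma duhamel_integrandE u T r i x s : 0 < s < T ->
  duhamel_integrand u T r i (s, x) = heat_leray_div (r - s) (u s) x ord0 i.
Proof. by move=> sT; rewrite /duhamel_integrand/= sT. Qed.

Lemma measurable_duhamel_integrand_time u T M r i x : good_family u T M -> T <= r ->
  measurable_fun `]0, T[ (fun s => heat_leray_div (r - s) (u s) x ord0 i).
Proof.
move=> gu Tr.
have m := measurableT_comp (measurable_duhamel_integrand i gu Tr) (measurable_pair2 x).
apply: (eq_measurable_fun (fun s => duhamel_integrand u T r i (s, x))).
  by move=> s; rewrite inE/= in_itv/= => sT; rewrite duhamel_integrandE.
exact: measurable_funTS.
Qed.

Definition duhamel_C : R := oseen_C / alpha.

(** Minkowski in time against the slice bound [kap s], of order [(T - s)^(alpha - 1)]. Its integral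
    is where [alpha > 0], that is [p > d], is used. *)
Lemma duhamel_Lp u T M i : 0 < T -> good_family u T M ->
  {ae mu, forall x, (\int[leb]_(s in `]0%R, T[)
     `|heat_leray_div (T - s) (u s) x ord0 i|%:E < +oo)%E} /\
  Lp_ub mu p (fun x => fine (\int[leb]_(s in `]0%R, T[)
     `|heat_leray_div (T - s) (u s) x ord0 i|%:E)%E)
    (duhamel_C * M ^+ 2 * T `^ alpha).
Proof.
move=> T0 gu; have [M0 gus] := gu; have a0 := scaling_exponent_gt0.
have C0 := oseen_C_gt0.
pose F (w : 'rV[R]_d * R) : R := `|duhamel_integrand u T T i (w.2, w.1)|.
have mF : measurable_fun setT F.
  apply: measurableT_comp => //.
  exact: (measurableT_comp (measurable_duhamel_integrand i gu (lexx T)) (@measurable_swap _ _ _ _)).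
pose kap s : R := oseen_C * M ^+ 2 * (T - s) `^ (alpha - 1).
have kap0 s : `]0, T[%classic s -> 0 < kap s.
  rewrite /= in_itv/= => /andP[_ sT]; rewrite /kap.
  by rewrite (mulr_gt0 (mulr_gt0 C0 (exprn_gt0 2 M0)))// powR_gt0// subr_gt0.
have mkap : measurable_fun [set: R] kap.
  by apply: measurable_funM => //; exact: measurable_powR_sub.
have kapI : (\int[leb]_(s in `]0%R, T[) (kap s)%:E <= (duhamel_C * M ^+ 2 * T `^ alpha)%:E)%E.
  rewrite /kap; under eq_integral do rewrite EFinM.
  rewrite ge0_integralZl//; last 3 first.
  - by apply/measurable_EFinP; apply: measurable_funTS; exact: measurable_powR_sub.
  - by move=> s _; rewrite lee_fin powR_ge0.
  - by rewrite lee_fin (mulr_ge0 (ltW C0) (sqr_ge0 M)).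
  rewrite (_ : duhamel_C * M ^+ 2 * T `^ alpha = oseen_C * M ^+ 2 * (alpha^-1 * T `^ alpha)); last first.
    by rewrite /duhamel_C; field; rewrite gt_eqF.
  rewrite [leRHS]EFinM; apply: lee_wpmul2l.
    by rewrite lee_fin (mulr_ge0 (ltW C0) (sqr_ge0 M)).
  exact: integral_powR_sub_le.
have := @minkowski_Lp _ _ _ _ _ mu leb p (duhamel_C * M ^+ 2 * T `^ alpha) `]0, T[%classic F kap p1.
have c0 : 0 <= duhamel_C * M ^+ 2 * T `^ alpha.
  by rewrite mulr_ge0 ?powR_ge0// mulr_ge0 ?sqr_ge0// divr_ge0// ltW.
move=> /(_ c0 (measurable_itv _) mF (fun _ => normr_ge0 _) mkap kap0 kapI).
have FE s x : `]0, T[%classic s -> F (x, s) = `|heat_leray_div (T - s) (u s) x ord0 i|.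
  by rewrite /= in_itv/= => sT; rewrite /F/= duhamel_integrandE.
have IE x : (\int[leb]_(s in `]0%R, T[) (F (x, s))%:E =
    \int[leb]_(s in `]0%R, T[) `|heat_leray_div (T - s) (u s) x ord0 i|%:E)%E.
  by apply: eq_integral => s; rewrite inE => sT; rewrite FE.
have FL s : `]0, T[%classic s -> Lp_ub mu p (fun x => F (x, s)) (kap s).
  move=> sT; under eq_fun do rewrite FE//.
  have sT' : 0 < s < T by move: sT; rewrite /= in_itv.
  have [ms sM _] := gus s sT'.
  by apply: heat_leray_div_Lp => //; move: sT' => /andP[_]; rewrite subr_gt0.
move=> /(_ FL)[H1 H2]; split.
  by apply: filterS H1 => x; rewrite IE.
by move: H2; under eq_fun do rewrite IE.
Qed.

Lemma duhamelE u t x i :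
  duhamel u t x ord0 i = \int[leb]_(s in `]0, t[) heat_leray_div (t - s) (u s) x ord0 i.
Proof. by rewrite mxE. Qed.

End duhamel_bound.

Lemma integral_shift_itv0 {R : realType} (a r : R) (f : R -> \bar R) :
  measurable_fun `]a, (a + r)%R[ f ->
  (\int[@lebesgue_measure R]_(x in `]0%R, r[) f (a + x)%R =
   \int[@lebesgue_measure R]_(x in `]a, (a + r)%R[) f x)%E.
Proof.
move=> mf; rewrite integral_mkcond [RHS]integral_mkcond.
rewrite -(@integral_shift _ a (f \_ `]a, (a + r)%R[)); last first.
  by rewrite -measurable_restrictT.
apply: eq_integral => x _; rewrite !patchE !mem_setE !in_itv/= ltrDl ltrD2l.
by [].
Qed.

(** * Splitting the Duhamel integral in time *)

Section duhamel_split.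
Context {R : realType} {d : nat}.
Local Notation mu := (@lebesgue_rV R d).
Local Notation leb := (@lebesgue_measure R).
Local Notation field := ('rV[R]_d -> 'rV[R]_d).
Implicit Types (x y z : 'rV[R]_d) (i j : 'I_d) (s t r tau M : R) (v w : field) (u : R -> field).
Variable p : \bar R.
Hypothesis d0 : (0 < d)%N.
Hypothesis p2 : (2%:E < p)%E.
Hypothesis dp : (d%:R%:E < p)%E.

Let p1 : (1 <= p)%E.
Proof. by apply: le_trans (ltW p2); rewrite lee_fin ler1n. Qed.

Local Notation bounded v M := (Lp_le mu p (fun y => enorm (v y)) M).
Local Notation alpha := (scaling_exponent d p).
Local Notation good_family := (@good_family R d p).

Lemma measurable_duhamel u T M i : good_family u T M ->
  measurable_fun [set: 'rV[R]_d] (fun x => duhamel u T x ord0 i).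
Proof.
move=> gu.
have m := measurableT_comp (measurable_duhamel_integrand p2 i gu (lexx T)) (@measurable_swap _ _ _ _).
have := @measurable_Rintegral_param _ _ _ _ _ leb _ m.
apply: eq_measurable_fun => x _; rewrite mxE [RHS]Rintegral_mkcond.
apply: eq_Rintegral => s _; rewrite patchE mem_setE in_itv/= /duhamel_integrand/=.
by case: ifP.
Qed.

Lemma measurable_duhamel_norm u T M i : good_family u T M ->
  measurable_fun [set: 'rV[R]_d] (fun x => fine (\int[leb]_(s in `]0%R, T[)
    `|heat_leray_div (T - s) (u s) x ord0 i|%:E)%E).
Proof.
move=> gu; apply: measurableT_comp => //.
pose h (w : 'rV[R]_d * R) : R := `|duhamel_integrand u T T i (w.2, w.1)|.
have mh : measurable_fun setT h.
  apply: measurableT_comp => //.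
  exact: (measurableT_comp (measurable_duhamel_integrand p2 i gu (lexx T)) (@measurable_swap _ _ _ _)).
have := @measurable_integral_param _ _ _ _ _ leb (EFin \o h) ((measurable_EFinP _ _).2 mh).
apply: eq_measurable_fun => x _; rewrite [RHS]integral_mkcond.
apply: eq_integral => s _; rewrite patchE mem_setE in_itv/= /h /duhamel_integrand/=.
by case: ifP => _; rewrite ?normr0.
Qed.

Lemma ae_rowP v w : (forall i, {ae mu, forall x, v x ord0 i = w x ord0 i}) ->
  {ae mu, forall x, v x = w x}.
Proof.
move=> vw; have H : {ae mu, forall x, forall i, v x ord0 i = w x ord0 i}.
  exact: filter_forall.
by apply: filterS H => x Hx; apply/rowP => i; exact: Hx.
Qed.

(** Before the cut at [t1] the kernel time [t1 + r - s] stays above [r], so the constants at [r]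
    bound the integrand uniformly in [s]. *)
Lemma oseen_constants_mono r tau : 0 < r -> r <= tau ->
  @oseen_L1 R d tau + @oseen_Loo R d tau <= @oseen_L1 R d r + @oseen_Loo R d r.
Proof.
move=> r0 rt; have D0 := @heat_D_ge0 R d.
have pi4 : (0 : R) < 4 * pi by rewrite mulr_gt0// pi_gt0.
have q : heat_q tau <= heat_q r.
  by apply: le_powRN; rewrite ?mulr_gt0 ?ler_pM2l ?invr_ge0.
have P : @heat_peak R d tau <= @heat_peak R d r.
  by apply: le_powRN; rewrite ?(mulr_gt0 pi4) ?(ler_pM2l pi4) ?divr_ge0.
apply: lerD.
  by rewrite /oseen_L1 ler_wpM2l// mulr_ge0 ?exprn_ge0// mulr_ge0.
rewrite /oseen_Loo ler_pM ?heat_peak_ge0//.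
  by rewrite mulr_ge0 ?heat_q_ge0// mulr_ge0 ?exprn_ge0// mulr_ge0.
by rewrite ler_wpM2l// mulr_ge0 ?exprn_ge0// mulr_ge0.
Qed.

(** Fubini moves the heat flow inside the time integral, where it only advances the kernel time from
    [T - s] to [r + T - s]. The integrability is recorded because the mild identity will be
    convolved term by term. *)
Lemma heat_duhamel u T M r x i : 0 < T -> 0 < r -> good_family u T M ->
  mu.-integrable setT (EFin \o (fun y => heat_kernel r (x - y) * duhamel u T y ord0 i)) /\
  heat r (duhamel u T) x ord0 i =
  \int[leb]_(s in `]0, T[) heat_leray_div (r + T - s) (u s) x ord0 i.
Proof.
move=> T0 r0 gu; have [M0 gus] := gu.
have mK : measurable_fun [set: 'rV[R]_d] (fun y => heat_kernel r (x - y)).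
  exact: (measurableT_comp (measurable_heat_kernel r) (measurable_subrV x)).
pose h (w : 'rV[R]_d * R) : R := duhamel_integrand u T T i (w.2, w.1).
have mh : measurable_fun setT h.
  exact: (measurableT_comp (measurable_duhamel_integrand p2 i gu (lexx T)) (@measurable_swap _ _ _ _)).
pose f (w : 'rV[R]_d * R) : R := heat_kernel r (x - w.1) * h w.
have mf : measurable_fun setT f.
  by apply: measurable_funM => //; exact: (measurableT_comp mK).
have mh1 y : measurable_fun setT (fun s => h (y, s)).
  exact: (measurableT_comp mh (measurable_pair1 y)).
have [Noo NLp] := duhamel_Lp d0 p2 dp i T0 gu.
set N := (fun x => fine _) in NLp.
have hE y : (\int[leb]_s `|h (y, s)|%:E =
    \int[leb]_(s in `]0%R, T[) `|heat_leray_div (T - s) (u s) y ord0 i|%:E)%E.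
  rewrite [RHS]integral_mkcond; apply: eq_integral => s _.
  rewrite patchE mem_setE in_itv/= /h /duhamel_integrand/=.
  by case: ifP => _; rewrite ?normr0.
have mN : measurable_fun setT N by exact: measurable_duhamel_norm gu.
have N0 y : 0 <= N y by rewrite fine_ge0// integral_ge0.
pose B := @duhamel_C R d p * M ^+ 2 * T `^ alpha.
have C0 : 0 < @duhamel_C R d p.
  by rewrite divr_gt0 ?oseen_C_gt0//; exact: scaling_exponent_gt0.
have B0 : 0 < B.
  by rewrite (mulr_gt0 (mulr_gt0 C0 (exprn_gt0 2 M0)))// powR_gt0.
have NB : Lp_le mu p N B by exact: Lp_ub_le.
have KN : (\int[mu]_y (heat_kernel r (x - y) * N y)%:E <= ((1 + @heat_peak R d r) * B)%:E)%E.
  apply: (@kernel_pow_le _ _ _ mu p 1 1 (@heat_peak R d r) B (fun y => heat_kernel r (x - y)) N) => //.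
  - exact: heat_peak_ge0.
  - by move=> y; exact: heat_kernel_ge0.
  - by move=> y; exact: heat_kernel_le.
  - by rewrite integral_heat_kernel.
have foo : (\int[mu]_y \int[leb]_s (`|f (y, s)|)%:E < +oo)%E.
  rewrite (_ : (\int[mu]_y _ = \int[mu]_y (heat_kernel r (x - y) * N y)%:E)%E).
    exact: le_lt_trans KN (ltry _).
  apply: ae_eq_integral => //.
  - apply: (@measurable_integral_param _ _ _ _ _ leb (EFin \o (Num.norm \o f))).
    by apply/measurable_EFinP; exact: measurableT_comp.
  - by apply/measurable_EFinP; exact: measurable_funM.
  apply: filterS Noo => y yoo _.
  rewrite EFinM /N fineK; last by rewrite ge0_fin_numE// integral_ge0.
  rewrite -hE -ge0_integralZl//; last 2 first.
  - by apply/measurable_EFinP; apply: measurableT_comp => //; exact: mh1.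
  - by rewrite lee_fin heat_kernel_ge0.
  by apply: eq_integral => s _; rewrite /f normrM (ger0_norm (heat_kernel_ge0 _ _)).
have hD y : \int[leb]_s h (y, s) = duhamel u T y ord0 i.
  rewrite mxE [RHS]Rintegral_mkcond.
  apply: eq_Rintegral => s _; rewrite patchE mem_setE in_itv/= /h /duhamel_integrand/=.
  by case: ifP.
have aeK : {ae mu, forall y, \int[leb]_s f (y, s) = heat_kernel r (x - y) * duhamel u T y ord0 i}.
  apply: filterS Noo => y yoo.
  rewrite -hD -RintegralZl//.
  by apply: integrable_EFinP => //; [exact: mh1|rewrite hE].
have mKD : measurable_fun setT (fun y => heat_kernel r (x - y) * duhamel u T y ord0 i).
  by apply: measurable_funM => //; exact: measurable_duhamel gu.
have Fi := @integrable_Rintegral_param _ _ _ _ _ mu leb f mf foo.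
split.
  apply/integrableP; split; first exact/measurable_EFinP.
  have /integrableP[_] := Fi; apply: le_lt_trans.
  rewrite le_eqVlt; apply/orP; left; apply/eqP; apply: ae_eq_integral => //.
  - by apply: measurableT_comp => //; exact/measurable_EFinP.
  - apply: measurableT_comp => //; apply/measurable_EFinP.
    exact: (@measurable_Rintegral_param _ _ _ _ _ leb _ mf).
  - by apply: filterS aeK => y /= -> .
rewrite mxE; transitivity (\int[mu]_y \int[leb]_s f (y, s)).
  congr fine; apply: ae_eq_integral => //.
  - exact/measurable_EFinP.
  - apply/measurable_EFinP; exact: (@measurable_Rintegral_param _ _ _ _ _ leb _ mf).
  - by apply: filterS aeK => y /= ->.
rewrite (@Rintegral_fubini _ _ _ _ _ mu leb f mf foo) [RHS]Rintegral_mkcond.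
apply: eq_Rintegral => s _; rewrite patchE mem_setE in_itv/= /f /h /duhamel_integrand/=.
have [sT|nsT] := boolP (0 < s < T); last first.
  under eq_Rintegral do rewrite mulr0.
  by rewrite /Rintegral integral0.
have [ms sM _] := gus s sT; move: (sT) => /andP[s0 sT'].
have Ts0 : 0 < T - s by rewrite subr_gt0.
have := congr1 (fun z : 'rV[R]_d => z ord0 i) (heat_heat_leray_div p2 x r0 Ts0 M0 ms sM).
rewrite mxE addrA; exact.
Qed.

(** The time integral is cut at [t1]: the early part is [heat_duhamel] and the late part is a time
    shift. Additivity needs integrability on both sides: the early integrand is bounded, while the
    late one is singular at its endpoint and integrable only for almost every [x]. *)
Lemma duhamel_split u t1 r M : 0 < t1 -> 0 < r -> good_family u (t1 + r) M ->
  {ae mu, forall x, duhamel u (t1 + r) x =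
     heat r (duhamel u t1) x + duhamel (fun s => u (t1 + s)) r x}.
Proof.
move=> t10 r0 gu; have [M0 gus] := gu.
have gu1 : good_family u t1 M by apply: good_family_sub gu _; rewrite lerDl ltW.
have gur : good_family (fun s => u (t1 + s)) r M by apply: good_family_shift => //; exact: ltW.
have key i : {ae mu, forall x, duhamel u (t1 + r) x ord0 i =
     (heat r (duhamel u t1) x + duhamel (fun s => u (t1 + s)) r x) ord0 i}.
  have [Noo _] := duhamel_Lp d0 p2 dp i r0 gur.
  apply: filterS Noo => x xoo.
  have Eh := (heat_duhamel x i t10 r0 gu1).2.
  rewrite [RHS]mxE Eh; apply: (etrans (duhamelE _ _ _ _)); apply: esym.
  apply: (etrans (congr1 (GRing.add _) (duhamelE _ _ _ _))); apply: esym.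
  pose f (s : R) : R := heat_leray_div (t1 + r - s) (u s) x ord0 i.
  have mf : measurable_fun `]0, t1 + r[ f.
    exact: (measurable_duhamel_integrand_time p2 i x gu (lexx _)).
  have fr s : f (t1 + s) = heat_leray_div (r - s) (u (t1 + s)) x ord0 i.
    by rewrite /f opprD addrACA subrr add0r.
  have sub1 : `]0, t1[ `<=` `]0, t1 + r[.
    by apply: subset_itvl; rewrite bnd_simp lerDl ltW.
  have sub2 : `]t1, t1 + r[ `<=` `]0, t1 + r[.
    by apply: subset_itvr; rewrite bnd_simp ltW.
  have sub3 : `[t1, t1 + r[ `<=` `]0, t1 + r[.
    by apply: subset_itvr; rewrite bnd_simp.
  have mfa D : D `<=` `]0, t1 + r[%classic -> measurable D ->
      measurable_fun D (fun s => `|f s|%:E).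
    move=> sD mD; apply/measurable_EFinP; apply: measurableT_comp => //.
    exact: measurable_funS mf.
  have I1 : (\int[leb]_(s in `]0%R, t1[) `|f s|%:E < +oo)%E.
    pose K := (@oseen_L1 R d r + @oseen_Loo R d r) * M ^+ 2.
    apply: (@le_lt_trans _ _ (\int[leb]_(s in `]0%R, t1[) K%:E)%E); last first.
      by rewrite integral_cst//= lebesgue_measure_itv/= lte_fin t10 -EFinB -EFinM ltry.
    apply: ge0_le_integral => //; first exact: mfa.
    move=> s /=; rewrite in_itv/= => /andP[s0 st1]; rewrite lee_fin.
    have sT : 0 < s < t1 + r by rewrite s0 (lt_le_trans st1)// lerDl ltW.
    have [ms sM _] := gus s sT.
    have tau0 : r <= t1 + r - s by rewrite addrAC lerDr subr_ge0 ltW.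
    apply: (le_trans (heat_leray_div_le p2 x i (lt_le_trans r0 tau0) M0 ms sM)).
    rewrite /K ler_wpM2r ?sqr_ge0//; exact: oseen_constants_mono.
  have I2 : (\int[leb]_(s in `]t1, (t1 + r)%R[) `|f s|%:E < +oo)%E.
    rewrite -(@integral_shift_itv0 _ t1 r (fun s => `|f s|%:E)); last exact: mfa.
    apply: le_lt_trans xoo; rewrite le_eqVlt; apply/orP; left; apply/eqP.
    by apply: eq_integral => s _; rewrite fr.
  have I2' : (\int[leb]_(s in `[t1, (t1 + r)%R[) `|f s|%:E < +oo)%E.
    by rewrite -integral_itv_obnd_cbnd//; exact: mfa.
  have disj : [disjoint `]0, t1[%classic & `[t1, t1 + r[%classic].
    apply/disj_setPLR => s /=; rewrite !in_itv/= => /andP[_ st1] /andP[ts _].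
    by move: (lt_le_trans st1 ts); rewrite ltxx.
  have UE : `]0, t1 + r[%classic = `]0, t1[ `|` `[t1, t1 + r[.
    by rewrite -itv_bndbnd_setU//= bnd_simp ltW// ltrDl.
  have mfU : measurable_fun (`]0, t1[ `|` `[t1, t1 + r[) f.
    exact: (eq_ind _ (fun D => measurable_fun D f) mf _ UE).
  have intU : leb.-integrable (`]0, t1[ `|` `[t1, t1 + r[) (EFin \o f).
    apply: integrable_EFinP; [exact: measurableU|exact: mfU|].
    rewrite ge0_integral_setU//; first exact: lte_add_pinfty.
    by apply/measurable_EFinP; exact: (measurableT_comp _ mfU).
  transitivity (\int[leb]_(s in `]0, t1[ `|` `[t1, t1 + r[) f s).
    exact: (congr1 (fun D => \int[leb]_(s in D) f s) UE).
  rewrite (@Rintegral_setU _ _ _ leb _ _ _ (measurable_itv _) (measurable_itv _) intU disj).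
  have E1 : \int[leb]_(s in `]0, t1[) f s =
      \int[leb]_(s in `]0, t1[) heat_leray_div (r + t1 - s) (u s) x ord0 i.
    by apply: eq_Rintegral => s _; rewrite /f (addrC t1).
  have E2 : \int[leb]_(s in `[t1, t1 + r[) f s =
      \int[leb]_(s in `]0, r[) heat_leray_div (r - s) (u (t1 + s)) x ord0 i.
    transitivity (\int[leb]_(s in `]t1, t1 + r[) f s).
      apply: esym; apply: Rintegral_itv_obnd_cbnd.
      apply: integrable_EFinP; [exact: measurable_itv| |exact: I2].
      exact: (measurable_funS _ sub2 mf).
    rewrite -(@Rintegral_shift_itv0 _ t1 r f (measurable_funS (measurable_itv _) sub2 mf)).
    by apply: eq_Rintegral => s _; exact: fr.
  exact: (f_equal2 +%R E1 E2).
exact: ae_rowP key.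
Qed.

End duhamel_split.

(** * Gluing solutions *)

Section Lp_norm.
Context {R : realType} {d : nat}.
Local Notation mu := (@lebesgue_rV R d).
Local Notation field := ('rV[R]_d -> 'rV[R]_d).
Implicit Types (x y z : 'rV[R]_d) (i j : 'I_d) (M B : R) (v w : field) (u : R -> field).
Variable p : \bar R.
Hypothesis p2 : (2%:E < p)%E.

Let p1 : (1 <= p)%E.
Proof. by apply: le_trans (ltW p2); rewrite lee_fin ler1n. Qed.

Let p0 : (0 <= p)%E. Proof. exact: le_trans p1. Qed.

Lemma measurable_fieldD v w : measurable_fun [set: 'rV[R]_d] v ->
  measurable_fun [set: 'rV[R]_d] w -> measurable_fun [set: 'rV[R]_d] (fun x => v x + w x).
Proof.
move=> mv mw; apply/measurable_fun_rVP => i; under eq_fun do rewrite mxE.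
by apply: measurable_funD; exact: measurable_field_coord.
Qed.

Lemma measurable_fieldN v : measurable_fun [set: 'rV[R]_d] v ->
  measurable_fun [set: 'rV[R]_d] (fun x => - v x).
Proof.
move=> mv; apply/measurable_fun_rVP => i; under eq_fun do rewrite mxE.
by apply: measurableT_comp => //; exact: measurable_field_coord.
Qed.

Lemma measurable_fieldB v w : measurable_fun [set: 'rV[R]_d] v ->
  measurable_fun [set: 'rV[R]_d] w -> measurable_fun [set: 'rV[R]_d] (fun x => v x - w x).
Proof. by move=> mv mw; apply: measurable_fieldD => //; exact: measurable_fieldN. Qed.

Lemma Lp_norm_ge0 v : (0 <= Lp_norm p v)%E.
Proof. exact: Lnorm_ge0. Qed.

Lemma Lp_norm_ae_le v w : measurable_fun [set: 'rV[R]_d] v ->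
  measurable_fun [set: 'rV[R]_d] w ->
  {ae mu, forall x, enorm (v x) <= enorm (w x)} ->
  (Lp_norm p v <= Lp_norm p w)%E.
Proof.
move=> mv mw vw; have := Lp_norm_ge0 w.
case E : (Lp_norm p w) => [M| |]//; last by move=> _; exact: leey.
rewrite lee_fin => M0; apply/(Lp_norm_leP p2) => //.
have /(Lp_norm_leP p2 w M0) wM : (Lp_norm p w <= M%:E)%E by rewrite E.
apply: Lp_le_mono vw wM => //; first exact: measurable_enorm_field.
- exact: measurable_enorm_field.
- by move=> x; exact: enorm_ge0.
Qed.

Lemma Lp_norm_ae_eq v w : measurable_fun [set: 'rV[R]_d] v ->
  measurable_fun [set: 'rV[R]_d] w ->
  {ae mu, forall x, v x = w x} -> Lp_norm p v = Lp_norm p w.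
Proof.
move=> mv mw vw; apply/eqP; rewrite eq_le; apply/andP; split.
  by apply: Lp_norm_ae_le => //; apply: filterS vw => x ->.
by apply: Lp_norm_ae_le => //; apply: filterS vw => x ->.
Qed.

Lemma Lp_normD v w : measurable_fun [set: 'rV[R]_d] v ->
  measurable_fun [set: 'rV[R]_d] w ->
  (Lp_norm p (fun x => v x + w x)%R <= Lp_norm p v + Lp_norm p w)%E.
Proof.
move=> mv mw.
have H := @eminkowski _ _ _ mu _ _ p (measurable_enorm_field mv) (measurable_enorm_field mw) p1.
suff : (Lp_norm p (fun x => v x + w x)%R <=
  'N[mu]_p[EFin \o (fun x => enorm (v x) + enorm (w x))%R])%E.
  by move=> /le_trans; apply; exact: H.
set f := (fun x => enorm (v x) + enorm (w x)).
have : (0 <= 'N[mu]_p[EFin \o f])%E by exact: Lnorm_ge0.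
case E : ('N[mu]_p[EFin \o f])%E => [M| |]//; last by move=> _; exact: leey.
rewrite lee_fin => M0; apply/(Lp_norm_leP p2) => //.
have f0 x : 0 <= f x by rewrite addr_ge0// enorm_ge0.
have /(Lnorm_leP _ p1 M0 f0) fM : ('N[mu]_p[EFin \o f] <= M%:E)%E by rewrite E.
apply: Lp_le_mono fM => //.
- by apply: measurable_enorm_field; exact: measurable_fieldD.
- by apply: measurable_funD; exact: measurable_enorm_field.
- by move=> x; exact: enorm_ge0.
- by apply: nearW => x; exact: enormD.
Qed.

Lemma Lp_normB v w : measurable_fun [set: 'rV[R]_d] v ->
  measurable_fun [set: 'rV[R]_d] w ->
  (Lp_norm p (fun x => v x - w x)%R <= Lp_norm p v + Lp_norm p w)%E.
Proof.
move=> mv mw; have -> : Lp_norm p w = Lp_norm p (fun x => - w x).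
  by apply: eq_Lnorm => x; rewrite enormN.
by apply: Lp_normD => //; exact: measurable_fieldN.
Qed.

(** Minkowski over the coordinates; the factor [d] lost here is the one that appears in
    [sparse_C]. *)
Lemma Lp_norm_coord v B : 0 <= B -> measurable_fun [set: 'rV[R]_d] v ->
  (forall i, Lp_le mu p (fun x => `|v x ord0 i|) B) ->
  (Lp_norm p v <= (d%:R * B)%:E)%E.
Proof.
move=> B0 mv vB; have mi i : measurable_fun setT (fun x => `|v x ord0 i|).
  by apply: measurableT_comp => //; exact: measurable_field_coord.
have sumB (s : seq 'I_d) : ('N[mu]_p[EFin \o (fun x => \sum_(i <- s) `|v x ord0 i|)%R] <=
    ((size s)%:R * B)%:E)%E.
  elim: s => [|i s IH].
    rewrite mul0r (_ : _ \o _ = cst 0%E); last first.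
      by apply/funext => x /=; rewrite big_nil.
    by rewrite Lnorm0// gt_eqF// (lt_le_trans _ p1).
  rewrite (_ : _ \o _ = (EFin \o (fun x => `|v x ord0 i|)%R) \+
     (EFin \o (fun x => \sum_(i <- s) `|v x ord0 i|)%R))%E; last first.
    by apply/funext => x /=; rewrite big_cons EFinD.
  apply: (le_trans (eminkowski _ _ _ p1)).
  - exact: mi.
  - exact: measurable_sum.
  rewrite /= -natr1 mulrDl mul1r addrC EFinD leeD//.
  by apply/Lnorm_leP.
apply/(Lp_norm_leP p2); first by rewrite mulr_ge0.
have := sumB (enum 'I_d); rewrite size_enum_ord => /Lnorm_leP.
move=> /(_ p1); rewrite mulr_ge0// => /(_ isT) H.
have : Lp_le mu p (fun x => \sum_(i <- enum 'I_d) `|v x ord0 i|) (d%:R * B).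
  by apply: H => x; exact: sumr_ge0.
apply: Lp_le_mono => //.
- exact: measurable_enorm_field.
- exact: measurable_sum.
- by move=> x; exact: enorm_ge0.
- by apply: nearW => x; rewrite big_enum; exact: enorm_le_sum.
Qed.

Lemma Lp_continuous_onP (I : set R) u : Lp_continuous_on p I u <->
  forall t : R, I t -> forall eps : R, 0 < eps -> exists2 delta : R, 0 < delta &
    forall s : R, I s -> `|s - t| < delta -> (Lp_norm p (fun x => (u s x - u t x)%R) <= eps%:E)%E.
Proof.
split=> [cu t It eps eps0|cu t It A].
  have e0A : nbhs (0%E : \bar R) [set x | (x <= eps%:E)%E].
    suff : nbhs (0 : R) [set r | (r%:E <= eps%:E)%E] by [].
    apply/nbhs_ballP; exists eps => //= r; rewrite /ball/= sub0r normrN lee_fin.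
    by move=> /(le_lt_trans (ler_norm _))/ltW.
  have : nbhs t [set s | I s -> (Lp_norm p (fun x => (u s x - u t x)%R) <= eps%:E)%E].
    exact: cu t It _ e0A.
  move=> /nbhs_ballP[delta /= delta0 H]; exists delta => // s Is st.
  by apply: (H s) => //; rewrite /ball/= distrC.
move=> A0; have : nbhs (0 : R) [set r | A r%:E] by [].
move=> /nbhs_ballP[eps /= eps0 H].
have [delta delta0 K] := cu t It _ (divr_gt0 eps0 (ltr0n _ 2)).
suff : nbhs t [set s | I s -> A (Lp_norm p (fun x => (u s x - u t x)%R))] by [].
apply/nbhs_ballP; exists delta => //= s; rewrite /ball/= distrC => st Is.
have := K s Is st; have := Lp_norm_ge0 (fun x => u s x - u t x).
case: (Lp_norm _ _) => [r| |]//; rewrite !lee_fin => r0 re.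
apply: (H r); rewrite /ball/= sub0r normrN ger0_norm//.
by apply: le_lt_trans re _; rewrite ltr_pdivrMr// ltr_pMr// ltr1n.
Qed.

End Lp_norm.

(** * Restarting and splicing solutions *)

Section splicing.
Context {R : realType} {d : nat}.
Local Notation mu := (@lebesgue_rV R d).
Local Notation field := ('rV[R]_d -> 'rV[R]_d).
Implicit Types (x y z : 'rV[R]_d) (i j : 'I_d) (s t r T M : R) (v : field) (u w : R -> field) (I : set R).
Variable p : \bar R.
Hypothesis d0 : (0 < d)%N.
Hypothesis p2 : (2%:E < p)%E.
Hypothesis dp : (d%:R%:E < p)%E.

Let p1 : (1 <= p)%E.
Proof. by apply: le_trans (ltW p2); rewrite lee_fin ler1n. Qed.

Let p0 : (0 <= p)%E. Proof. exact: le_trans p1. Qed.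

Local Notation bounded v M := (Lp_le mu p (fun y => enorm (v y)) M).
Local Notation alpha := (scaling_exponent d p).
Local Notation good_family := (@good_family R d p).
Local Notation strong := (@strong_solution_on R d p).

Lemma in_Lp_bounded v : in_Lp p v -> exists2 M, 0 < M & bounded v M.
Proof.
move=> [mv]; have := Lp_norm_ge0 p v; case E : (Lp_norm p v) => [m| |]// m0 _.
exists (m + 1); first by rewrite ltr_wpDl.
apply/(Lp_norm_leP p2); first by rewrite addr_ge0.
by rewrite E lee_fin lerDl.
Qed.

Lemma good_family_solution I u T : (forall s, I s -> in_Lp p (u s)) ->
  Lp_continuous_on p I u -> Lp_bounded_on p I u -> I T ->
  (forall s, 0 < s <= T -> I s) ->
  exists2 M, good_family u T M & forall s, 0 < s <= T -> bounded (u s) M.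
Proof.
move=> uL /Lp_continuous_onP cu bu IT sub; have [M0 uM0] := bu T IT.
pose M := `|M0| + 1; have M_gt0 : 0 < M by rewrite ltr_wpDl.
have bM s : 0 < s <= T -> bounded (u s) M.
  move=> sT; apply/(Lp_norm_leP p2); first exact: ltW.
  apply: (le_trans (uM0 s sT)); rewrite lee_fin.
  by rewrite (le_trans (ler_norm _))// lerDl.
exists M => //; split => // s /andP[s0 sT].
have sT' : 0 < s <= T by rewrite s0 ltW.
split; [by have [] := uL s (sub _ sT')|exact: bM|move=> eps eps0].
have [delta delta0 H] := cu s (sub _ sT') eps eps0.
exists delta => // s' /andP[s'0 s'T] ss.
apply/(Lp_norm_leP p2 _ (ltW eps0)); apply: H => //.
by apply: sub; rewrite s'0 ltW.
Qed.

Lemma measurable_duhamel_field u T M : good_family u T M ->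
  measurable_fun [set: 'rV[R]_d] (duhamel u T).
Proof.
by move=> gu; apply/measurable_fun_rVP => i; exact: measurable_duhamel gu.
Qed.

Lemma duhamel_norm_le u T M : 0 < T -> good_family u T M ->
  (Lp_norm p (duhamel u T) <=
   (d%:R * (@duhamel_C R d p * M ^+ 2 * T `^ alpha))%:E)%E.
Proof.
move=> T0 gu; have [M0 gus] := gu.
have C0 : 0 < @duhamel_C R d p.
  by rewrite divr_gt0 ?oseen_C_gt0//; exact: scaling_exponent_gt0.
apply: Lp_norm_coord => //.
- by rewrite (mulr_ge0 (mulr_ge0 (ltW C0) (sqr_ge0 M)))// powR_ge0.
- exact: measurable_duhamel_field gu.
move=> i; have [Noo /Lp_ub_le] := duhamel_Lp d0 p2 dp i T0 gu.
apply: Lp_le_mono => //.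
- by apply: measurableT_comp => //; exact: measurable_duhamel gu.
- exact: measurable_duhamel_norm gu.
apply: filterS Noo => x xoo; rewrite duhamelE -lee_fin fineK; last first.
  by rewrite ge0_fin_numE// integral_ge0.
apply: normr_Rintegral_le => //.
exact: (measurable_duhamel_integrand_time p2 i x gu (lexx _)).
Qed.

Lemma eq_duhamel u w t : (forall s, 0 < s < t -> u s = w s) -> duhamel u t = duhamel w t.
Proof.
move=> uw; apply/funext => x; apply/rowP => i.
apply: (etrans (duhamelE _ _ _ _)); apply: esym.
apply: (etrans (duhamelE _ _ _ _)); apply: esym.
by apply: eq_Rintegral => s; rewrite inE/= in_itv/= => /uw ->.
Qed.

(** The heat flow is an integral operator, so the mild identity, known almost everywhere in space,
    becomes an identity at every [x]. *)
Lemma heat_mild r t (u0 : field) u M x : 0 < r -> 0 < t -> in_Lp p u0 ->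
  good_family u t M -> measurable_fun [set: 'rV[R]_d] (u t) -> bounded (u t) M ->
  {ae mu, forall x, u t x = heat t u0 x - duhamel u t x} ->
  heat (r + t) u0 x = heat r (u t) x + heat r (duhamel u t) x.
Proof.
move=> r0 t0 u0L gu mu' uM mild; have [M0 _] := gu.
have [N N0 u0N] := in_Lp_bounded u0L; have mu0 := u0L.1.
rewrite -(heat_heat p2 x r0 t0 N0 mu0 u0N); apply/rowP => i; rewrite [RHS]mxE !mxE.
have I1 := heat_integrable p2 x i r0 M0 mu' uM.
have I2 := (heat_duhamel d0 p2 dp x i t0 r0 gu).1.
rewrite -RintegralD//; congr fine; apply: ae_eq_integral => //.
- apply/measurable_EFinP.
  exact: (measurableT_comp (measurable_heat_integrand2 r i (measurable_heat t mu0)) (measurable_pair1 x)).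
- exact: measurable_int (integrableD _ I1 I2).
apply: filterS mild => y -> _; rewrite !mxE; congr (_%:E).
by rewrite -mulrDr subrK.
Qed.

(** The history before [t] enters as the heat flow of the Duhamel term at [t], once through
    [duhamel_split] and once through [heat_mild], with opposite signs. *)
Lemma mild_restart (u0 : field) u T t r : in_Lp p u0 -> strong `]0, T[ u0 u ->
  0 < t -> 0 < r -> t + r < T ->
  {ae mu, forall x, u (t + r) x = heat r (u t) x - duhamel (fun s => u (t + s)) r x}.
Proof.
move=> u0L [uL cu bu mild] t0 r0 trT.
have tr0 : 0 < t + r by exact: addr_gt0.
have sub s : 0 < s <= t + r -> `]0, T[%classic s.
  by move=> /andP[s0 st]; rewrite /= in_itv/= s0 (le_lt_trans st).
have IT : `]0, T[%classic (t + r) by rewrite /= in_itv/= tr0.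
have [M gu uM] := good_family_solution (fun s Is => (uL s Is).1) cu bu IT sub.
have gut : good_family u t M by apply: good_family_sub gu _; rewrite lerDl ltW.
have It : `]0, T[%classic t by apply: sub; rewrite t0 lerDl ltW.
have uMt : bounded (u t) M by apply: uM; rewrite t0 lerDl ltW.
have := mild _ IT; apply: filterS2 (duhamel_split d0 p2 dp t0 r0 gu) => x -> ->.
rewrite (addrC t r) (heat_mild x r0 t0 u0L gut (uL t It).1.1 uMt (mild _ It)).
by rewrite opprD addrA addrK.
Qed.

(** Continuity of [w] at its initial time is not part of being a solution, and it cannot be read off
    the heat flow, which is not strongly continuous on [L^oo]. Instead [w s] is compared with
    [u (t + s)]: by [mild_restart] the heat parts agree, so the difference consists of two Duhamel
    terms of size [s^alpha], and [u] is continuous at [t]. *)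
Lemma restart_close (u0 : field) u w T t T' : in_Lp p u0 -> strong `]0, T[ u0 u ->
  0 < t < T -> 0 < T' -> strong `]0, T'] (u t) w ->
  forall eps : R, 0 < eps -> exists2 delta : R, 0 < delta &
    forall s, 0 < s <= T' -> s < delta ->
    (Lp_norm p (fun x => (w s x - u t x)%R) <= eps%:E)%E.
Proof.
move=> u0L su /andP[t0 tT] T'0 sw eps eps0.
have [uL cu bu _] := su; have [wL cw bw mildw] := sw.
pose r := (T - t) / 2; have r0 : 0 < r by rewrite divr_gt0// subr_gt0.
have trT : t + r < T by rewrite -ltrBrDl ltr_pdivrMr// ltr_pMr ?ltr1n// subr_gt0.
have sub s : 0 < s <= t + r -> `]0, T[%classic s.
  by move=> /andP[s0 st]; rewrite /= in_itv/= s0 (le_lt_trans st).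
have It : `]0, T[%classic t by apply: sub; rewrite t0 lerDl ltW.
have Itr : `]0, T[%classic (t + r) by apply: sub; rewrite lexx addr_gt0.
have [M gu uM] := good_family_solution (fun s Is => (uL s Is).1) cu bu Itr sub.
have IT' : `]0, T']%classic T' by rewrite /= in_itv/= T'0 lexx.
have sub' s : 0 < s <= T' -> `]0, T']%classic s by rewrite /= in_itv.
have [N gw wN] := good_family_solution (fun s Is => (wL s Is).1) cw bw IT' sub'.
have a0 := scaling_exponent_gt0 p2 dp.
have C0 : 0 < @duhamel_C R d p by rewrite divr_gt0 ?oseen_C_gt0.
pose K := d%:R * (@duhamel_C R d p * M ^+ 2) + d%:R * (@duhamel_C R d p * N ^+ 2).
have K0 : 0 <= K.
  by rewrite addr_ge0// (mulr_ge0 _ (mulr_ge0 (ltW C0) (sqr_ge0 _))).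
have [delta1 delta10 H1] := (Lp_continuous_onP p _ _).1 cu t It _ (divr_gt0 eps0 (ltr0n _ 2)).
(* For [s] below the [1/alpha]-th power of [e'], the two Duhamel terms together are at most
   [K e' <= eps / 2]. *)
pose e' := eps / 2 / (K + 1); have e'0 : 0 < e' by rewrite !divr_gt0// ltr_wpDl.
exists (Num.min (Num.min delta1 r) (e' `^ alpha^-1)).
  by rewrite !lt_min delta10 r0 powR_gt0.
move=> s /andP[s0 sT']; rewrite !lt_min => /andP[/andP[sd sr] se].
have tsr : 0 < t + s <= t + r by rewrite addr_gt0//= lerD2l ltW.
have Its := sub _ tsr.
have tsT : t + s < T by move: Its; rewrite /= in_itv/= => /andP[].
have Iw : `]0, T']%classic s by rewrite /= in_itv/= s0.
have gus : good_family (fun s => u (t + s)) s M.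
  by apply: good_family_shift (ltW t0); apply: good_family_sub gu _; rewrite lerD2l ltW.
have gws : good_family w s N by exact: good_family_sub gw sT'.
have mu' := (uL _ Its).1.1; have mut := (uL _ It).1.1; have mw := (wL _ Iw).1.1.
have mD1 := measurable_duhamel_field gus; have mD2 := measurable_duhamel_field gws.
have E1 : (Lp_norm p (fun x => (w s x - u (t + s) x)%R) <= (K * s `^ alpha)%:E)%E.
  rewrite (@Lp_norm_ae_eq _ _ p p2 _ (fun x => duhamel (fun s => u (t + s)) s x - duhamel w s x)).
  - apply: (le_trans (Lp_normB p2 mD1 mD2)).
    rewrite /K mulrDl EFinD -!(mulrA d%:R).
    by apply: leeD; exact: duhamel_norm_le.
  - exact: measurable_fieldB.
  - exact: measurable_fieldB.
  have := mildw s Iw; apply: filterS2 (mild_restart u0L su t0 s0 tsT) => x -> ->.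
  by rewrite opprB addrC addrA subrK.
have E2 : (Lp_norm p (fun x => (u (t + s)%R x - u t x)%R) <= (eps / 2)%:E)%E.
  by apply: H1 => //; rewrite addrAC subrr add0r gtr0_norm.
have E3 : K * s `^ alpha <= eps / 2.
  have sa : s `^ alpha <= e'.
    have -> : e' = (e' `^ alpha^-1) `^ alpha.
      by rewrite -powRrM mulVf ?gt_eqF// powRr1 ?ltW.
    by apply: ge0_ler_powR; rewrite ?nnegrE ?powR_ge0// ltW.
  apply: (@le_trans _ _ ((K + 1) * e')); last first.
    by rewrite /e' mulrC divfK// gt_eqF// ltr_wpDl.
  apply: ler_pM; rewrite ?powR_ge0// lerDl//.
rewrite (_ : (fun x => (w s x - u t x)%R) =
  (fun x => (w s x - u (t + s) x) + (u (t + s) x - u t x))); last first.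
  by apply/funext => x; rewrite addrA subrK.
apply: (le_trans (Lp_normD p2 (measurable_fieldB mw mu') (measurable_fieldB mu' mut))).
rewrite [eps]splitr EFinD; apply: leeD => //.
by apply: (le_trans E1); rewrite lee_fin.
Qed.

Definition splice u w t s : field := if s <= t then u s else w (s - t).

Lemma spliceL u w t s : s <= t -> splice u w t s = u s.
Proof. by rewrite /splice => ->. Qed.

Lemma spliceR u w t s : t < s -> splice u w t s = w (s - t).
Proof. by rewrite /splice leNgt => ->. Qed.

(** The junction is the point at issue. Continuity there is that of [u] from the left and
    [restart_close] from the right; the mild identity after [t] is obtained by undoing the
    cancellation of [mild_restart]. *)
Lemma strong_splice (u0 : field) u w T t T' : in_Lp p u0 -> strong `]0, T[ u0 u ->
  0 < t < T -> 0 < T' -> strong `]0, T'] (u t) w -> strong `]0, t + T'[ u0 (splice u w t).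
Proof.
move=> u0L su tT T'0 sw; have [uL cu bu mildu] := su; have [wL cw bw mildw] := sw.
have [t0 tltT] := andP tT.
have Iu s : 0 < s -> s <= t -> `]0, T[%classic s.
  by move=> s0 st; rewrite /= in_itv/= s0 (le_lt_trans st).
have Iw s : t < s -> s < t + T' -> `]0, T']%classic (s - t).
  by move=> ts sT; rewrite /= in_itv/= subr_gt0 ts/= lerBlDl ltW.
have zL s : `]0, t + T'[%classic s -> in_Lp_sigma p (splice u w t s).
  rewrite /= in_itv/= /splice => /andP[s0 sT].
  have [st|ts] := leP s t; first by apply: uL; exact: Iu.
  by apply: wL; exact: Iw.
have cz : Lp_continuous_on p `]0, t + T'[ (splice u w t).
  apply/Lp_continuous_onP => s0; rewrite /= in_itv/= => /andP[s00 s0T] eps eps0.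
  have [s0t|ts0|s0t] := ltgtP s0 t.
  - have Is0 := Iu _ s00 (ltW s0t).
    have [delta delta0 H] := (Lp_continuous_onP p _ _).1 cu _ Is0 _ eps0.
    exists (Num.min delta (t - s0)); first by rewrite lt_min delta0 subr_gt0.
    move=> s; rewrite in_itv/= lt_min => /andP[s_gt0 sT] /andP[sd st].
    have {}st : s <= t.
      by rewrite -(lerD2r (- s0)) ltW// (le_lt_trans _ st)// ler_norm.
    by rewrite (spliceL _ _ st) (spliceL _ _ (ltW s0t)); apply: H => //; exact: Iu.
  - have Is0 := Iw _ ts0 s0T.
    have [delta delta0 H] := (Lp_continuous_onP p _ _).1 cw _ Is0 _ eps0.
    exists (Num.min delta (s0 - t)); first by rewrite lt_min delta0 subr_gt0.
    move=> s; rewrite in_itv/= lt_min => /andP[s_gt0 sT] /andP[sd st].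
    have {}st : t < s.
      move: st; rewrite distrC => /(le_lt_trans (ler_norm _)).
      by rewrite ltrD2l ltrN2.
    rewrite !spliceR//; apply: H; first exact: Iw.
    by rewrite opprB addrA subrK.
  - rewrite {}s0t in s00 s0T *; have Is0 := Iu _ t0 (lexx t).
    have [delta delta0 H] := (Lp_continuous_onP p _ _).1 cu _ Is0 _ eps0.
    have [delta' delta'0 H'] := restart_close u0L su tT T'0 sw eps0.
    exists (Num.min delta delta'); first by rewrite lt_min delta0.
    move=> s; rewrite in_itv/= lt_min => /andP[s_gt0 sT] /andP[sd st].
    rewrite /splice lexx; have [le_st|lt_ts] := leP s t.
      by apply: H => //; exact: Iu.
    apply: H'; first by have := Iw _ lt_ts sT; rewrite /= in_itv.
    by move: st; rewrite ger0_norm// subr_ge0 ltW.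
have bz : Lp_bounded_on p `]0, t + T'[ (splice u w t).
  move=> s0; rewrite /= in_itv/= => /andP[s00 s0T].
  have [M uM] := bu t (Iu t t0 (lexx t)).
  have [N wN] := bw T' ltac:(by rewrite /= in_itv/= T'0 lexx).
  exists (Num.max M N) => s /andP[s_gt0 ss0].
  have sT := le_lt_trans ss0 s0T.
  rewrite EFin_max /splice; have [le_st|lt_ts] := leP s t.
    by rewrite le_max uM// s_gt0.
  by rewrite le_max wN ?orbT//; have := Iw _ lt_ts sT; rewrite /= in_itv.
split => // r; rewrite /= in_itv/= => /andP[r0 rT].
have [le_rt|lt_tr] := leP r t.
  rewrite (spliceL _ _ le_rt) (@eq_duhamel _ u); first by apply: mildu; exact: Iu.
  by move=> s /andP[_ sr]; rewrite spliceL// (ltW (lt_le_trans sr le_rt)).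
have Ir := Iw _ lt_tr rT; have tr0 : 0 < r - t by rewrite subr_gt0.
have Izr : `]0, t + T'[%classic (t + (r - t)).
  by rewrite subrKC /= in_itv/= r0.
have subz s : 0 < s <= t + (r - t) -> `]0, t + T'[%classic s.
  by rewrite subrKC => /andP[s0 sr]; rewrite /= in_itv/= s0 (le_lt_trans sr).
have [M gz _] := good_family_solution (fun s Is => (zL s Is).1) cz bz Izr subz.
have subu s : 0 < s <= t -> `]0, T[%classic s by move=> /andP[]; exact: Iu.
have It := Iu _ t0 (lexx t).
have [N gu uN] := good_family_solution (fun s Is => (uL s Is).1) cu bu It subu.
have uNt : bounded (u t) N by apply: uN; rewrite t0 lexx.
(* The Duhamel term of the spliced family splits at [t] into the history of [u] and a Duhamel term
   of [w]; [heat_mild] turns the history into the data of [w]. *)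
have := mildw _ Ir; apply: filterS2 (duhamel_split d0 p2 dp t0 tr0 gz) => x.
rewrite subrKC (spliceR _ _ lt_tr) => -> ->.
have -> : duhamel (splice u w t) t = duhamel u t.
  by apply: eq_duhamel => s /andP[_ st]; rewrite spliceL// ltW.
have -> : duhamel (fun s => splice u w t (t + s)) (r - t) = duhamel w (r - t).
  apply: eq_duhamel => s /andP[s0 _].
  by rewrite spliceR ?ltrDl// addrAC subrr add0r.
have := heat_mild x tr0 t0 u0L gu (uL t It).1.1 uNt (mildu _ It).
by rewrite subrK => ->; rewrite opprD addrA addrK.
Qed.

(** The maximal time is a supremum over all solutions with data [u0], and the spliced one competes
    in it. *)
Lemma max_existence_time_restart (u0 : field) u w T t T' : in_Lp p u0 ->
  strong `]0, T[ u0 u -> 0 < t < T -> 0 < T' -> strong `]0, T'] (u t) w ->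
  ((t + T')%:E <= max_existence_time p u0)%E.
Proof.
move=> u0L su tT T'0 sw; apply: ereal_sup_ubound; exists (t + T') => //; split.
  by rewrite addr_gt0//; move: tT => /andP[].
by exists (splice u w t); exact: strong_splice u0L su tT T'0 sw.
Qed.

End splicing.

(** * Local existence with a lower bound on the life span *)

Section local_existence.
Context {R : realType} {d : nat}.
Local Notation mu := (@lebesgue_rV R d).
Local Notation field := ('rV[R]_d -> 'rV[R]_d).
Implicit Types (x y z : 'rV[R]_d) (i j : 'I_d) (s t r T m : R) (v : field) (u w : R -> field) (I : set R).
Variable p : \bar R.
Hypothesis p2 : (2%:E < p)%E.
Hypothesis dp : (d%:R%:E < p)%E.

Let p0 : (0 < p)%E. Proof. by apply: lt_trans p2. Qed.

Local Notation alpha := (scaling_exponent d p).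
Local Notation strong := (@strong_solution_on R d p).

Lemma strong_solution_subset v w T T' : T' <= T ->
  strong `]0, T] v w -> strong `]0, T'] v w.
Proof.
move=> TT [wL cw bw mildw].
have sub s : `]0, T']%classic s -> `]0, T]%classic s.
  by rewrite /= !in_itv/= => /andP[-> /le_trans ->].
split.
- by move=> s /sub; exact: wL.
- apply/Lp_continuous_onP => s Is eps eps0.
  have [delta delta0 H] := (Lp_continuous_onP p _ _).1 cw s (sub _ Is) _ eps0.
  by exists delta => // s' /sub; exact: H.
- by move=> s /sub; exact: bw.
- by move=> s /sub; exact: mildw.
Qed.

Lemma Lp_norm0 : Lp_norm p (fun=> 0 : 'rV[R]_d) = 0%E.
Proof.
rewrite /Lp_norm (_ : (fun x => _) = cst 0%E); last first.
  by apply/funext => x; rewrite enorm0.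
by rewrite Lnorm0// gt_eqF.
Qed.

Lemma heat_leray_div0 t x : heat_leray_div t (fun=> 0) x = 0 :> 'rV[R]_d.
Proof.
apply/rowP => i; rewrite !mxE; under eq_Rintegral => y _.
  rewrite big1; last first.
    by move=> j _; rewrite big1// => k _; rewrite !mxE !mulr0.
  over.
by rewrite /Rintegral integral0.
Qed.

(** Covers the data about which [is_cp] is silent. They vanish almost everywhere, so their heat flow
    is zero. *)
Lemma strong_solution0 v T : in_Lp p v -> Lp_norm p v = 0%E ->
  strong `]0, T] v (fun=> fun=> 0).
Proof.
move=> [mv _] v0.
have ve : {ae mu, forall y, v y = 0}.
  have mev : measurable_fun [set: 'rV[R]_d] (fun y => (enorm (v y))%:E).
    by apply/measurable_EFinP; exact: measurable_enorm_field.
  have := Lnorm_eq0_eq0 mev p0 v0; apply: filterS => y /(_ I)[] y0.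
  by apply/rowP => i; rewrite enorm_eq0// mxE.
split.
- move=> s _; split; first by split; [exact: measurable_cst|rewrite Lp_norm0].
  move=> phi _; under eq_Rintegral => y _.
    rewrite big1; last by move=> i _; rewrite mxE mul0r.
    over.
  by rewrite /Rintegral integral0.
- apply/Lp_continuous_onP => s _ eps eps0; exists 1 => // s' _ _.
  rewrite (_ : (fun x => _) = (fun=> 0)); first by rewrite Lp_norm0 lee_fin ltW.
  by apply/funext => x; rewrite subrr.
- by move=> s _; exists 0 => s' _; rewrite Lp_norm0.
- move=> s _; apply: nearW => x; apply/rowP => i; rewrite !mxE.
  rewrite [X in _ - X](_ : _ = 0); last first.
    under eq_Rintegral do rewrite heat_leray_div0 mxE.
    by rewrite /Rintegral integral0.
  rewrite subr0 -[LHS](_ : \int[mu]_(y in setT) 0 = 0); last by rewrite /Rintegral integral0.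
  congr fine; apply: ae_eq_integral => //.
  + apply/measurable_EFinP; apply: measurable_funM.
      exact: (measurableT_comp (measurable_heat_kernel s) (measurable_subrV x)).
    exact: measurable_field_coord.
  + by apply: filterS ve => y -> _; rewrite mxE mulr0.
Qed.

(** [is_cp] speaks of the one time at which its equation holds. Under the inequality assumed here
    [T] lies below that time, and the solution is restricted. *)
Lemma exists_solution cp v T m : is_cp d p cp -> in_Lp_sigma p v -> 0 < T ->
  (Lp_norm p v <= m%:E)%E -> m * T `^ alpha <= cp ->
  exists w, strong `]0, T] v w.
Proof.
move=> [/andP[cp0 _] H] vL T0 vm mT; have := Lp_norm_ge0 p v.
case E : (Lp_norm p v) vm => [n| |]//; rewrite !lee_fin => nm.
rewrite le_eqVlt => /predU1P[n0|n0].
  exists (fun=> fun=> 0); apply: strong_solution0; first exact: vL.1.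
  by rewrite E -n0.
have a0 := scaling_exponent_gt0 p2 dp.
pose T' := (cp / n) `^ alpha^-1; have cn : 0 < cp / n by rewrite divr_gt0.
have T'a : T' `^ alpha = cp / n.
  by rewrite -powRrM mulVf ?gt_eqF// powRr1 ?ltW.
have T'0 : 0 < T' by rewrite powR_gt0.
have TT : T <= T'.
  rewrite leNgt; apply/negP => T'T.
  have : T' `^ alpha < T `^ alpha by apply: gt0_ltr_powR; rewrite ?nnegrE ?ltW.
  rewrite T'a ltr_pdivrMr// mulrC ltNge => /negP; apply.
  by apply: le_trans mT; rewrite ler_wpM2r// powR_ge0.
have := H v vL T' T'0.
rewrite E T'a -EFinM mulrC divfK ?gt_eqF// => /(_ erefl)[w [sw _ _]].
by exists w; exact: strong_solution_subset sw.
Qed.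

End local_existence.

(** * Heat flow of sparse data *)

Lemma Lp_leD {R : realType} dT (T : measurableType dT)
    (m : {sigma_finite_measure set T -> \bar R}) (p : \bar R) (f g : T -> R) (A B : R) :
  (1 <= p)%E -> 0 <= A -> 0 <= B ->
  measurable_fun [set: T] f -> measurable_fun [set: T] g ->
  (forall x, 0 <= f x) -> (forall x, 0 <= g x) ->
  Lp_le m p f A -> Lp_le m p g B -> Lp_le m p (fun x => f x + g x) (A + B).
Proof.
move=> p1 A0 B0 mf mg f0 g0 /(Lnorm_leP _ p1 A0 f0) fA /(Lnorm_leP _ p1 B0 g0) gB.
apply/(Lnorm_leP _ p1); [exact: addr_ge0|by move=> x; exact: addr_ge0|].
have H := @eminkowski _ _ _ m f g p mf mg p1.
by apply: (le_trans H); rewrite EFinD; exact: leeD.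
Qed.

Section sparse_heat.
Context {R : realType} {d : nat}.
Local Notation mu := (@lebesgue_rV R d).
Local Notation field := ('rV[R]_d -> 'rV[R]_d).
Implicit Types (x y z : 'rV[R]_d) (i j : 'I_d) (s t r l tau M beta th : R) (v : field) (S : set 'rV[R]_d).
Local Notation e := (fun p : \bar R => fine p^-1%E).

Lemma measurable_eball x r : measurable (eball x r).
Proof.
rewrite (_ : eball x r = (fun y => enorm (y - x)) @^-1` `]-oo, r[); last first.
  by apply/seteqP; split => y; rewrite /eball /= in_itv.
rewrite -[X in measurable X]setTI.
exact: (measurableT_comp measurable_enorm (measurable_subrVr x)).
Qed.

(** The ball lies in a cube of side [2 r]; this crude volume is one source of the [2^d] in
    [sparse_C]. *)
Lemma eball_measure_le x r : 0 <= r -> (mu (eball x r) <= ((2 * r) ^+ d)%:E)%E.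
Proof.
move=> r0; pose A i := `[x ord0 i - r, x ord0 i + r]%classic.
have mA i : measurable (A i) by exact: measurable_itv.
have := lebesgue_rV_box mA; rewrite (eq_bigr (fun=> (2 * r)%:E)); last first.
  move=> i _; rewrite lebesgue_measure_itv/= lte_fin.
  by case: ltP => h; rewrite -?EFinB; congr _%:E; lra.
have -> : (\prod_(i < d) (2 * r)%:E = ((2 * r) ^+ d)%:E)%E.
  by rewrite prodEFin prodr_const card_ord.
move=> <-; apply: le_measure; rewrite ?inE.
- exact: measurable_eball.
- rewrite (_ : [set v | _] = \bigcap_(i in [set: 'I_d])
      ((fun v : 'rV[R]_d => v ord0 i) @^-1` A i)); last first.
    by apply/seteqP; split=> y /= Ay i => [_|]; exact: Ay.
  apply: fin_bigcap_measurable => // i _; rewrite -[X in measurable X]setTI.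
  exact: (@measurable_coord _ R).
move=> y /= yx i; rewrite /A /= in_itv/= -ler_distl.
have := ler_coord_enorm (y - x) i; rewrite !mxE => /le_trans; apply.
exact: ltW.
Qed.

(** Half of the Gaussian exponent is kept as decay; the other half is the kernel at time [2 t],
    still of mass one up to the factor [2^(d/2)]. *)
Lemma heat_kernel_far t x : 0 < t ->
  heat_kernel t x <=
  2 `^ (d%:R / 2) * expR (- (enorm x ^+ 2 / (8 * t))) * heat_kernel (2 * t) x.
Proof.
move=> t0; rewrite /heat_kernel mulrACA le_eqVlt; apply/orP; left; apply/eqP.
congr (_ * _); last first.
  by rewrite -expRD; congr expR; field; rewrite gt_eqF.
have c0 : 0 <= 4 * pi * t by rewrite !mulr_ge0 ?pi_ge0// ltW.
rewrite (_ : 4 * pi * (2 * t) = 2 * (4 * pi * t)); last by ring.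
rewrite (powRM _ _ c0)// mulrA -powRD; last by apply/implyP => _; rewrite pnatr_eq0.
by rewrite subrr powRr0 mul1r.
Qed.

Variable p : \bar R.
Hypothesis p2 : (2%:E < p)%E.

Let p1 : (1 < p)%E.
Proof. by apply: lt_trans p2; rewrite lte_fin ltr1n. Qed.

Let p0 : (0 <= p)%E. Proof. exact: le_trans (ltW p1). Qed.

Local Notation bounded v M := (Lp_le mu p (fun y => enorm (v y)) M).

(** The three terms are the three applications of Schur's test. For points of [S] near [x] the mass
    in [y] is at most [a], peak times measure, while the mass in [x] is only bounded by one; this is
    why [a] carries the exponent [1 - 1/p], the one imposed on [eps] in the theorem. *)
Lemma heat_sparse_le v S M tau l beta th : 0 < tau -> 0 < M -> 0 <= l -> 0 <= beta -> 0 <= th ->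
  measurable_fun [set: 'rV[R]_d] v -> measurable S -> bounded v M ->
  (Lp_norm_on (~` S) p v <= (beta * M)%:E)%E ->
  (forall x, (mu (S `&` eball x l) <= th%:E)%E) ->
  (Lp_norm p (heat tau v) <= (d%:R * ((beta +
     2 `^ (d%:R / 2) * expR (- (l ^+ 2 / (8 * tau))) +
     (@heat_peak R d tau * th) `^ (1 - e p)) * M))%:E)%E.
Proof.
move=> tau0 M0 l0 beta0 th0 mv mS vM vS Sl.
set eta := 2 `^ _ * expR _; set a := _ * th.
have eta0 : 0 <= eta by rewrite mulr_ge0 ?powR_ge0 ?expR_ge0.
have a0 : 0 <= a by rewrite mulr_ge0 ?heat_peak_ge0.
have P0 := @heat_peak_ge0 R d tau.
pose N y := enorm (v y); have mN : measurable_fun setT N by exact: measurable_enorm_field.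
have N0 y : 0 <= N y by exact: enorm_ge0.
pose K (w : 'rV[R]_d * 'rV[R]_d) := heat_kernel tau (w.1 - w.2).
have mK : measurable_fun setT K by exact: (measurableT_comp (measurable_heat_kernel tau) measurable_subrV2).
have K0 w : 0 <= K w by exact: heat_kernel_ge0.
pose far : set ('rV[R]_d * 'rV[R]_d) := [set w | l <= enorm (w.1 - w.2)].
have mfar : measurable far.
  rewrite (_ : far = (fun w : 'rV[R]_d * 'rV[R]_d => enorm (w.1 - w.2)) @^-1` `[l, +oo[); last first.
    by apply/seteqP; split => w; rewrite /far /= in_itv/= andbT.
  rewrite -[X in measurable X]setTI.
  exact: (measurableT_comp measurable_enorm measurable_subrV2).
pose Kf w := K w * \1_far w.
pose Kn w := K w * (\1_(~` far) w * \1_S w.2).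
have mKf : measurable_fun setT Kf by apply: measurable_funM => //; exact: measurable_indic.
have mKn : measurable_fun setT Kn.
  apply: measurable_funM => //; apply: measurable_funM.
    by apply: measurable_indic; exact: measurableC.
  apply: (measurableT_comp (measurable_indic _)) => //.
have Kf0 w : 0 <= Kf w by rewrite mulr_ge0.
have Kn0 w : 0 <= Kn w by rewrite mulr_ge0// mulr_ge0.
pose NS y := N y * \1_(~` S) y.
have mNS : measurable_fun setT NS.
  by apply: measurable_funM => //; apply: measurable_indic; exact: measurableC.
have NS0 y : 0 <= NS y by rewrite mulr_ge0.
have bM0 : 0 <= beta * M by rewrite mulr_ge0// ltW.
have NSM : Lp_le mu p NS (beta * M).
  apply/(Lnorm_leP _ (ltW p1) bM0 NS0); apply: le_trans vS.
  rewrite /Lp_norm_on (_ : EFin \o NS = (fun x => (enorm (v x))%:E) \_ (~` S))//.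
  apply/funext => y; rewrite patchE /= /NS indicE.
  by case: ifP => _; rewrite ?mulr1 ?mulr0.
have K1 x : (\int[mu]_y (K (x, y))%:E <= 1%:E)%E by rewrite integral_heat_kernel.
have K1l y : (\int[mu]_x (K (x, y))%:E <= 1%:E)%E.
  by under eq_integral do rewrite /K /= heat_kernelB; rewrite integral_heat_kernel.
have far_le x y : Kf (x, y) <= eta * heat_kernel (2 * tau) (x - y).
  rewrite /Kf indicE; case: (boolP ((x, y) \in far)) => [|_]; last first.
    by rewrite mulr0 mulr_ge0// heat_kernel_ge0.
  rewrite inE /far /= => lxy; rewrite mulr1; apply: (le_trans (heat_kernel_far _ tau0)).
  rewrite ler_wpM2r ?heat_kernel_ge0// ler_wpM2l ?powR_ge0// ler_expR lerN2.
  by rewrite ler_pM2r ?invr_gt0 ?mulr_gt0// ler_sqr ?nnegrE ?enorm_ge0.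
have tau20 : 0 < 2 * tau by rewrite mulr_gt0.
have Kf1 x : (\int[mu]_y (Kf (x, y))%:E <= eta%:E)%E.
  apply: (@le_trans _ _ (\int[mu]_y (eta%:E * (heat_kernel (2 * tau) (x - y))%:E))%E).
    apply: ge0_le_integral => //.
    - by move=> y _; rewrite lee_fin.
    - by apply/measurable_EFinP; exact: (measurableT_comp mKf (measurable_pair1 x)).
    - apply/measurable_EFinP; apply: measurable_funM => //.
      exact: (measurableT_comp (measurable_heat_kernel _) (measurable_subrV x)).
    - by move=> y _; rewrite lee_fin.
  rewrite ge0_integralZl//; last 2 first.
  - apply/measurable_EFinP.
    exact: (measurableT_comp (measurable_heat_kernel _) (measurable_subrV x)).
  - by move=> y _; rewrite lee_fin heat_kernel_ge0.
  by rewrite integral_heat_kernel// mule1.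
have Kf1l y : (\int[mu]_x (Kf (x, y))%:E <= eta%:E)%E.
  apply: le_trans (Kf1 y); rewrite le_eqVlt; apply/orP; left; apply/eqP.
  apply: eq_integral => x _; congr (_%:E); rewrite /Kf /K /= heat_kernelB.
  suff farC : ((x, y) \in far) = ((y, x) \in far) by rewrite !indicE farC.
  by apply/idP/idP; rewrite !inE /far /= enormB.
have Kn1 x : (\int[mu]_y (Kn (x, y))%:E <= a%:E)%E.
  apply: (@le_trans _ _ (\int[mu]_y ((@heat_peak R d tau)%:E * (\1_(S `&` eball x l) y)%:E))%E).
    apply: ge0_le_integral => //.
    - by move=> y _; rewrite lee_fin.
    - by apply/measurable_EFinP; exact: (measurableT_comp mKn (measurable_pair1 x)).
    - apply/measurable_EFinP; apply: measurable_funM => //; apply: measurable_indic.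
      by apply: measurableI => //; exact: measurable_eball.
    move=> y _; rewrite -EFinM lee_fin /Kn ler_pM//; first exact: heat_kernel_le.
    rewrite -[leLHS]/(\1_(~` far) (x, y) * \1_S y) !indicE in_setI -natrM mulnb andbC ler_nat.
    case: (y \in S) => //=; rewrite (_ : ((x, y) \in ~` far) = (y \in eball x l))//.
    apply/idP/idP; rewrite !inE /far /eball /= enormB; first by move=> /negP; rewrite -ltNge.
    by move=> h; apply/negP; rewrite -ltNge.
  rewrite ge0_integralZl//; last first.
    by apply/measurable_EFinP/measurable_indic; apply: measurableI => //; exact: measurable_eball.
  rewrite integral_indic ?setIT//; last by apply: measurableI => //; exact: measurable_eball.
  have P0e : (0 <= (@heat_peak R d tau)%:E)%E by rewrite lee_fin.
  by rewrite /a EFinM; exact: (lee_wpmul2l P0e (Sl x)).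
have Kn1l y : (\int[mu]_x (Kn (x, y))%:E <= 1%:E)%E.
  apply: le_trans (K1l y); apply: ge0_le_integral => //.
  - by move=> x _; rewrite lee_fin.
  - by apply/measurable_EFinP; exact: (measurableT_comp mKn (measurable_pair2 y)).
  - by apply/measurable_EFinP; exact: (measurableT_comp mK (measurable_pair2 y)).
  by move=> x _; rewrite lee_fin /Kn ler_piMr.
(* The masses in [y] and in [x] are [1, 1] for the data off [S], [eta, eta] for distant points, and
   [a, 1] for near points of [S]. *)
have HA := @schur_Lp _ _ _ _ _ mu mu K mK K0 1 1 ler01 ler01 K1 p (beta * M) NS p1 bM0 K1l mNS NS0 NSM.
have HB := @schur_Lp _ _ _ _ _ mu mu Kf mKf Kf0 eta eta eta0 eta0 Kf1 p M N p1 (ltW M0) Kf1l mN N0 vM.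
have HC := @schur_Lp _ _ _ _ _ mu mu Kn mKn Kn0 a 1 a0 ler01 Kn1 p M N p1 (ltW M0) Kn1l mN N0 vM.
set A := (fun x : 'rV[R]_d => fine _) in HA.
set B := (fun x : 'rV[R]_d => fine _) in HB.
set C := (fun x : 'rV[R]_d => fine _) in HC.
have mA : measurable_fun setT A.
  by apply: measurableT_comp => //; exact: (@measurable_kernel_op _ _ _ _ _ mu K mK NS mNS).
have mB : measurable_fun setT B.
  by apply: measurableT_comp => //; exact: (@measurable_kernel_op _ _ _ _ _ mu Kf mKf N mN).
have mC : measurable_fun setT C.
  by apply: measurableT_comp => //; exact: (@measurable_kernel_op _ _ _ _ _ mu Kn mKn N mN).
have fge0 (f : 'rV[R]_d -> R) : (forall y, 0 <= f y) -> 0 <= fine (\int[mu]_y (f y)%:E)%E.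
  by move=> f0; apply: fine_ge0; apply: integral_ge0 => y _; rewrite lee_fin.
have A0 x : 0 <= A x by apply: fge0 => y; rewrite mulr_ge0.
have B0 x : 0 <= B x by apply: fge0 => y; rewrite mulr_ge0.
have C0 x : 0 <= C x by apply: fge0 => y; rewrite mulr_ge0.
have etaE : eta `^ (1 - e p) * eta `^ e p = eta.
  rewrite -powRD ?subrK ?powRr1//; apply/implyP => _; rewrite gt_eqF//.
  by rewrite mulr_gt0 ?powR_gt0 ?expR_gt0.
rewrite !powR1 !mul1r in HA; rewrite etaE in HB; rewrite powR1 mulr1 in HC.
have a'0 : 0 <= a `^ (1 - e p) by exact: powR_ge0.
apply: (Lp_norm_coord p2) => //.
- by rewrite mulr_ge0 ?(ltW M0)// !addr_ge0.
- exact: measurable_heat.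
move=> i; have HAB := Lp_leD (ltW p1) bM0 (mulr_ge0 eta0 (ltW M0)) mA mB A0 B0 (Lp_ub_le HA) (Lp_ub_le HB).
have HABC := Lp_leD (ltW p1) (addr_ge0 bM0 (mulr_ge0 eta0 (ltW M0))) (mulr_ge0 a'0 (ltW M0))
  (measurable_funD mA mB) mC (fun x => addr_ge0 (A0 x) (B0 x)) C0 HAB (Lp_ub_le HC).
rewrite !mulrDl; apply: Lp_le_mono HABC => //.
- apply: measurableT_comp => //; apply: measurable_field_coord; exact: measurable_heat.
- by apply: measurable_funD => //; exact: measurable_funD.
apply: nearW => x.
have Foo := heat_norm_integral p2 x tau0 M0 mv vM.
(* Each piece is dominated by a convergent integral, so that [fine] loses nothing and the pieces can
   be added as real numbers. *)
have fin (f : 'rV[R]_d -> R) : (forall y, 0 <= f y) -> measurable_fun setT f ->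
    (forall y, f y <= heat_kernel tau (x - y) * enorm (v y)) ->
    (\int[mu]_y (f y)%:E)%E = (fine (\int[mu]_y (f y)%:E)%E)%:E.
  move=> f0 mf fK; rewrite fineK// ge0_fin_numE; last first.
    by apply: integral_ge0 => y _; rewrite lee_fin.
  apply: (@le_lt_trans _ _ (\int[mu]_y (heat_kernel tau (x - y) * enorm (v y))%:E)%E).
    apply: ge0_le_integral => //.
    - by move=> y _; rewrite lee_fin.
    - exact/measurable_EFinP.
    - apply/measurable_EFinP; apply: measurable_funM => //.
      exact: (measurableT_comp mK (measurable_pair1 x)).
    - by move=> y _; rewrite lee_fin.
  exact: le_lt_trans Foo (ltry _).
have mKx := measurableT_comp mK (measurable_pair1 x).
have mKfx := measurableT_comp mKf (measurable_pair1 x).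
have mKnx := measurableT_comp mKn (measurable_pair1 x).
have EA : (\int[mu]_y (K (x, y) * NS y)%:E = (A x)%:E)%E.
  apply: fin => [y||y]; first by rewrite mulr_ge0.
    exact: measurable_funM.
  by rewrite ler_wpM2l// ler_piMr// indicE lern1 leq_b1.
have EB : (\int[mu]_y (Kf (x, y) * N y)%:E = (B x)%:E)%E.
  apply: fin => [y||y]; first by rewrite mulr_ge0.
    exact: measurable_funM.
  by rewrite ler_wpM2r// ler_piMr// indicE lern1 leq_b1.
have EC : (\int[mu]_y (Kn (x, y) * N y)%:E = (C x)%:E)%E.
  apply: fin => [y||y]; first by rewrite mulr_ge0.
    exact: measurable_funM.
  by rewrite ler_wpM2r// ler_piMr// !indicE -natrM mulnb lern1 leq_b1.
pose gA y := (K (x, y) * NS y)%:E; pose gB y := (Kf (x, y) * N y)%:E.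
pose gC y := (Kn (x, y) * N y)%:E.
have gA0 y : setT y -> (0 <= gA y)%E by rewrite lee_fin mulr_ge0.
have gB0 y : setT y -> (0 <= gB y)%E by rewrite lee_fin mulr_ge0.
have gC0 y : setT y -> (0 <= gC y)%E by rewrite lee_fin mulr_ge0.
have gAB0 y : setT y -> (0 <= gA y + gB y)%E by move=> Ty; rewrite adde_ge0 ?gA0 ?gB0.
have mgA : measurable_fun setT gA by apply/measurable_EFinP; exact: measurable_funM.
have mgB : measurable_fun setT gB by apply/measurable_EFinP; exact: measurable_funM.
have mgC : measurable_fun setT gC by apply/measurable_EFinP; exact: measurable_funM.
have mgAB := emeasurable_funD mgA mgB.
have ABC : (\int[mu]_y (gA y + gB y + gC y) = (A x + B x + C x)%:E)%E.
  rewrite (ge0_integralD mu measurableT gAB0 mgAB gC0 mgC).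
  by rewrite (ge0_integralD mu measurableT gA0 mgA gB0 mgB) EA EB EC.
rewrite -lee_fin -ABC.
rewrite mxE; apply: (@le_trans _ _ (\int[mu]_y `|heat_kernel tau (x - y) * v y ord0 i|%:E)%E).
  apply: normr_Rintegral_le => //.
  exact: (measurableT_comp (measurable_heat_integrand2 tau i mv) (measurable_pair1 x)).
apply: ge0_le_integral => //.
- apply/measurable_EFinP; apply: measurableT_comp => //.
  exact: (measurableT_comp (measurable_heat_integrand2 tau i mv) (measurable_pair1 x)).
- exact: emeasurable_funD.
move=> y _; rewrite -!EFinD lee_fin normrM (ger0_norm (K0 (x, y))).
apply: (@le_trans _ _ (K (x, y) * N y)).
  by rewrite ler_wpM2l// ler_coord_enorm.
(* Every [y] is off [S], far from [x], or a near point of [S]; the pieces may overlap, which only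
   helps an upper bound. *)
have := mulr_ge0 (K0 (x, y)) (N0 y).
rewrite /NS /Kf /Kn !indicE /= !in_setC.
by case: (_ \in far); case: (_ \in S) => /=; rewrite ?mulr0 ?mulr1 ?mul0r ?addr0 ?add0r => h; lra.
Qed.

End sparse_heat.

(** * Choice of the constant *)

Section sparse_bound.
Context {R : realType} {d : nat}.
Local Notation mu := (@lebesgue_rV R d).
Local Notation field := ('rV[R]_d -> 'rV[R]_d).
Implicit Types (v : field) (M eps beta lbar gamma T : R).
Variable p : \bar R.
Hypothesis p2 : (2%:E < p)%E.
Local Notation e := (fine p^-1%E).

Let p1 : (1 < p)%E.
Proof. by apply: lt_trans p2; rewrite lte_fin ltr1n. Qed.

(** Chosen so that three terms of size [2^d gamma / sparse_C], times the factor [d] of the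
    coordinates, add up to exactly [gamma / 2]. *)
Definition sparse_C : R := 6 * d%:R * 2 ^+ d.

Lemma sparse_C_ge : (0 < d)%N -> 4 <= sparse_C.
Proof.
move=> d0; apply: (@le_trans _ _ (6 * 1 * 1)); first by rewrite !mulr1 ler_nat.
by rewrite /sparse_C !ler_pM// ?ler1n// ?exprn_ege1// ?mulr1// ler1n.
Qed.

Lemma sparse_measure_le eps beta l v (S : set 'rV[R]_d) x : 0 <= eps -> 0 <= l -> measurable S ->
  (ereal_sup [set mu (S `&` eball x0 l) / mu (eball x0 l) |
     x0 in [set: 'rV[R]_d]] <= eps%:E)%E ->
  (mu (S `&` eball x l) <= (eps * (2 * l) ^+ d)%:E)%E.
Proof.
move=> eps0 l0 mS H; have Bl := eball_measure_le x l0.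
have mB := @measurable_eball R d x l; have SB : (mu (S `&` eball x l) <= mu (eball x l))%E.
  by apply: le_measure; rewrite ?inE//; exact: measurableI.
have : (mu (S `&` eball x l) / mu (eball x l) <= eps%:E)%E.
  by apply: le_trans H; apply: ereal_sup_ubound; exists x.
have B0 : (0 <= mu (eball x l))%E by exact: measure_ge0.
case E : (mu (eball x l)) Bl SB B0 => [b| |]//; rewrite !lee_fin => bl SB.
(* For a ball of measure zero the quotient gives no information, but then [S] meets the ball in a
   null set. *)
rewrite le_eqVlt => /predU1P[b0 _|b0].
  by apply: (le_trans SB); rewrite -b0 lee_fin mulr_ge0// exprn_ge0// mulr_ge0.
rewrite inver gt_eqF// lee_pdivrMr// -EFinM => /le_trans; apply.
by rewrite lee_fin ler_wpM2l.
Qed.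

(** The peak at time [T1 / 2] is [(2 pi T1)^(-d/2)], which offsets the volume [T1^(d/2)] of a ball
    of radius [sqrt T1]; what remains depends on [lbar] alone. *)
Lemma heat_peak_scale (T1 : R) : 0 < T1 ->
  @heat_peak R d (T1 / 2) * Num.sqrt T1 ^+ d <= 1.
Proof.
move=> T10; have pi2 := @pi_ge2 R.
rewrite -(powR12_sqrt (ltW T10)) -powR_mulrn ?powR_ge0// -powRrM.
apply: (@le_trans _ _ (T1 `^ (- (d%:R / 2)) * T1 `^ (2^-1 * d%:R))).
  rewrite ler_wpM2r ?powR_ge0//; apply: le_powRN; rewrite ?divr_ge0//.
  rewrite mulrA ler_pdivlMr// mulrC ler_wpM2r ?ltW//; lra.
rewrite -powRD; last by apply/implyP => _; rewrite gt_eqF.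
by rewrite (mulrC 2^-1) addNr powRr0.
Qed.

Lemma sparse_heat_le v M eps beta lbar gamma (T1 : R) : (0 < d)%N -> in_Lp p v ->
  Lp_norm p v = M%:E -> 0 < M -> 0 < gamma <= 1 -> 0 < T1 ->
  0 < eps -> 0 < lbar ->
  sparse_C * ln (sparse_C / gamma) <= lbar ^+ 2 ->
  beta = sparse_C^-1 * gamma ->
  eps `^ (1 - e) <= sparse_C^-1 * gamma / lbar ^+ d ->
  sparse p eps beta (Num.sqrt T1 * lbar) v ->
  (Lp_norm p (heat (T1 / 2) v) <= (gamma * M / 2)%:E)%E.
Proof.
move=> d0 [mv _] vE M0 /andP[g0 g1] T10 eps0 lb0 hl hb he [S [mS vS Ssup]].
have C4 := sparse_C_ge d0; have Cg0 : 0 < sparse_C by apply: lt_le_trans C4.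
set q := sparse_C^-1 * gamma in hb he; have q0 : 0 < q by rewrite mulr_gt0 ?invr_gt0.
have q4 : q <= 4^-1.
  apply: (@le_trans _ _ (sparse_C^-1 * 1)); first by rewrite ler_wpM2l// invr_ge0 ltW.
  by rewrite mulr1 lef_pV2 ?posrE.
pose L := ln (sparse_C / gamma).
have LE : expR (- L) = q.
  by rewrite -lnV ?posrE ?divr_gt0// lnK ?posrE ?invr_gt0 ?divr_gt0// invf_div mulrC.
(* From [1 - L <= expR (- L) = q <= 1/4]. With [sparse_C >= 4] this gives [lbar^2 >= 4 L >= 3],
   hence [lbar >= 1]. *)
have L34 : 3 / 4 <= L by have := expR_ge1Dx (- L); rewrite LE; lra.
have L0 : 0 <= L by lra.
have lb4 : 4 * L <= lbar ^+ 2 by apply: le_trans hl; rewrite ler_wpM2r.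
have lb1 : 1 <= lbar.
  by rewrite -(ler_sqr _ (ltW lb0)) ?nnegrE// expr1n; lra.
pose l := Num.sqrt T1 * lbar; have l0 : 0 <= l by rewrite mulr_ge0 ?sqrtr_ge0 ?ltW.
have vM : Lp_le mu p (fun y => enorm (v y)) M by apply/(Lp_norm_leP p2 _ (ltW M0)); rewrite vE.
have tau0 : 0 < T1 / 2 by rewrite divr_gt0.
pose th := eps * (2 * l) ^+ d.
have th0 : 0 <= th by rewrite mulr_ge0 ?(ltW eps0)// exprn_ge0// mulr_ge0.
have vS' : (Lp_norm_on (~` S) p v <= (q * M)%:E)%E by rewrite ltW// EFinM -hb -vE.
have Sl x := @sparse_measure_le eps beta l v S x (ltW eps0) l0 mS Ssup.
have := heat_sparse_le p2 tau0 M0 l0 (ltW q0) th0 mv mS vM vS' Sl.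
move=> /le_trans; apply; rewrite lee_fin.
have q2 : (2 : R) `^ (d%:R / 2) <= 2 ^+ d.
  by rewrite -powR_mulrn// ler_powR ?ler1n// ler_pdivrMr// ler_peMr// ler1n.
(* The Gaussian exponent is [lbar^2 / 4 >= L]: this is the use of the logarithmic lower bound on
   [lbar]. *)
have e1 : expR (- (l ^+ 2 / (8 * (T1 / 2)))) <= q.
  have -> : l ^+ 2 / (8 * (T1 / 2)) = lbar ^+ 2 / 4.
    by rewrite /l exprMn sqr_sqrtr ?ltW//; field; rewrite gt_eqF.
  by rewrite -LE ler_expR lerN2; lra.
have /andP[e0 e1'] := inv_p_itv p2.
have twod1 : (1 : R) <= 2 ^+ d by rewrite exprn_ege1// ler1n.
have lbd1 : 1 <= lbar ^+ d by rewrite exprn_ege1.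
(* The exponent [1 - 1/p] stays on [eps]; on the factor [2^d lbar^d >= 1] it is replaced by [1],
   after which [lbar^d] cancels. *)
have e2 : (@heat_peak R d (T1 / 2) * th) `^ (1 - e) <= 2 ^+ d * q.
  apply: (@le_trans _ _ ((eps * (2 ^+ d * lbar ^+ d)) `^ (1 - e))).
    have X0 : 0 <= eps * (2 ^+ d * lbar ^+ d).
      by rewrite mulr_ge0 ?(ltW eps0)// mulr_ge0 ?exprn_ge0 ?(ltW lb0).
    apply: ge0_ler_powR; rewrite ?nnegrE ?subr_ge0//.
      by rewrite mulr_ge0 ?heat_peak_ge0.
    rewrite /th /l !exprMn (_ : _ * _ = eps * (2 ^+ d * lbar ^+ d) *
      (@heat_peak R d (T1 / 2) * Num.sqrt T1 ^+ d)); last by ring.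
    by rewrite ler_piMr ?heat_peak_scale.
  have X1 : 1 <= 2 ^+ d * lbar ^+ d by rewrite -[leLHS]mulr1 ler_pM.
  rewrite powRM ?(ltW eps0) ?(le_trans ler01 X1)//.
  apply: (@le_trans _ _ (q / lbar ^+ d * (2 ^+ d * lbar ^+ d))).
    apply: ler_pM; rewrite ?powR_ge0//.
    rewrite -[leRHS]powRr1 ?(le_trans ler01 X1)// ler_powR//; lra.
  by rewrite le_eqVlt; apply/orP; left; apply/eqP; field; rewrite gt_eqF// exprn_gt0.
apply: (@le_trans _ _ (d%:R * ((q + 2 ^+ d * q + 2 ^+ d * q) * M))).
  rewrite ler_wpM2l// ler_wpM2r ?(ltW M0)// lerD// lerD2l.
  by apply: ler_pM; rewrite ?powR_ge0 ?expR_ge0.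
apply: (@le_trans _ _ (d%:R * ((3 * 2 ^+ d * q) * M))).
  rewrite ler_wpM2l// ler_wpM2r ?(ltW M0)//.
  have : q <= 2 ^+ d * q by rewrite ler_peMl// ltW.
  by move=> h; lra.
rewrite /q /sparse_C le_eqVlt; apply/orP; left; apply/eqP; field.
by rewrite pnatr_eq0 -lt0n d0 expf_neq0.
Qed.

End sparse_bound.

Theorem corollary1p3 (R : realType) (d : nat) (p : \bar R)
    (hd : (3 <= d)%N) (hp : (d%:R%:E < p)%E) :
  exists C0 : R, 1 <= C0 /\
  forall cp C1 : R, is_cp d p cp -> is_C1 d p cp C1 ->
  forall (u0 : 'rV[R]_d -> 'rV[R]_d) (u : R -> 'rV[R]_d -> 'rV[R]_d)
    (Tstar : R),
  in_Lp_sigma p u0 ->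
  max_existence_time p u0 = Tstar%:E ->
  strong_solution_on p `]0, Tstar[ u0 u ->
  forall t gamma T1 : R, 0 < t < Tstar ->
  (Lp_norm p (u t) *
    ((Tstar - t) `^ scaling_exponent d p)%:E * gamma%:E = cp%:E)%E ->
  0 < T1 ->
  (Lp_norm p (u t) * (T1 `^ scaling_exponent d p)%:E =
    (gamma / (2 * C1))%:E)%E ->
  forall eps beta lbar : R,
  0 < eps < 1 -> 0 < beta < 1 -> 0 < lbar ->
  C0 * ln (C0 / gamma) <= lbar ^+ 2 ->
  beta = C0^-1 * gamma ->
  eps `^ (1 - fine p^-1%E) <= C0^-1 * gamma / lbar ^+ d ->
  ~ sparse p eps beta (Num.sqrt T1 * lbar) (u t).
Proof.
have d0 : (0 < d)%N by exact: leq_trans hd.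
have p2 : (2%:E < p)%E by apply: le_lt_trans hp; rewrite lee_fin ler_nat ltnW.
exists (@sparse_C R d); split.
  by apply: le_trans (sparse_C_ge d0); rewrite ler1n.
move=> cp C1 hcp [hC1 HC1] u0 u Tstar u0L hT su t gamma T1 tT hg T10 hT1.
move=> eps beta lbar /andP[eps0 _] _ lb0 hl hb he hsp.
have [/andP[cp0 cp1] Hcp] := hcp; have [t0 tT'] := andP tT.
have a0 := scaling_exponent_gt0 p2 hp; set alpha := scaling_exponent d p in a0 hg hT1 *.
have [uL _ _ _] := su.
have utL : in_Lp_sigma p (u t) by apply: uL; rewrite /= in_itv.
have := Lp_norm_ge0 p (u t); case E : (Lp_norm p (u t)) => [M| |]//; last first.
  by have := utL.1.2; rewrite E.
rewrite lee_fin => M0'; move: hg hT1; rewrite E -!EFinM => -[hg] -[hT1].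
have Tt0 : 0 < Tstar - t by rewrite subr_gt0.
have A0 : 0 < (Tstar - t) `^ alpha by exact: powR_gt0.
have M0 : 0 < M.
  rewrite lt_neqAle M0' andbT; apply/eqP => M0; move: hg cp0.
  by rewrite -M0 !mul0r => <-; rewrite ltxx.
have g0 : 0 < gamma by move: cp0; rewrite -hg pmulr_rgt0// mulr_gt0.
have C10 : 0 < C1 by apply: lt_le_trans hC1; rewrite invr_gt0 mulr_gt0.
(* The guaranteed life span of a solution with data [u t], solved from the defining equation of
   [cp]. *)
pose Tb := (cp / M) `^ alpha^-1; have Tb0 : 0 < Tb by rewrite powR_gt0 ?divr_gt0.
have Tba : M * Tb `^ alpha = cp.
  by rewrite /Tb -powRrM mulVf ?gt_eqF// powRr1 ?divr_ge0 ?ltW// mulrC divfK// gt_eqF.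
have TbE : (Lp_norm p (u t) * (Tb `^ alpha)%:E = cp%:E)%E by rewrite E -EFinM Tba.
have [w [sw _ _]] := Hcp _ utL _ Tb0 TbE.
have restart (z y : R -> 'rV[R]_d -> 'rV[R]_d) T s T' : strong_solution_on p `]0, T[ u0 z ->
    0 < s < T -> 0 < T' -> strong_solution_on p `]0, T'] (z s) y -> s + T' <= Tstar.
  move=> sz sT T'0 sy.
  by have := max_existence_time_restart d0 p2 hp u0L.1 sz sT T'0 sy; rewrite hT lee_fin.
have powR_mono a b : 0 <= a -> a <= b -> a `^ alpha <= b `^ alpha.
  by move=> a0' ab; apply: ge0_ler_powR; rewrite ?nnegrE ?(le_trans a0' ab)// ltW.
(* Otherwise the guaranteed life span from [u t] would exceed [Tstar - t]. *)
have g1 : gamma <= 1.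
  have TbT : Tb <= Tstar - t by rewrite lerBrDl; exact: restart su tT Tb0 sw.
  have := powR_mono _ _ (ltW Tb0) TbT.
  rewrite -(ler_pM2l M0) Tba -hg.
  by rewrite -[leRHS]mulr1 ler_pM2l// mulr_gt0.
(* Since [gamma <= 1] and [C1] is at least the inverse of [2 cp], the quotient [gamma / (2 C1)] is
   at most [cp], so [T1 <= Tb]. *)
have T1b : T1 / 2 < Tb.
  apply: (@lt_le_trans _ _ T1); first by rewrite ltr_pdivrMr// ltr_pMr// ltr1n.
  rewrite leNgt; apply/negP => TbT1.
  have : Tb `^ alpha < T1 `^ alpha by apply: gt0_ltr_powR; rewrite ?nnegrE ?ltW.
  rewrite -(ltr_pM2l M0) Tba hT1 ltNge => /negP; apply.
  rewrite ler_pdivrMr ?mulr_gt0//; apply: (le_trans g1).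
  by move: hC1; rewrite -[leLHS]mul1r ler_pdivrMr ?mulr_gt0//; lra.
have tau0 : 0 < T1 / 2 by rewrite divr_gt0.
pose tau := T1 / 2.
have g01 : 0 < gamma <= 1 by rewrite g0.
have Hheat := sparse_heat_le p2 d0 utL.1 E M0 g01 T10 eps0 lb0 hl hb he hsp.
have Hduh : (Lp_norm p (duhamel w tau) <= (gamma * M / 2)%:E)%E.
  have tauT : 0 < tau < Tb by rewrite tau0.
  have := HC1 _ utL _ Tb0 TbE _ sw _ tauT; rewrite E => /le_trans; apply.
  rewrite -EFin_expe -EFinM lee_fin.
  have : tau `^ alpha <= T1 `^ alpha.
    by apply: powR_mono; rewrite ?ltW// ltr_pdivrMr// ltr_pMr// ltr1n.
  move=> h; apply: (@le_trans _ _ (C1 * T1 `^ alpha * M ^+ 2)).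
    by rewrite ler_wpM2r ?sqr_ge0// ler_wpM2l// ltW.
  (* The choice of [T1] makes the last factor [gamma / (2 C1)], and [C1] cancels. *)
  rewrite (_ : C1 * _ * _ = C1 * M * (M * T1 `^ alpha)); last by ring.
  rewrite hT1 le_eqVlt; apply/orP; left; apply/eqP; field.
  by rewrite gt_eqF.
have [wL cw bw mildw] := sw.
have Iw : `]0, Tb]%classic tau by rewrite /= in_itv/= tau0 ltW.
have sub s : 0 < s <= tau -> `]0, Tb]%classic s.
  by move=> /andP[s0 st]; rewrite /= in_itv/= s0 (le_trans st)// ltW.
have [N gw _] := good_family_solution p2 (fun s Is => (wL s Is).1) cw bw Iw sub.
have mD := measurable_duhamel_field p2 gw.
have mH : measurable_fun setT (heat tau (u t)) by apply: measurable_heat; exact: utL.1.1.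
have Hw : (Lp_norm p (w tau) <= (gamma * M)%:E)%E.
  rewrite (Lp_norm_ae_eq p2 (wL _ Iw).1.1 (measurable_fieldB mH mD) (mildw _ Iw)).
  apply: (le_trans (Lp_normB p2 mH mD)).
  by rewrite [gamma * M]splitr EFinD; exact: leeD.
(* By the definition of [gamma] this is an equality: data of size [gamma M] are guaranteed to live
   for a time [Tstar - t]. *)
have mTa : gamma * M * (Tstar - t) `^ alpha <= cp by rewrite -hg; lra.
have [y sy] := exists_solution p2 hp hcp (wL _ Iw) Tt0 Hw mTa.
(* The second restart happens at [t + tau] and needs a solution from [u0] that takes the value
   [w tau] there. Adding the life span [Tstar - t] then gives [Tstar + tau <= Tstar]. *)
have sz := strong_splice d0 p2 hp u0L.1 su tT Tb0 sw.
have tauT : 0 < t + tau < t + Tb by rewrite addr_gt0//= ltrD2l.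
have zt : splice u w t (t + tau) = w tau.
  by rewrite spliceR ?ltrDl// addrAC subrr add0r.
have := restart _ y _ _ _ sz tauT Tt0; rewrite zt => /(_ sy).
by rewrite addrAC addrC -lerBrDr; rewrite /tau; lra.
Qed.
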